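(* Let $p$ be a prime and let $K/\mathbf{Q}_p$ be an unramified finite extension of degree $n$ with ring of integers $\mathcal{O}_K$, maximal ideal $\mathfrak{m}_K = p\mathcal{O}_K$ and residue field $k$. Let $E/K$ be an elliptic curve given by a Weierstrass equation over $\mathcal{O}_K$ of the form $$Y^2 + a_1 XY + a_3 Y = X^3 + a_2 X^2 + a_4 X + a_6$$ with $a_i \in \mathfrak{m}_K = p\mathcal{O}_K$ for each $i$. Then $E_0(K) \cong \mathbf{Z}_p^n$ as $\mathbf{Z}_p$-modules, except in the following four cases: (i) $p=2$ and the equation $\overline{a_3/2}\,x^3+\overline{a_1/2}\,x-1=0$ has a solution in $k$; (ii) $p=3$ and $N_{k/\mathbf{F}_p}(\overline{8a_2/3})=1$; (iii) $p=5$ and $N_{k/\mathbf{F}_p}(\overline{3a_4/5})=1$; (iv) $p=7$ and $N_{k/\mathbf{F}_p}(\overline{4a_6/7})=1$. In case (i), one has $E_0(K) \cong \mathbf{Z}_2^n \times (\mathbf{Z}/2\mathbf{Z})^b$ as $\mathbf{Z}_2$-modules, where $2^b$ is the number of solutions in $k$ of $\overline{a_3/2}\,X^4+\overline{a_1/2}\,X^2-X=0$. In cases (ii)-(iv), one has $E_0(K) \cong \mathbf{Z}_p^n \times \mathbf{Z}/p\mathbf{Z}$ as $\mathbf{Z}_p$-modules.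
   Context: The overline denotes reduction $\mathcal{O}_K \to k=\mathcal{O}_K/\mathfrak{m}_K$, and $N_{k/\mathbf{F}_p}: k\to\mathbf{F}_p$ is the norm map. $E_0(K)\subset E(K)$ is the subgroup of points whose reduction modulo $\mathfrak{m}_K$ (with respect to the given Weierstrass equation) is a non-singular point of the reduced curve over $k$. The group $E_0(K)$ carries a $\mathbf{Z}_p$-module structure extending its $\mathbf{Z}$-module structure (for $a\in\mathbf{Z}_p$ and integers $m_j\to a$ $p$-adically, $aP=\lim_j m_jP$ in the $p$-adic topology of $E(K)$); isomorphisms are of $\mathbf{Z}_p$-modules for this structure. *)

(* Defs.v *)
From HB Require Import structures.
From mathcomp Require Import all_boot all_order all_fingroup all_algebra all_field.
From mathcomp Require Import boolp classical_sets functions filter.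

Set Implicit Arguments.
Unset Strict Implicit.
Unset Printing Implicit Defensive.

Import GRing.Theory.
Local Open Scope classical_set_scope.
Local Open Scope ring_scope.

(* Z_p as the inverse limit of the Z/p^n: the n-th component is the           *)
(* representative in [0, p^n) of the residue class modulo p^n.  The proof of  *)
(* primality is an index of the type so that the domain structure, hence the  *)
(* field Q_p, can be inferred.                                                *)
Record padic_int (p : nat) (pr_p : prime p) := PadicInt {
  padic_res : nat -> int;
  _ : forall n, padic_res n = (padic_res n.+1 %% (p ^ n)%N)%Z }.

Section PadicInt.
Variables (p : nat) (pr_p : prime p).
Local Notation Zp := (padic_int pr_p).
Implicit Types (x y z : Zp) (m n : nat).

Lemma padic_resS x n : padic_res x n = (padic_res x n.+1 %% (p ^ n)%N)%Z.
Proof. by case: x. Qed.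

Lemma padic_res_mod x n : (padic_res x n %% (p ^ n)%N)%Z = padic_res x n.
Proof. by rewrite padic_resS modz_mod. Qed.

Lemma modz_pexp (c : int) m n : (m <= n)%N ->
  ((c %% (p ^ n)%N)%Z %% (p ^ m)%N)%Z = (c %% (p ^ m)%N)%Z.
Proof.
move=> le_mn; rewrite [in RHS](divz_eq c (p ^ n)%N).
by rewrite -(subnK le_mn) expnD PoszM mulrA modzMDl.
Qed.

Lemma padic_res_le x m n : (m <= n)%N ->
  padic_res x m = (padic_res x n %% (p ^ m)%N)%Z.
Proof.
move=> le_mn; rewrite -(subnK le_mn); elim: (n - m)%N => [|d IHd].
  by rewrite padic_res_mod.
by rewrite IHd padic_resS modz_pexp // leq_addl.
Qed.

Lemma padicP x y : padic_res x =1 padic_res y -> x = y.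
Proof.
case: x y => [f Hf] [g Hg] /= /funext eq_fg; case: _ / eq_fg in Hg *.
by congr PadicInt; apply: Prop_irrelevance.
Qed.

Lemma padic_mk_subproof (f : nat -> int) :
    (forall n, f n.+1 = f n %[mod (p ^ n)%N])%Z ->
  forall n, (f n %% (p ^ n)%N)%Z
    = ((f n.+1 %% (p ^ n.+1)%N)%Z %% (p ^ n)%N)%Z.
Proof. by move=> Hf n; rewrite modz_pexp. Qed.

Definition padic_mk f Hf : Zp := PadicInt pr_p (@padic_mk_subproof f Hf).

Lemma padic_step x n : (padic_res x n.+1 = padic_res x n %[mod (p ^ n)%N])%Z.
Proof. by rewrite [in RHS]padic_resS modz_mod. Qed.

Lemma padic_opp_subproof x n :
  (- padic_res x n.+1 = - padic_res x n %[mod (p ^ n)%N])%Z.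
Proof. by rewrite -modzNm padic_step modzNm. Qed.

Lemma padic_add_subproof x y n :
  (padic_res x n.+1 + padic_res y n.+1
   = padic_res x n + padic_res y n %[mod (p ^ n)%N])%Z.
Proof. by rewrite -modzDm !padic_step modzDm. Qed.

Lemma padic_mul_subproof x y n :
  (padic_res x n.+1 * padic_res y n.+1
   = padic_res x n * padic_res y n %[mod (p ^ n)%N])%Z.
Proof. by rewrite -modzMm !padic_step modzMm. Qed.

Definition padic_const (c : int) : Zp := @padic_mk (fun=> c) (fun=> erefl).
Definition padic_opp x := padic_mk (padic_opp_subproof x).
Definition padic_add x y := padic_mk (padic_add_subproof x y).
Definition padic_mul x y := padic_mk (padic_mul_subproof x y).

Lemma padic_addA : associative padic_add.
Proof. by move=> x y z; apply: padicP => n /=; rewrite modzDml modzDmr addrA. Qed.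

Lemma padic_addC : commutative padic_add.
Proof. by move=> x y; apply: padicP => n /=; rewrite addrC. Qed.

Lemma padic_add0 : left_id (padic_const 0) padic_add.
Proof. by move=> x; apply: padicP => n /=; rewrite modzDml add0r padic_res_mod. Qed.

Lemma padic_addN : left_inverse (padic_const 0) padic_opp padic_add.
Proof. by move=> x; apply: padicP => n /=; rewrite modzDml addNr. Qed.

Lemma padic_mulA : associative padic_mul.
Proof. by move=> x y z; apply: padicP => n /=; rewrite modzMml modzMmr mulrA. Qed.

Lemma padic_mulC : commutative padic_mul.
Proof. by move=> x y; apply: padicP => n /=; rewrite mulrC. Qed.

Lemma padic_mul1 : left_id (padic_const 1) padic_mul.
Proof. by move=> x; apply: padicP => n /=; rewrite modzMml mul1r padic_res_mod. Qed.

Lemma padic_mulD : left_distributive padic_mul padic_add.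
Proof.
by move=> x y z; apply: padicP => n /=; rewrite modzMml modzDml modzDmr mulrDl.
Qed.

HB.instance Definition _ := gen_eqMixin Zp.
HB.instance Definition _ := gen_choiceMixin Zp.
HB.instance Definition _ :=
  GRing.isZmodule.Build Zp padic_addA padic_addC padic_add0 padic_addN.

Lemma padic_1neq0 : padic_const 1 != 0 :> Zp.
Proof.
apply/eqP => /(congr1 (fun x : Zp => padic_res x 1)) /=.
by rewrite expn1 mod0z modz_small //= ltz_nat prime_gt1.
Qed.

HB.instance Definition _ := GRing.Zmodule_isComNzRing.Build Zp
  padic_mulA padic_mulC padic_mul1 padic_mulD padic_1neq0.

Definition padic_unit : {pred Zp} := fun x => `[< exists y, y * x = 1 >].

Definition padic_inv x : Zp :=
  if pselect (exists y, y * x = 1) is left ex_y then projT1 (cid ex_y) else x.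

Lemma padic_mulV : {in padic_unit, left_inverse 1 padic_inv *%R}.
Proof.
move=> x /asboolP ex_y; rewrite /padic_inv.
by case: pselect => // ex; case: cid.
Qed.

Lemma padic_unitP x y : y * x = 1 -> padic_unit x.
Proof. by move=> yx1; apply/asboolP; exists y. Qed.

Lemma padic_inv_out : {in [predC padic_unit], padic_inv =1 id}.
Proof.
move=> x /negP nUx; rewrite /padic_inv.
by case: pselect => // ex; case: nUx; apply/asboolP.
Qed.

HB.instance Definition _ := GRing.ComNzRing_hasMulInverse.Build Zp
  padic_mulV padic_unitP padic_inv_out.

Lemma padic_res_neq0 x : x != 0 -> exists n, padic_res x n != 0.
Proof.
move=> /eqP x_neq0; apply: contrapT => /forallNP Hx; apply: x_neq0.
by apply: padicP => n /=; rewrite mod0z; apply/eqP/negbNE/negP/Hx.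
Qed.

Lemma padic_integral x y : x * y = 0 -> (x == 0) || (y == 0).
Proof.
move=> xy0; rewrite -[_ || _]negbK negb_or; apply/negP => /andP[].
move=> /padic_res_neq0[m Hm] /padic_res_neq0[n Hn].
have := congr1 (fun z : Zp => padic_res z (m + n)) xy0.
rewrite /= mod0z => /dvdz_mod0P.
move: Hm Hn; rewrite (padic_res_le x (leq_addr n m)).
rewrite (padic_res_le y (leq_addl m n)).
move: (padic_res x _) (padic_res y _) => a b /eqP/dvdz_mod0P Ha /eqP/dvdz_mod0P Hb.
rewrite !dvdzE /= in Ha Hb *; rewrite abszM.
have a_gt0 : (0 < `|a|)%N by rewrite lt0n; apply: contraNneq Ha => ->.
have b_gt0 : (0 < `|b|)%N by rewrite lt0n; apply: contraNneq Hb => ->.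
move: Ha Hb; rewrite !pfactor_dvdn ?muln_gt0 ?a_gt0 // lognM //.
rewrite -!ltnNge => lt_a lt_b.
by rewrite leqNgt -addSn leq_add // ltnW.
Qed.

HB.instance Definition _ :=
  GRing.ComUnitRing_isIntegral.Build Zp padic_integral.

(* m_j -> a p-adically: padic_res a N is the residue of a modulo p^N.         *)
Definition padic_int_cvg (m : nat -> int) (a : Zp) :=
  forall N : nat, \forall j \near \oo, (m j = padic_res a N %[mod (p ^ N)%N])%Z.

(* A copy of 'F_p, on which Z_p acts through reduction modulo p.              *)
Definition Zmodp of prime p : Type := 'F_p.

Definition padic_red (a : Zp) : 'F_p := (padic_res a 1)%:~R.

Lemma padic_red_mod (c : int) : (c %% (p ^ 1)%N)%Z%:~R = c%:~R :> 'F_p.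
Proof.
transitivity (((c %/ p)%Z * p + (c %% p)%Z)%:~R : 'F_p).
  by rewrite expn1 [RHS]intrD intrM (pchar_Fp_0 pr_p : p%:~R = 0 :> 'F_p) mulr0 add0r.
by rewrite -divz_eq.
Qed.

Lemma padic_redM a b : padic_red (a * b) = padic_red a * padic_red b.
Proof. by rewrite /padic_red /= padic_red_mod intrM. Qed.

Lemma padic_redD a b : padic_red (a + b) = padic_red a + padic_red b.
Proof. by rewrite /padic_red /= padic_red_mod intrD. Qed.

Lemma padic_red1 : padic_red 1 = 1.
Proof. by rewrite /padic_red /= padic_red_mod. Qed.

HB.instance Definition _ := GRing.Zmodule.copy (Zmodp pr_p) 'F_p.

Definition Zmodp_scale (a : Zp) (x : Zmodp pr_p) : Zmodp pr_p :=
  padic_red a * (x : 'F_p).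

Lemma Zmodp_scaleA a b (x : Zmodp pr_p) :
  Zmodp_scale a (Zmodp_scale b x) = Zmodp_scale (a * b) x.
Proof. by rewrite /Zmodp_scale padic_redM mulrA. Qed.

Lemma Zmodp_scale1 : left_id 1 Zmodp_scale.
Proof. by move=> x; rewrite /Zmodp_scale padic_red1 mul1r. Qed.

Lemma Zmodp_scaleDr : right_distributive Zmodp_scale +%R.
Proof. by move=> a x y; rewrite /Zmodp_scale mulrDr. Qed.

Lemma Zmodp_scaleDl (x : Zmodp pr_p) : {morph Zmodp_scale^~ x : a b / a + b}.
Proof. by move=> a b; rewrite /Zmodp_scale padic_redD mulrDl. Qed.

HB.instance Definition _ := GRing.Zmodule_isLmodule.Build Zp (Zmodp pr_p)
  Zmodp_scaleA Zmodp_scale1 Zmodp_scaleDr Zmodp_scaleDl.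

End PadicInt.

Notation padic pr_p := {fraction (padic_int pr_p)}.

Section RingOfIntegers.
Variables (p : nat) (pr_p : prime p) (K : fieldExtType (padic pr_p)).

Definition padic_int_emb : padic_int pr_p -> K :=
  in_alg K \o @tofrac (padic_int pr_p).

HB.instance Definition _ := GRing.RMorphism.on padic_int_emb.

(* O_K, as the integral closure of Z_p in K.                                  *)
Definition integer : {pred K} := fun x => `[< integralOver padic_int_emb x >].

Lemma integer_subring : subring_closed integer.
Proof.
split=> [|x y /asboolP Ox /asboolP Oy|x y /asboolP Ox /asboolP Oy]; apply/asboolP.
- exact: integral1.
- exact: integral_sub.
- exact: integral_mul.
Qed.

HB.instance Definition _ := GRing.isSubringClosed.Build K integer integer_subring.

Record int_ring := IntRing { int_val : K; _ : int_val \in integer }.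

HB.instance Definition _ := [isSub for int_val].
HB.instance Definition _ := [Choice of int_ring by <:].
HB.instance Definition _ := [SubChoice_isSubComNzRing of int_ring by <:].

(* m_K, as the set of non-units of O_K.                                       *)
Definition max_ideal : {pred K} :=
  fun x => (x \in integer) && ((x == 0) || (x^-1 \notin integer)).

(* The ramification index is 1, i.e. p generates m_K; the residue extension   *)
(* is automatically separable since the residue field of Q_p is perfect.      *)
Definition unramified :=
  forall x : K, x \in max_ideal <-> exists2 y, y \in integer & x = p%:R * y.

Definition padic_cvg (u : nat -> K) (l : K) :=
  forall N : nat, \forall j \near \oo,
    exists2 y, y \in integer & u j - l = p%:R ^+ N * y.

Variables (k : finFieldType) (red : {rmorphism int_ring -> k}).

(* k is O_K / m_K and red is the quotient map.                                *)
Definition is_residue_map :=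
  (forall c, exists x, red x = c) /\
  (forall x, red x = 0 <-> int_val x \in max_ideal).

(* The reduction of an element of K that lies in O_K (junk value 0 outside).  *)
Definition reduce (x : K) : k := red (insubd 0 x).

End RingOfIntegers.

Arguments integer {p pr_p} K.
Arguments max_ideal {p pr_p} K.

(* The norm of a finite field over its prime subfield; its values are seen in *)
(* the field itself.                                                          *)
Definition prime_norm (k : finFieldType) (x : k) : k :=
  let: exist2 _ _ pcharkp := finPcharP k in
  galNorm 1%AS {: pPrimeCharType pcharkp} x.

Record weierstrass (F : Type) :=
  Weierstrass { wa1 : F; wa2 : F; wa3 : F; wa4 : F; wa6 : F }.

Definition map_weierstrass (F F' : Type) (f : F -> F') (W : weierstrass F) :=
  Weierstrass (f (wa1 W)) (f (wa2 W)) (f (wa3 W)) (f (wa4 W)) (f (wa6 W)).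

Inductive wpoint (F : Type) := Inf | Aff of F & F.
Arguments Inf {F}.

Section Weierstrass.
Variables (F : fieldType) (W : weierstrass F).
Local Notation a1 := (wa1 W).
Local Notation a2 := (wa2 W).
Local Notation a3 := (wa3 W).
Local Notation a4 := (wa4 W).
Local Notation a6 := (wa6 W).

Definition wdisc : F :=
  let b2 := a1 ^+ 2 + 4%:R * a2 in
  let b4 := 2%:R * a4 + a1 * a3 in
  let b6 := a3 ^+ 2 + 4%:R * a6 in
  let b8 := a1 ^+ 2 * a6 + 4%:R * a2 * a6 - a1 * a3 * a4 + a2 * a3 ^+ 2
            - a4 ^+ 2 in
  - b2 ^+ 2 * b8 - 8%:R * b4 ^+ 3 - 27%:R * b6 ^+ 2 + 9%:R * b2 * b4 * b6.

Definition on_curve (P : wpoint F) : Prop :=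
  if P is Aff x y then
    y ^+ 2 + a1 * x * y + a3 * y = x ^+ 3 + a2 * x ^+ 2 + a4 * x + a6
  else True.

Definition wopp (P : wpoint F) : wpoint F :=
  if P is Aff x y then Aff x (- y - a1 * x - a3) else Inf.

Definition wadd (P Q : wpoint F) : wpoint F :=
  match P, Q with
  | Inf, _ => Q
  | _, Inf => P
  | Aff x1 y1, Aff x2 y2 =>
    let third l :=
      let x3 := l ^+ 2 + a1 * l - a2 - x1 - x2 in
      wopp (Aff x3 (y1 + l * (x3 - x1))) in
    if x1 != x2 then third ((y2 - y1) / (x2 - x1))
    else if y1 + y2 + a1 * x2 + a3 == 0 then Inf
    else third ((3%:R * x1 ^+ 2 + 2%:R * a2 * x1 + a4 - a1 * y1)
                / (2%:R * y1 + a1 * x1 + a3))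
  end.

Definition wmulz (m : int) (P : wpoint F) : wpoint F :=
  match m with
  | Posz n => iter n (wadd P) Inf
  | Negz n => wopp (iter n.+1 (wadd P) Inf)
  end.

Definition homX (P : wpoint F) : F := if P is Aff x _ then x else 0.
Definition homY (P : wpoint F) : F := if P is Aff _ y then y else 1.
Definition homZ (P : wpoint F) : F := if P is Aff _ _ then 1 else 0.

(* The gradient of                                                            *)
(*   Y^2 Z + a1 X Y Z + a3 Y Z^2 - X^3 - a2 X^2 Z - a4 X Z^2 - a6 Z^3         *)
(* does not vanish at (X, Y, Z).                                              *)
Definition nonsingular (X Y Z : F) :=
  [\/ a1 * Y * Z - 3%:R * X ^+ 2 - 2%:R * a2 * X * Z - a4 * Z ^+ 2 != 0,
      2%:R * Y * Z + a1 * X * Z + a3 * Z ^+ 2 != 0 |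
      Y ^+ 2 + a1 * X * Y + 2%:R * a3 * Y * Z - a2 * X ^+ 2
        - 2%:R * a4 * X * Z - 3%:R * a6 * Z ^+ 2 != 0].

End Weierstrass.

Section PadicPoints.
Variables (p : nat) (pr_p : prime p) (K : fieldExtType (padic pr_p)).
Variables (k : finFieldType) (red : {rmorphism int_ring K -> k}).
Variable W : weierstrass K.
Local Notation O := (integer K).
Local Notation bar := (reduce red).

(* E_0(K): after scaling the homogeneous coordinates of P by c they lie in    *)
(* O_K and are not all in m_K, so that their reductions are homogeneous       *)
(* coordinates of the reduction of P.                                         *)
Definition E0 : set (wpoint K) := [set P | on_curve W P /\
  exists c : K,
    let X := c * homX P in let Y := c * homY P in let Z := c * homZ P in
    [/\ [/\ X \in O, Y \in O & Z \in O],
        ~~ [&& X \in max_ideal K, Y \in max_ideal K & Z \in max_ideal K] &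
        nonsingular (map_weierstrass bar W) (bar X) (bar Y) (bar Z)]].

(* Convergence for the quotient topology of P^2(K) = (K^3 \ 0) / K^*.         *)
Definition point_cvg (P : nat -> wpoint K) (Q : wpoint K) :=
  exists c : nat -> K,
    [/\ forall j, c j != 0,
        padic_cvg (fun j => c j * homX (P j)) (homX Q),
        padic_cvg (fun j => c j * homY (P j)) (homY Q) &
        padic_cvg (fun j => c j * homZ (P j)) (homZ Q)].

Definition is_zp_multiple (a : padic_int pr_p) (P Q : wpoint K) :=
  forall m : nat -> int, padic_int_cvg m a ->
    point_cvg (fun j => wmulz W (m j) P) Q.

(* An isomorphism of Z_p-modules M -> E_0(K); that the limits defining the    *)
(* scalar action on E_0(K) exist is part of the assertion.                    *)
Definition E0_isomorphic (M : lmodType (padic_int pr_p)) :=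
  exists f : M -> wpoint K,
    [/\ set_bij setT E0 f,
        forall u v, f (u + v) = wadd W (f u) (f v) &
        forall (a : padic_int pr_p) u, is_zp_multiple a (f u) (f (a *: u))].

End PadicPoints.

(* Main.v *)
Require Import Defs.
From HB Require Import structures.
From mathcomp Require Import all_boot all_order all_fingroup all_algebra all_field.
From mathcomp Require Import mxabelem boolp classical_sets functions filter ring.

(* In the coordinates z = - x / y, w = - 1 / y the curve reads                *)
(*   w = z^3 + a1 z w + a2 z^2 w + a3 w^2 + a4 z w^2 + a6 w^3,                *)
(* and since the a_i lie in m_K = p O_K, the points of E_0(K) are exactly its *)
(* solutions in O_K^2, with z in O_K arbitrary and w determined by z.  On     *)
(* them the group law is one rational formula all of whose denominators are   *)
(* = 1 mod p, so it is p-adically continuous; associativity is proved for     *)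
(* points in general position, where -(P + Q + R) is the fourth point of the  *)
(* curve on the parabola through P, Q, R, and extends by density.             *)
(*   Filter E_0(K) by the p-adic size of z: every graded piece is k, p maps   *)
(* E_r / E_(r+1) bijectively to E_(r+1) / E_(r+2) for r > 0, and modulo p^2   *)
(*   z(p P) = p z - e1 a1 z^2 - e2 a2 z^3 - e3 a3 z^4 - e4 a4 z^5 - e6 a6 z^7 *)
(* with 2 e1 = p^2 - p, 3 e2 = p^3 - p, 2 e3 = p^4 - p, 5 e4 = 2 (p^5 - p)    *)
(* and 7 e6 = 3 (p^7 - p).  The e_i are divisible by p except when p = 2, 3,  *)
(* 5, 7; they give an F_p-linear map psi from k = E_0 / E_1 to                *)
(* k = E_1 / E_2, and E_0(K) = Z_p^n x ker psi by successive approximation    *)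
(* along bases adapted to psi.  For p = 3, 5, 7 one has psi(t) = t - c t^p,   *)
(* and Hilbert's Theorem 90 decides by the norm of c whether it is injective. *)

Set Implicit Arguments.
Unset Strict Implicit.
Unset Printing Implicit Defensive.

Import GRing.Theory.
Local Open Scope ring_scope.

(** Modulo p the equation becomes Y^2 = X^3, whose nonsingular points form the additive group k
    through the coordinate z. So E_0(K) has a separated and complete filtration with all layers
    equal to k, and p maps each layer bijectively to the next, except perhaps the first to the
    second, where it is psi. Hence E_1 is free over Z_p of rank [k : F_p] = n, and p E_1 = E_2. What
    remains is the extension of k by E_1, and psi alone decides it. A class killed by psi lifts to a
    point P with p P in E_2 = p E_1, so subtracting a point of E_1 makes P killed by p. Along a
    complement of ker psi the points p P are part of a basis of E_1, and adjoining P only replaces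
    the basis element p P by P. This gives Z_p^n x (Z/p)^b with p^b the order of ker psi
    ([filtered_module_classification]), and the theorem becomes a count of ker psi.

    What is needed from the curve is collected in [chart_group]: a group law ([paddA]), approximate
    additivity of z ([pz_addS], [pz_mulrn]) and multiplication by m modulo p^2 ([pz_mul_mod2]).
    [pt_in_E0] and [E0_pt] identify this group with E_0(K), and [E0_isomorphic_of_action] matches
    the scalars with limits of multiples. The same classification applied to O_K yields its
    freeness, and from it the rank and completeness ([integer_coords], [dim_residue],
    [pideal_complete]).

    For p = 2, psi is up to sign the quartic of case (i). For p = 3, 5, 7 the equation t = c t^p has
    at most p solutions, and a nonzero one exactly when c has norm 1 ([frobenius_kernel_card]). For
    all other p, psi is the identity. *)

(** * Associativity of the chord law for points in general position *)

Section GenericAssociativity.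
Variables (F : fieldType) (W : weierstrass F).
Local Notation a1 := (wa1 W).
Local Notation a2 := (wa2 W).
Local Notation a3 := (wa3 W).
Local Notation a4 := (wa4 W).
Local Notation a6 := (wa6 W).

Definition chordX (l x1 x2 : F) := l ^+ 2 + a1 * l - a2 - x1 - x2.

Definition chordY (l x1 y1 x3 : F) := - (y1 + l * (x3 - x1)) - a1 * x3 - a3.

Lemma wadd_chord x1 y1 x2 y2 : x1 != x2 ->
  let l := (y2 - y1) / (x2 - x1) in
  wadd W (Aff x1 y1) (Aff x2 y2)
    = Aff (chordX l x1 x2) (chordY l x1 y1 (chordX l x1 x2)).
Proof. by rewrite /wadd => ->. Qed.

(** The monic cubic left after substituting the line has the roots [x1] and [x2], and Vieta gives
    the third. The two curve equations are solved for [a4] and [a6], which turns the claim into an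
    identity. *)
Lemma chord_remainder l m x1 x2 x : x1 != x2 ->
    on_curve W (Aff x1 (l * x1 + m)) -> on_curve W (Aff x2 (l * x2 + m)) ->
  x ^+ 3 + a2 * x ^+ 2 + a4 * x + a6 = (l * x + m) ^+ 2 + a1 * x * (l * x + m)
    + a3 * (l * x + m) + (x - x1) * (x - x2) * (x - chordX l x1 x2).
Proof.
rewrite /chordX /= => x12 E1 E2; have d0 : x2 - x1 != 0 by rewrite subr_eq0 eq_sym.
have Ea4 : a4 = 2%:R * l * m + a1 * m + a3 * l - (x1 ^+ 2 + x1 * x2 + x2 ^+ 2)
    - (a2 - l ^+ 2 - a1 * l) * (x1 + x2).
  apply: (mulfI d0); apply/eqP; rewrite -subr_eq0; apply/eqP.
  transitivity (((l * x1 + m) ^+ 2 + a1 * x1 * (l * x1 + m) + a3 * (l * x1 + m)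
     - (x1 ^+ 3 + a2 * x1 ^+ 2 + a4 * x1 + a6))
   - ((l * x2 + m) ^+ 2 + a1 * x2 * (l * x2 + m) + a3 * (l * x2 + m)
     - (x2 ^+ 3 + a2 * x2 ^+ 2 + a4 * x2 + a6))); first by ring.
  by rewrite E1 E2 !subrr.
have Ea6 : a6 = (l * x1 + m) ^+ 2 + a1 * x1 * (l * x1 + m)
    + a3 * (l * x1 + m) - (x1 ^+ 3 + a2 * x1 ^+ 2 + a4 * x1) by rewrite E1; ring.
by rewrite Ea6 Ea4; ring.
Qed.

(* The slope of the line through P1 + P2 and P3 is 1/mu - l12 - a1, where l12 *)
(* and mu are the first and second divided differences of y at x1, x2, x3.   *)
Lemma slope_sum x1 y1 x2 y2 x3 y3 : x1 != x2 -> x2 != x3 -> x1 != x3 ->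
    on_curve W (Aff x1 y1) -> on_curve W (Aff x2 y2) -> on_curve W (Aff x3 y3) ->
  let l := (y2 - y1) / (x2 - x1) in
  let xS := chordX l x1 x2 in
  let mu := ((y3 - y2) / (x3 - x2) - l) / (x3 - x1) in
  xS != x3 ->
  mu != 0 /\ (y3 - chordY l x1 y1 xS) / (x3 - xS) = mu^-1 - l - a1.
Proof.
move=> x12 x23 x13 E1 E2 E3 l xS mu xS3.
have d21 : x2 - x1 != 0 by rewrite subr_eq0 eq_sym.
have d32 : x3 - x2 != 0 by rewrite subr_eq0 eq_sym.
have d31 : x3 - x1 != 0 by rewrite subr_eq0 eq_sym.
have d3S : x3 - xS != 0 by rewrite subr_eq0 eq_sym.
have Ey1 : y1 = l * x1 + (y1 - l * x1) by ring.
have Ey2 : y2 = l * x2 + (y1 - l * x1) by rewrite /l; field.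
have := @chord_remainder l (y1 - l * x1) x1 x2 x3 x12.
rewrite -Ey1 -Ey2 => /(_ E1 E2); rewrite -E3 -/xS.
set L := l * x3 + _ => EL.
have Ey3 : y3 = L + mu * ((x3 - x1) * (x3 - x2)).
  by rewrite /L /mu /l; field; rewrite d32 d21 d31.
(* [y3] lies on the curve and [L] on the chord, both over [x3]. Subtracting their equations leaves
   (y3 - L) times the left-hand factor, and y3 - L = mu (x3 - x1) (x3 - x2). *)
have key : mu * (y3 + L + a1 * x3 + a3) = x3 - xS.
  apply: (mulfI (mulf_neq0 d31 d32)); apply/eqP; rewrite -subr_eq0; apply/eqP.
  transitivity (y3 ^+ 2 + a1 * x3 * y3 + a3 * y3 -
      (L ^+ 2 + a1 * x3 * L + a3 * L + (x3 - x1) * (x3 - x2) * (x3 - xS))).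
    by rewrite Ey3; ring.
  by rewrite EL subrr.
have mu0 : mu != 0 by apply: contraNneq d3S => mu0; rewrite -key mu0 mul0r.
split=> //; apply: (mulIf d3S); rewrite divfK //; apply: (mulfI mu0).
transitivity (mu * (y3 + L + a1 * x3 + a3) - mu * (l + a1) * (x3 - xS)).
  by rewrite /chordY /L; ring.
by rewrite key; field.
Qed.

(** The second divided difference [mu] is unchanged when the three points are reversed. So
    [slope_sum] gives the slopes of both final chords, 1/mu - l - a1 and 1/mu - l' - a1 with l' = l
    + mu (x3 - x1), and the two sums agree by a rational identity. *)
Lemma wadd_generic_assoc x1 y1 x2 y2 x3 y3 : x1 != x2 -> x2 != x3 -> x1 != x3 ->
    on_curve W (Aff x1 y1) -> on_curve W (Aff x2 y2) -> on_curve W (Aff x3 y3) ->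
    chordX ((y2 - y1) / (x2 - x1)) x1 x2 != x3 ->
    chordX ((y3 - y2) / (x3 - x2)) x2 x3 != x1 ->
  wadd W (wadd W (Aff x1 y1) (Aff x2 y2)) (Aff x3 y3)
    = wadd W (Aff x1 y1) (wadd W (Aff x2 y2) (Aff x3 y3)).
Proof.
move=> x12 x23 x13 E1 E2 E3 xS3 xT1.
have d21 : x2 - x1 != 0 by rewrite subr_eq0 eq_sym.
have d32 : x3 - x2 != 0 by rewrite subr_eq0 eq_sym.
have d31 : x3 - x1 != 0 by rewrite subr_eq0 eq_sym.
have [mu0] := slope_sum x12 x23 x13 E1 E2 E3 xS3.
have x32 : x3 != x2 by rewrite eq_sym.
have x21 : x2 != x1 by rewrite eq_sym.
have x31 : x3 != x1 by rewrite eq_sym.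
have := @slope_sum x3 y3 x2 y2 x1 y1 x32 x21 x31 E3 E2 E1.
rewrite (wadd_chord _ _ x12) (wadd_chord _ _ x23) wadd_chord // wadd_chord 1?eq_sym //.
cbv zeta.
set l := (y2 - y1) / (x2 - x1) in xS3 mu0 *.
set l' := (y3 - y2) / (x3 - x2) in xT1 mu0 *.
set mu := (l' - l) / (x3 - x1) in mu0 *.
have -> : (y2 - y3) / (x2 - x3) = l' by rewrite /l' -mulrNN -invrN !opprB.
have -> : (y1 - y2) / (x1 - x2) = l by rewrite /l -mulrNN -invrN !opprB.
have -> : chordX l' x3 x2 = chordX l' x2 x3 by rewrite /chordX; ring.
have -> : (l - l') / (x1 - x3) = mu by rewrite /mu -mulrNN -invrN !opprB.
have -> : chordY l' x3 y3 (chordX l' x2 x3) = chordY l' x2 y2 (chordX l' x2 x3).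
  by rewrite /chordY /l'; field.
move=> /(_ xT1)[_ sT] sS; rewrite sS.
set xS := chordX l x1 x2 in xS3 sS *; set yS := chordY _ _ _ _ in sS *.
set xT := chordX l' x2 x3 in xT1 sT *; set yT := chordY _ _ _ _ in sT *.
have -> : (yT - y1) / (xT - x1) = mu^-1 - l' - a1 by rewrite -sT -mulrNN -invrN !opprB.
have El' : l' = l + mu * (x3 - x1) by rewrite /mu; field.
have Ey3 : y3 = y1 + l * (x2 - x1) + l' * (x3 - x2) by rewrite /l /l'; field; rewrite d32 d21.
have EyS : yS = y3 - (mu^-1 - l - a1) * (x3 - xS).
  by rewrite -sS divfK ?subKr // subr_eq0 eq_sym.
have EX : chordX (mu^-1 - l - a1) xS x3 = chordX (mu^-1 - l' - a1) x1 xT.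
  by rewrite /xS /xT /chordX El'; field.
rewrite EX; congr Aff; rewrite -EX /chordY EyS Ey3 /xS /chordX El'; field.
by rewrite mu0.
Qed.

End GenericAssociativity.

(** * The chart at infinity and its uniform addition formula *)

Section ChartAtInfinity.
Variables (F : fieldType) (W : weierstrass F).
Local Notation a1 := (wa1 W).
Local Notation a2 := (wa2 W).
Local Notation a3 := (wa3 W).
Local Notation a4 := (wa4 W).
Local Notation a6 := (wa6 W).

Definition chart_rhs (z w : F) := z ^+ 3 + a1 * z * w + a2 * z ^+ 2 * w
  + a3 * w ^+ 2 + a4 * z * w ^+ 2 + a6 * w ^+ 3.

Definition on_chart (z w : F) := w = chart_rhs z w.

(* z = - x / y and w = - 1 / y; the origin of the chart is the point at       *)
(* infinity.                                                                  *)
Definition chart_point (z w : F) : wpoint F :=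
  if w == 0 then Inf else Aff (z / w) (- w^-1).

(* chart_rhs z1 w1 - chart_rhs z2 w2                                          *)
(*   = (z1 - z2) * slope_num + (w1 - w2) * (1 - slope_den)                    *)
Definition slope_num z1 z2 w1 := z1 ^+ 2 + z1 * z2 + z2 ^+ 2 + a1 * w1
  + a2 * (z1 + z2) * w1 + a4 * w1 ^+ 2.

Definition slope_den z2 w1 w2 := 1 - (a1 * z2 + a2 * z2 ^+ 2 + a3 * (w1 + w2)
  + a4 * z2 * (w1 + w2) + a6 * (w1 ^+ 2 + w1 * w2 + w2 ^+ 2)).

Definition slope z1 w1 z2 w2 := slope_num z1 z2 w1 / slope_den z2 w1 w2.

(* Coefficients of the cubic chart_rhs z (l * z + m) - (l * z + m) in z.      *)
Definition cubic3 l := 1 + a2 * l + a4 * l ^+ 2 + a6 * l ^+ 3.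
Definition cubic2 l m := a1 * l + a3 * l ^+ 2 + a2 * m + 2%:R * a4 * l * m
  + 3%:R * a6 * l ^+ 2 * m.
Definition cubic1 l m := a1 * m + 2%:R * a3 * l * m + a4 * m ^+ 2
  + 3%:R * a6 * l * m ^+ 2 - l.
Definition cubic0 m := a3 * m ^+ 2 + a6 * m ^+ 3 - m.

Definition third_z l m z1 z2 := - z1 - z2 - cubic2 l m / cubic3 l.

(** The negative of the point (z / w, - 1 / w) has ordinate [opp_den z w / w]. *)
Definition opp_den z w := 1 - a1 * z - a3 * w.

(** Writing the slope as [slope_num / slope_den] instead of a difference quotient lets one formula
    serve chords, tangents, opposite points and the point at infinity. *)
Definition chart_add z1 w1 z2 w2 : F * F :=
  let l := slope z1 w1 z2 w2 in
  let m := w1 - l * z1 in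
  let z3 := third_z l m z1 z2 in
  let w3 := l * z3 + m in
  (- z3 / opp_den z3 w3, - w3 / opp_den z3 w3).

Lemma chart_point_inf : chart_point 0 0 = Inf.
Proof. by rewrite /chart_point eqxx. Qed.

Lemma chart_point_aff z w : w != 0 -> chart_point z w = Aff (z / w) (- w^-1).
Proof. by rewrite /chart_point => /negPf->. Qed.

Lemma on_chart_w0 z : on_chart z 0 -> z = 0.
Proof.
rewrite /on_chart /chart_rhs !(mulr0, expr0n, addr0) /= => /esym/eqP.
by rewrite expf_eq0 /= => /eqP.
Qed.

Lemma chart_point_inj z w z' w' : on_chart z w -> on_chart z' w' ->
  chart_point z w = chart_point z' w' -> z = z' /\ w = w'.
Proof.
rewrite /chart_point; have [-> | w0] := eqVneq w 0 => C.
  have [-> | w'0] := eqVneq w' 0 => // C' _.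
  by rewrite (on_chart_w0 C) (on_chart_w0 C').
have [-> | w'0] := eqVneq w' 0 => // C' [Ez /oppr_inj/invr_inj Ew].
by rewrite Ew in Ez *; rewrite (divIf w'0 Ez).
Qed.

Lemma on_chart_curve z w : on_chart z w -> on_curve W (chart_point z w).
Proof.
rewrite /chart_point; have [//|w0] := eqVneq w 0; rewrite /= /on_chart /chart_rhs => C.
apply/eqP; rewrite -subr_eq0; apply/eqP.
transitivity ((w - (z ^+ 3 + a1 * z * w + a2 * z ^+ 2 * w
  + a3 * w ^+ 2 + a4 * z * w ^+ 2 + a6 * w ^+ 3)) / w ^+ 3); first by field.
by rewrite -C subrr mul0r.
Qed.

Lemma curve_on_chart x y : y != 0 -> on_curve W (Aff x y) ->
  on_chart (- x / y) (- y^-1).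
Proof.
rewrite /= /on_chart /chart_rhs => y0 C; apply/eqP; rewrite -subr_eq0; apply/eqP.
transitivity (- (y ^+ 2 + a1 * x * y + a3 * y - (x ^+ 3 + a2 * x ^+ 2 + a4 * x + a6))
  / y ^+ 3); first by field.
by rewrite C subrr oppr0 mul0r.
Qed.

Lemma chart_point_curve x y : y != 0 -> chart_point (- x / y) (- y^-1) = Aff x y.
Proof.
move=> y0; rewrite chart_point_aff ?oppr_eq0 ?invr_eq0 //.
by congr Aff; field; rewrite ?y0 ?oppr_eq0 ?oner_eq0.
Qed.

Section Line.
Variables z1 w1 z2 w2 : F.
Hypotheses (C1 : on_chart z1 w1) (C2 : on_chart z2 w2).
Local Notation U := (slope_den z2 w1 w2).
Local Notation l := (slope z1 w1 z2 w2).
Local Notation m := (w1 - l * z1).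
Local Notation D := (cubic3 l).
Local Notation z3 := (third_z l m z1 z2).
Local Notation w3 := (l * z3 + m).
Hypotheses (U0 : U != 0) (D0 : D != 0).

Lemma slope_rel : w1 - w2 = l * (z1 - z2).
Proof.
apply: (mulIf U0); rewrite mulrAC [l * _]divfK //.
apply/eqP; rewrite -subr_eq0; apply/eqP.
transitivity (w1 - w2 - (chart_rhs z1 w1 - chart_rhs z2 w2)).
  by rewrite /slope_num /slope_den /chart_rhs; ring.
by rewrite -C1 -C2 subrr.
Qed.

Lemma line1 : w1 = l * z1 + m. Proof. by rewrite addrC subrK. Qed.

Lemma line2 : w2 = l * z2 + m.
Proof. by apply: (@subrI _ w1); rewrite slope_rel; ring. Qed.

Lemma vieta2 : cubic2 l m = - D * (z1 + z2 + z3).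
Proof. by rewrite /third_z; field. Qed.

(** The divided difference of the cubic at [z1] and [z2] is [slope_num - l * slope_den], which
    vanishes by the choice of the slope. So [z1] is a double root when the two points coincide, and
    no case distinction is needed. *)
Lemma vieta1 : cubic1 l m = D * (z1 * z2 + (z1 + z2) * z3).
Proof.
suff E: D * (z1 ^+ 2 + z1 * z2 + z2 ^+ 2) + cubic2 l m * (z1 + z2) + cubic1 l m = 0.
  by apply/eqP; rewrite -subr_eq0 -[X in _ == X]E vieta2; apply/eqP; ring.
transitivity (slope_num z1 z2 w1 - l * U); last by rewrite [l * _]divfK ?subrr.
move: line1 line2; move: (l) => l0; move: (w1 - l0 * z1) => m0 -> ->.
by rewrite /slope_num /slope_den /cubic3 /cubic2 /cubic1; ring.
Qed.

Lemma vieta0 : cubic0 m = - D * (z1 * z2 * z3).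
Proof.
have E : D * z1 ^+ 3 + cubic2 l m * z1 ^+ 2 + cubic1 l m * z1 + cubic0 m = 0.
  transitivity (chart_rhs z1 w1 - w1); last by rewrite -C1 subrr.
  move: line1; move: (l) => l0; move: (w1 - l0 * z1) => m0 ->.
  by rewrite /cubic3 /cubic2 /cubic1 /cubic0 /chart_rhs; ring.
apply/eqP; rewrite -subr_eq0 -[X in _ == X]E vieta2 vieta1; apply/eqP; ring.
Qed.

Lemma third_on_chart : on_chart z3 w3.
Proof.
apply/eqP; rewrite eq_sym -subr_eq0; apply/eqP.
transitivity (D * z3 ^+ 3 + cubic2 l m * z3 ^+ 2 + cubic1 l m * z3 + cubic0 m).
  by rewrite /cubic3 /cubic2 /cubic1 /cubic0 /chart_rhs; ring.
by rewrite vieta2 vieta1 vieta0; ring.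
Qed.

(** Up to the factor - l^3, the left side is the cubic evaluated at z = - m / l. There w = 0, and
    only the term z^3 survives. *)
Lemma line_product : D * (w1 * w2 * w3) = m ^+ 3.
Proof.
have := (vieta2, vieta1, vieta0); move: line1 line2 (third_z _ _ _ _).
move: (l) => l0; move: (w1 - l0 * z1) => m0 -> -> z0 [[v2 v1] v0].
transitivity (- l0 ^+ 3 * cubic0 m0 + l0 ^+ 2 * m0 * cubic1 l0 m0
    - l0 * m0 ^+ 2 * cubic2 l0 m0 + m0 ^+ 3 * cubic3 l0); first by rewrite v2 v1 v0; ring.
by rewrite /cubic3 /cubic2 /cubic1 /cubic0; ring.
Qed.

(** Divided by [line_product], this is the sum of the three abscissas z / w. It equals lambda^2 + a1
    lambda - a2 with lambda = l / m, as in the affine chord formula. *)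
Lemma line_sum : D * (z1 * w2 * w3 + z2 * w1 * w3 + z3 * w1 * w2)
  = m * (l ^+ 2 + a1 * l * m - a2 * m ^+ 2).
Proof.
have := (vieta2, vieta1, vieta0); move: line1 line2 (third_z _ _ _ _).
move: (l) => l0; move: (w1 - l0 * z1) => m0 -> -> z0 [[v2 v1] v0].
transitivity (- 3%:R * l0 ^+ 2 * cubic0 m0 + 2%:R * l0 * m0 * cubic1 l0 m0
    - m0 ^+ 2 * cubic2 l0 m0).
  by rewrite v2 v1 v0; ring.
by rewrite /cubic3 /cubic2 /cubic1 /cubic0; ring.
Qed.

End Line.

Definition chart_opp z w : F * F := (- z / opp_den z w, - w / opp_den z w).

Lemma chart_opp_on_chart z w : on_chart z w -> opp_den z w != 0 ->
  on_chart (chart_opp z w).1 (chart_opp z w).2.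
Proof.
rewrite /on_chart /chart_rhs /chart_opp /= => C.
have En : opp_den z w = 1 - a1 * z - a3 * w by [].
move: (opp_den z w) En => n En n0.
apply/eqP; rewrite -subr_eq0; apply/eqP.
transitivity (- (w - (z ^+ 3 + a1 * z * w + a2 * z ^+ 2 * w
  + a3 * w ^+ 2 + a4 * z * w ^+ 2 + a6 * w ^+ 3)) / n ^+ 3
  - w * (n + 1) * (n - (1 - a1 * z - a3 * w)) / n ^+ 3); first by field.
by rewrite -C -En !subrr !mulr0 oppr0 mul0r subrr.
Qed.

Lemma chart_opp_point z w : opp_den z w != 0 ->
  chart_point (chart_opp z w).1 (chart_opp z w).2 = wopp W (chart_point z w).
Proof.
move=> n0 /=; have [-> | w0] := eqVneq w 0; first by rewrite /chart_point oppr0 mul0r eqxx.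
rewrite !chart_point_aff ?mulf_neq0 ?oppr_eq0 ?invr_eq0 //=; congr Aff.
  by field; rewrite ?w0 ?n0 ?oppr_eq0 ?oner_eq0.
by rewrite invf_div /opp_den; field; rewrite ?w0 ?oppr_eq0 ?oner_eq0.
Qed.

(** A line through the origin of the chart, the point at infinity, meets the curve in two further
    points opposite to each other. This settles sums with a summand [Inf]. *)
Lemma chart_opp_collinear l z t : cubic3 l != 0 -> opp_den t (l * t) != 0 ->
    cubic2 l 0 = - cubic3 l * (z + t) -> cubic1 l 0 = cubic3 l * (z * t) ->
  chart_opp t (l * t) = (z, l * z).
Proof.
move=> D0 n0 v2 v1; have E : - t = z * opp_den t (l * t).
  apply: (mulfI D0); apply/eqP; rewrite -subr_eq0; apply/eqP.
  transitivity (- cubic3 l * (z + t) + (a1 + a3 * l) * (cubic3 l * (z * t))).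
    by rewrite /opp_den; ring.
  by rewrite -v2 -v1 /cubic2 /cubic1; ring.
by rewrite /chart_opp -mulrN E mulrA !mulfK.
Qed.

Section Addition.
Variables z1 w1 z2 w2 : F.
Hypotheses (C1 : on_chart z1 w1) (C2 : on_chart z2 w2).
Local Notation U := (slope_den z2 w1 w2).
Local Notation l := (slope z1 w1 z2 w2).
Local Notation m := (w1 - l * z1).
Local Notation D := (cubic3 l).
Local Notation z3 := (third_z l m z1 z2).
Local Notation w3 := (l * z3 + m).
Hypotheses (U0 : U != 0) (D0 : D != 0) (n0 : opp_den z3 w3 != 0).

Lemma chart_addE : chart_add z1 w1 z2 w2 = chart_opp z3 w3. Proof. by []. Qed.

Lemma chart_add_on_chart :
  on_chart (chart_add z1 w1 z2 w2).1 (chart_add z1 w1 z2 w2).2.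
Proof. exact: (chart_opp_on_chart (third_on_chart C1 C2 U0 D0) n0). Qed.

Lemma chart_add_point :
  chart_point (chart_add z1 w1 z2 w2).1 (chart_add z1 w1 z2 w2).2
    = wadd W (chart_point z1 w1) (chart_point z2 w2).
Proof.
have [s1 s2] := (line1 z1 w1 z2 w2, line2 C1 C2 U0).
have v2 := vieta2 D0; have v1 := vieta1 C1 C2 U0 D0.
have C3 := third_on_chart C1 C2 U0 D0.
have lp := line_product C1 C2 U0 D0; have ls := line_sum C1 C2 U0 D0.
rewrite chart_addE.
have [w10 | w1n0] := eqVneq w1 0.
  have z10 : z1 = 0 by move: C1; rewrite w10; apply: on_chart_w0.
  have m0 : m = 0 by rewrite w10 z10 mulr0 subrr.
  move: n0 v2 v1 s2; rewrite m0 !addr0 => n0' v2 v1 s2.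
  rewrite (@chart_opp_collinear _ z2) //.
  - by rewrite /= -s2 [chart_point z1 w1](_ : _ = Inf) // z10 w10 chart_point_inf.
  - by rewrite v2 z10 add0r.
  - by rewrite v1 z10 mul0r !add0r.
have [w20 | w2n0] := eqVneq w2 0.
  have z20 : z2 = 0 by move: C2; rewrite w20; apply: on_chart_w0.
  have m0 : m = 0 by apply/eqP; rewrite -[m == 0](inj_eq (addrI (l * z2))) -s2 w20 z20 mulr0 addr0.
  move: n0 v2 v1 s1; rewrite m0 !addr0 => n0' v2 v1 s1.
  rewrite (@chart_opp_collinear _ z1) //.
  - rewrite /= -s1 [chart_point z2 w2](_ : _ = Inf); first by case: chart_point.
    by rewrite z20 w20 chart_point_inf.
  - by rewrite v2 z20 addr0.
  - by rewrite v1 z20 mulr0 add0r addr0.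
(* For m = 0 the line passes through the point at infinity, so the two summands are opposite and
   [wadd] returns [Inf]. *)
have [m0 | m0] := eqVneq m 0.
  have w30 : w3 = 0.
    apply/eqP; have /eqP : D * (w1 * w2 * w3) = 0 by rewrite lp m0 expr0n.
    by rewrite !mulf_eq0 (negPf D0) (negPf w1n0) (negPf w2n0).
  have z30 : z3 = 0 by move: C3; rewrite w30; apply: on_chart_w0.
  move: lp ls v2 v1 s1 s2; rewrite z30 m0 !mulr0 !addr0 => _ _ v2 v1 s1 s2.
  have l0 : l != 0 by apply: contraNneq w1n0 => l0; rewrite s1 l0 mul0r.
  have z10 : z1 != 0 by apply: contraNneq w1n0 => z10; rewrite s1 z10 mulr0.
  have z20 : z2 != 0 by apply: contraNneq w2n0 => z20; rewrite s2 z20 mulr0.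
  rewrite /chart_opp /= !oppr0 !mul0r chart_point_inf !chart_point_aff //.
  rewrite /wadd; move: s1 s2 l0 D0 v2 v1; move: (l) => l0 -> -> l0n0 D0n0 v2 v1.
  have -> : z1 / (l0 * z1) = z2 / (l0 * z2) by field; rewrite z10 l0n0 z20.
  rewrite eqxx /= ifT //; apply/eqP; 
  apply: (mulfI (mulf_neq0 D0n0 (mulf_neq0 l0n0 (mulf_neq0 z10 z20)))).
  rewrite mulr0; transitivity (- cubic3 l0 * (z1 + z2) + (a1 + a3 * l0) * (cubic3 l0 * (z1 * z2))).
    by field; rewrite z10 l0n0 z20.
  by rewrite -v2 -v1 /cubic2 /cubic1; ring.
have w3n0 : w3 != 0.
  apply: contraNneq m0 => w30; have := lp; rewrite w30 !mulr0 => /esym/eqP.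
  by rewrite expf_eq0.
(* In affine coordinates the line is y = (l / m) x - 1 / m. Once the slope used by [wadd] is known
   to be l / m, chord and tangent end in the same computation. *)
have tail lam : lam = l / m ->
    let x3 := lam ^+ 2 + a1 * lam - a2 - z1 / w1 - z2 / w2 in
    Aff x3 (- w1^-1 + lam * (x3 - z1 / w1)) = chart_point z3 w3.
  move=> -> x3; rewrite chart_point_aff //.
  have Ex3 : x3 = z3 / w3.
    apply: (@mulfI _ (D * (w1 * w2 * w3))); first by rewrite lp expf_neq0.
    transitivity (m * (l ^+ 2 + a1 * l * m - a2 * m ^+ 2)
        - D * (w1 * w2 * w3) * (z1 / w1 + z2 / w2)).
      by rewrite lp /x3; move: m0; move: (m) (l) => m0 l0 m0n0; field; rewrite m0n0 w1n0 w2n0.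
    by rewrite -ls; move: w3n0; move: (w3) (z3) (D) => w z d wn0; field; rewrite ?w1n0 ?w2n0 ?wn0.
  rewrite Ex3; congr Aff; move: w3n0 s1 m0; move: (z3) (l) => z l0.
  move: (w1 - l0 * z1) => m0 wn0 s1 m0n0; rewrite s1 in w1n0 *.
  by field; rewrite m0n0 w1n0 wn0.
rewrite (chart_opp_point n0) -(tail _ erefl) (chart_point_aff _ w1n0) (chart_point_aff _ w2n0) /wadd.
have yE z w : w = l * z + m -> w != 0 -> - w^-1 = (l / m) * (z / w) - m^-1.
  by move: m0; move: (m) (l) => m0 l0 m0n0 -> wn0; field; rewrite m0n0 wn0.
case: ifP => [x12 | /negbFE/eqP x12].
  rewrite (_ : _ / (_ - _) = l / m) //.
  rewrite (yE _ _ s1 w1n0) (yE _ _ s2 w2n0) opprD addrACA opprK addNr addr0 -mulrBr mulfK //.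
  by rewrite subr_eq0 eq_sym.
(* The line is not vertical, so equal abscissas force equal points, and [wadd] takes the tangent. *)
have y12 : - w1^-1 = - w2^-1 by rewrite (yE _ _ s1 w1n0) (yE _ _ s2 w2n0) x12.
have w12 : w1 = w2 by move/oppr_inj/invr_inj: y12.
have z12 : z1 = z2 by move: x12; rewrite w12; apply: divIf.
have lU : l * U = slope_num z1 z2 w1 by rewrite [l * U]divfK.
have Um : U * m = w1 ^+ 2 * (2%:R * (- w1^-1) + a1 * (z1 / w1) + a3).
  transitivity (w1 * U - l * U * z1); first by ring.
  rewrite lU -z12 -w12; transitivity (w1 - 3%:R * chart_rhs z1 w1 + a1 * z1 * w1 + a3 * w1 ^+ 2).
    by rewrite /slope_den /slope_num /chart_rhs; ring.
  by rewrite -C1; field.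
have num : slope_num z1 z2 w1 = w1 ^+ 2 * (3%:R * (z1 / w1) ^+ 2
    + 2%:R * a2 * (z1 / w1) + a4 - a1 * (- w1^-1)).
  by rewrite /slope_num -z12; field.
have den0 : 2%:R * (- w1^-1) + a1 * (z1 / w1) + a3 != 0.
  by apply: contraNneq (mulf_neq0 U0 m0) => den0; rewrite Um den0 mulr0.
rewrite -y12 -x12 ifN; last by apply: contraNneq den0 => <-; apply/eqP; ring.
have lamE : (3%:R * (z1 / w1) ^+ 2 + 2%:R * a2 * (z1 / w1) + a4 - a1 * (- w1^-1))
    / (2%:R * (- w1^-1) + a1 * (z1 / w1) + a3) = l / m.
  apply/eqP; rewrite eqr_div //; apply/eqP; apply: (mulfI U0).
  by rewrite [LHS]mulrCA Um [RHS]mulrA [U * l]mulrC lU num; ring.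
by rewrite lamE.
Qed.

End Addition.
End ChartAtInfinity.

(** Negation carries the line of slope l to a line of slope - (l + a1). That line joins P1 + P2 to -
    P1 and passes through - (its third point) = P2 after reflection. This instance of cancellation
    is needed before associativity is available. *)
Lemma wadd_cancel (F : fieldType) (W : weierstrass F) (x1 y1 x2 y2 xT yT : F) :
    x1 != x2 -> wadd W (Aff x1 y1) (Aff x2 y2) = Aff xT yT -> xT != x1 ->
  wadd W (Aff xT yT) (wopp W (Aff x1 y1)) = Aff x2 y2.
Proof.
move=> x12; rewrite wadd_chord // [wopp _ _]/=; cbv zeta; set l := _ / _ => -[ET EY] xT1.
have d21 : x2 - x1 != 0 by rewrite subr_eq0 eq_sym.
have dT1 : x1 - xT != 0 by rewrite subr_eq0 eq_sym.
have sl : (- y1 - wa1 W * x1 - wa3 W - yT) / (x1 - xT) = - (l + wa1 W).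
  by apply: (mulIf dT1); rewrite divfK // -EY -ET /chordY /chordX; ring.
have Ey2 : y2 = y1 + l * (x2 - x1) by rewrite /l divfK // addrC subrK.
have E : chordX W (- (l + wa1 W)) xT x1 = x2 by rewrite -ET /chordX; ring.
rewrite wadd_chord // sl; cbv zeta; rewrite E Ey2 -EY -ET /chordY /chordX.
by congr Aff; ring.
Qed.

Lemma same_abscissa (F : fieldType) (W : weierstrass F) (x y y' : F) :
    on_curve W (Aff x y) -> on_curve W (Aff x y') ->
  Aff x y' = Aff x y \/ Aff x y' = wopp W (Aff x y).
Proof.
move=> /= <- E; have /eqP : (y' - y) * (y' - (- y - wa1 W * x - wa3 W)) = 0.
  transitivity (y' ^+ 2 + wa1 W * x * y' + wa3 W * y'
    - (y ^+ 2 + wa1 W * x * y + wa3 W * y)); first by ring.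
  by rewrite E subrr.
by rewrite mulf_eq0 !subr_eq0 => /orP[]/eqP->; [left | right].
Qed.

(** * Complete filtered fields and congruences *)

(** The properties of the ideals [I N] = p^N O_K that the group law uses: [idealV1] makes 1 + [I 1]
    consist of units, [ideal_cvg] is completeness, and [ideal_avoid] provides small perturbations
    into general position. *)
Record filtered_field (K : fieldType) (I : nat -> {pred K}) : Prop := FilteredField {
  ideal0 : forall N, 0 \in I N;
  idealB : forall N x y, x \in I N -> y \in I N -> x - y \in I N;
  ideal_one : 1 \in I 0;
  idealMM : forall M N x y, x \in I M -> y \in I N -> x * y \in I (M + N)%N;
  idealS : forall N x, x \in I N.+1 -> x \in I N;
  idealV1 : forall x, x - 1 \in I 1 -> x != 0 /\ x^-1 \in I 0;
  ideal_sep : forall x, (forall N, x \in I N) -> x = 0;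
  ideal_cvg : forall u : nat -> K, (forall j, u j \in I 0) ->
    (forall j, u j.+1 - u j \in I j) ->
    exists2 l, l \in I 0 & forall j, l - u j \in I j;
  ideal_avoid : forall N (s : seq K), exists2 x, x \in I N & x \notin s }.

Section Filtration.
Variables (K : fieldType) (I : nat -> {pred K}) (HI : filtered_field I).

Lemma idealN N x : x \in I N -> - x \in I N.
Proof. by move=> Ix; rewrite -sub0r (idealB HI) ?(ideal0 HI). Qed.

Lemma idealD N x y : x \in I N -> y \in I N -> x + y \in I N.
Proof. by move=> Ix Iy; rewrite -[y]opprK (idealB HI) ?idealN. Qed.

Lemma idealMl N x y : x \in I N -> y \in I 0 -> x * y \in I N.
Proof. by move=> Ix Iy; rewrite -[N]addn0 (idealMM HI). Qed.

Lemma idealMr N x y : x \in I 0 -> y \in I N -> x * y \in I N.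
Proof. by move=> Ix Iy; rewrite -[N]add0n (idealMM HI). Qed.

Lemma ideal_le M N x : (M <= N)%N -> x \in I N -> x \in I M.
Proof.
by move/subnK <-; elim: (N - M)%N => // d IH; rewrite addSn => /(idealS HI)/IH.
Qed.

Lemma ideal_nat n : n%:R \in I 0.
Proof.
elim: n => [|n IH]; first exact: (ideal0 HI).
by rewrite mulrS idealD ?(ideal_one HI).
Qed.

Lemma integralX n x : x \in I 0 -> x ^+ n \in I 0.
Proof.
move=> Ix; elim: n => [|n IH]; first exact: (ideal_one HI).
by rewrite exprS idealMl.
Qed.

Lemma idealX N n x : x \in I N -> x ^+ n \in I (n * N)%N.
Proof.
move=> Ix; elim: n => [|n IH]; first exact: (ideal_one HI).
by rewrite exprS mulSn (idealMM HI).
Qed.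

Definition eqmod N (x y : K) := x - y \in I N.
Local Notation cong := eqmod.

Lemma cong_refl N x : cong N x x.
Proof. by rewrite /eqmod subrr (ideal0 HI). Qed.

Lemma cong_sym N x y : cong N x y -> cong N y x.
Proof. by move=> xy; rewrite /eqmod -opprB idealN. Qed.

Lemma cong_trans N y x z : cong N x y -> cong N y z -> cong N x z.
Proof. by move=> xy yz; rewrite /eqmod -(subrKA y) idealD. Qed.

Lemma cong_le M N x y : (M <= N)%N -> cong N x y -> cong M x y.
Proof. exact: ideal_le. Qed.

Lemma cong0 N x : cong N x 0 = (x \in I N).
Proof. by rewrite /eqmod subr0. Qed.

Lemma congD N x x' y y' : cong N x x' -> cong N y y' -> cong N (x + y) (x' + y').
Proof. by move=> Hx Hy; rewrite /eqmod opprD addrACA idealD. Qed.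

Lemma congN N x x' : cong N x x' -> cong N (- x) (- x').
Proof. by move=> Hx; rewrite /eqmod -opprD idealN. Qed.

Lemma congM N x x' y y' : y \in I 0 -> x' \in I 0 ->
  cong N x x' -> cong N y y' -> cong N (x * y) (x' * y').
Proof.
move=> Iy Ix' Hx Hy; rewrite /eqmod.
have -> : x * y - x' * y' = (x - x') * y + x' * (y - y') by ring.
by apply: idealD; [apply: idealMl | apply: idealMr].
Qed.

Lemma congX N n x x' : x \in I 0 -> x' \in I 0 -> cong N x x' -> cong N (x ^+ n) (x' ^+ n).
Proof.
move=> Ix Ix' Hx; elim: n => [|n IH]; first exact: cong_refl.
by rewrite !exprS congM ?integralX.
Qed.

Lemma congMS a N y y' : a \in I 1 -> cong N y y' -> cong N.+1 (a * y) (a * y').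
Proof. by move=> Ia Hy; rewrite /eqmod -mulrBr -add1n (idealMM HI). Qed.

Lemma congV N x x' : x - 1 \in I 1 -> x' - 1 \in I 1 -> cong N x x' -> cong N x^-1 x'^-1.
Proof.
move=> /(idealV1 HI)[x0 Ix] /(idealV1 HI)[x'0 Ix'] Hx.
rewrite /eqmod; have -> : x^-1 - x'^-1 = - (x^-1 * x'^-1) * (x - x') by field; rewrite x0 x'0.
by rewrite idealMr // idealN // idealMl.
Qed.

Lemma cong_eq x y : (forall N, cong N x y) -> x = y.
Proof. by move=> Hxy; apply/eqP; rewrite -subr_eq0; apply/eqP/(ideal_sep HI). Qed.

End Filtration.

(* [integral HI] also proves membership in I 1 of products with a factor a_i. *)
Ltac integral HI := first
  [ assumption | exact: (ideal0 HI) | exact: (ideal_one HI) | exact: (ideal_nat HI)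
  | apply: (idealD HI); integral HI | apply: (idealB HI); integral HI
  | apply: (idealN HI); integral HI | apply: (integralX HI); integral HI
  | apply: (idealMl HI); [integral HI | integral HI]
  | apply: (idealMr HI); [integral HI | integral HI] ].

(** A common left factor in [I 1] gains one digit of precision, so [congMS] is tried before
    [congM]. *)
Ltac congruence_tac HI := first
  [ assumption | exact: (cong_refl HI)
  | apply: (congD HI); congruence_tac HI
  | apply: (congN HI); congruence_tac HI
  | apply: (congX HI); [integral HI | integral HI | congruence_tac HI]
  | apply: (congMS HI); [integral HI | congruence_tac HI]
  | apply: (congM HI); [integral HI | integral HI | congruence_tac HI | congruence_tac HI] ].

(* mul_coef_poly m z is m z - z(m P) modulo p^2, for a point P with z(P) = z.  *)
Definition mul_coef1 m := (\sum_(j < m) j)%N.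
Definition mul_coef2 m := (\sum_(j < m) j * j.+1)%N.
Definition mul_coef3 m := (\sum_(j < m) j * (2 * j ^ 2 + 3 * j + 2))%N.
Definition mul_coef4 m := (\sum_(j < m) 2 * (j ^ 2 + j + 1) * (j * j.+1))%N.
Definition mul_coef6 m := (\sum_(j < m) 3 * (j ^ 2 + j + 1) ^ 2 * (j * j.+1))%N.

Definition mul_coef_poly (K : fieldType) (W : weierstrass K) m z : K :=
  wa1 W * ((mul_coef1 m)%:R * z ^+ 2) + wa2 W * ((mul_coef2 m)%:R * z ^+ 3)
  + wa3 W * ((mul_coef3 m)%:R * z ^+ 4) + wa4 W * ((mul_coef4 m)%:R * z ^+ 5)
  + wa6 W * ((mul_coef6 m)%:R * z ^+ 7).

(** The interface between the curve and the theory of filtered modules. [cg_addS] makes the layers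
    additive. The error N + N + 1 in [cg_mulrn] is fine enough to compute p on layer N as soon as N
    > 0, and [cg_mul_mod2] covers layer 0. *)
Record chart_group (K : fieldType) (I : nat -> {pred K}) (W : weierstrass K)
    (G : zmodType) (z w : G -> K) (pt : G -> wpoint K) : Prop := ChartGroup {
  cg_inj : injective z;
  cg_z : forall g, z g \in I 0;
  cg_w : forall g, w g \in I 0;
  cg_on : forall g, on_chart W (z g) (w g);
  cg_ex : forall x, x \in I 0 -> exists g, z g = x;
  cg_pt : forall g, pt g = chart_point (z g) (w g);
  cg_pt_inj : injective pt;
  cg_ptD : forall g h, pt (g + h) = wadd W (pt g) (pt h);
  cg_ptM : forall g m, pt (g *~ m) = wmulz W m (pt g);
  cg_eqmod_w : forall N g h, eqmod I N (z g) (z h) -> eqmod I N (w g) (w h);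
  cg_0 : z 0 = 0;
  cg_addS : forall N g h, z h \in I N -> eqmod I N.+1 (z (g + h)) (z g + z h);
  cg_mulrn : forall N g m, z g \in I N ->
    eqmod I (N + N).+1 (z (g *+ m)) (m%:R * z g);
  cg_mul_mod2 : forall g m, eqmod I 2 (z (g *+ m)) (m%:R * z g - mul_coef_poly W m (z g)) }.

(** * The group of integral points of the chart *)

Section Points.
Variables (K : fieldType) (I : nat -> {pred K}) (HI : filtered_field I).
Variable W : weierstrass K.
Local Notation a1 := (wa1 W).
Local Notation a2 := (wa2 W).
Local Notation a3 := (wa3 W).
Local Notation a4 := (wa4 W).
Local Notation a6 := (wa6 W).
Hypotheses (I1 : a1 \in I 1) (I2 : a2 \in I 1) (I3 : a3 \in I 1)
  (I4 : a4 \in I 1) (I6 : a6 \in I 1).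
Local Notation cong := (eqmod I).

Let J1 : a1 \in I 0. Proof. exact: (idealS HI). Qed.
Let J2 : a2 \in I 0. Proof. exact: (idealS HI). Qed.
Let J3 : a3 \in I 0. Proof. exact: (idealS HI). Qed.
Let J4 : a4 \in I 0. Proof. exact: (idealS HI). Qed.
Let J6 : a6 \in I 0. Proof. exact: (idealS HI). Qed.

(** Every term of the denominator except 1 carries some a_i. The same holds for [cubic3] and
    [opp_den], so the addition formula is defined at all integral points. *)
Lemma slope_den_unit z2 w1 w2 : z2 \in I 0 -> w1 \in I 0 -> w2 \in I 0 ->
  slope_den W z2 w1 w2 - 1 \in I 1.
Proof.
move=> Iz Iw1 Iw2; rewrite /slope_den addrAC subrr add0r; integral HI.
Qed.

Lemma cubic3_unit l : l \in I 0 -> cubic3 W l - 1 \in I 1.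
Proof.
move=> Il; have -> : cubic3 W l - 1 = a2 * l + a4 * l ^+ 2 + a6 * l ^+ 3.
  by rewrite /cubic3; ring.
integral HI.
Qed.

Lemma opp_den_unit z w : z \in I 0 -> w \in I 0 -> opp_den W z w - 1 \in I 1.
Proof.
move=> Iz Iw; have -> : opp_den W z w - 1 = - (a1 * z + a3 * w).
  by rewrite /opp_den; ring.
integral HI.
Qed.

Lemma slope_den_neq0 z2 w1 w2 : z2 \in I 0 -> w1 \in I 0 -> w2 \in I 0 ->
  slope_den W z2 w1 w2 != 0.
Proof. by move=> Iz Iw Iw'; case: (idealV1 HI (slope_den_unit Iz Iw Iw')). Qed.

Lemma cubic3_neq0 l : l \in I 0 -> cubic3 W l != 0.
Proof. by move=> Il; case: (idealV1 HI (cubic3_unit Il)). Qed.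

Lemma opp_den_neq0 z w : z \in I 0 -> w \in I 0 -> opp_den W z w != 0.
Proof. by move=> Iz Iw; case: (idealV1 HI (opp_den_unit Iz Iw)). Qed.

Lemma slope_num_integral z1 z2 w1 : z1 \in I 0 -> z2 \in I 0 -> w1 \in I 0 ->
  slope_num W z1 z2 w1 \in I 0.
Proof. by move=> *; rewrite /slope_num; integral HI. Qed.

Lemma slope_integral z1 w1 z2 w2 :
    z1 \in I 0 -> w1 \in I 0 -> z2 \in I 0 -> w2 \in I 0 ->
  slope W z1 w1 z2 w2 \in I 0.
Proof.
move=> Iz1 Iw1 Iz2 Iw2; have [_ Iu] := idealV1 HI (slope_den_unit Iz2 Iw1 Iw2).
by rewrite /slope (idealMl HI) // slope_num_integral.
Qed.

Lemma cubic2_ideal l m : l \in I 0 -> m \in I 0 -> cubic2 W l m \in I 1.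
Proof. by move=> *; rewrite /cubic2; integral HI. Qed.

Lemma third_z_integral l m z1 z2 :
    l \in I 0 -> m \in I 0 -> z1 \in I 0 -> z2 \in I 0 ->
  third_z W l m z1 z2 \in I 0.
Proof.
move=> Il Im Iz1 Iz2; have [_ Id] := idealV1 HI (cubic3_unit Il).
have I2' := idealS HI (cubic2_ideal Il Im); rewrite /third_z; integral HI.
Qed.

Record point := Point { pz : K; pw : K;
  pz_integral : pz \in I 0; pw_integral : pw \in I 0; point_on : on_chart W pz pw }.

Definition pcong N (P Q : point) := cong N (pz P) (pz Q).

(** The slope between two integral points is integral, so w is a 1-Lipschitz function of z. In
    particular z determines the point. *)
Lemma pcong_w N P Q : pcong N P Q -> cong N (pw P) (pw Q).
Proof.
move=> PQ; rewrite /eqmod (slope_rel (point_on P) (point_on Q)).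
  apply: (idealMr HI) => //; exact: slope_integral (pz_integral _)
    (pw_integral _) (pz_integral _) (pw_integral _).
exact: slope_den_neq0 (pz_integral _) (pw_integral _) (pw_integral _).
Qed.

Lemma point_eq : injective pz.
Proof.
move=> P Q Ez; have Ew : pw P = pw Q.
  by apply: (cong_eq HI) => N; apply: pcong_w; rewrite /pcong Ez; apply: (cong_refl HI).
case: P Q Ez Ew => z w Iz Iw C [z' w' Iz' Iw' C'] /= Ez Ew.
by case: _ / Ez in Iz' C' *; case: _ / Ew in Iw' C' *; congr Point; apply: Prop_irrelevance.
Qed.

HB.instance Definition _ := Equality.copy point (inj_type point_eq).
HB.instance Definition _ := gen_choiceMixin point.

(** For fixed z the map v |-> [chart_rhs W z v] contracts by a factor p, since its difference
    quotient is 1 - [slope_den]. Its iterates from 0 converge to the required w. *)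
Lemma point_exists z : z \in I 0 -> exists P : point, pz P = z.
Proof.
move=> Iz; pose w := fix w n := if n is n'.+1 then chart_rhs W z (w n') else 0.
have Iw n : w n \in I 0.
  elim: n => [|n IH] /=; first exact: (ideal0 HI).
  by rewrite /chart_rhs; integral HI.
have contract v v' N : v \in I 0 -> v' \in I 0 -> cong N v v' ->
    cong N.+1 (chart_rhs W z v) (chart_rhs W z v').
  move=> Iv Iv' vv'; rewrite /eqmod.
  have -> : chart_rhs W z v - chart_rhs W z v' = - (slope_den W z v v' - 1) * (v - v').
    by rewrite /chart_rhs /slope_den; ring.
  by rewrite -add1n (idealMM HI) // (idealN HI) // slope_den_unit.
have cvg_w n : cong n (w n.+1) (w n).
  elim: n => [|n IH]; last by apply: (contract (w n.+1) (w n)).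
  by rewrite /eqmod (idealB HI).
have [v Iv Hv] := ideal_cvg HI Iw cvg_w.
suff C : on_chart W z v by exists (Point Iz Iv C).
apply: (cong_eq HI) => N; apply: (cong_trans HI (Hv N)).
apply: (cong_trans HI (cong_sym HI (cvg_w N))).
apply: (cong_sym HI); apply: (cong_le HI (leqnSn N)); exact: (contract v (w N) N Iv (Iw N) (Hv N)).
Qed.

Definition chart (P : point) := chart_point (pz P) (pw P).

Lemma chart_inj : injective chart.
Proof.
by move=> P Q /(chart_point_inj (point_on P) (point_on Q))[/point_eq].
Qed.

Section Sum.
Variables P Q : point.
Definition sum_slope := slope W (pz P) (pw P) (pz Q) (pw Q).
Definition sum_intercept := pw P - sum_slope * pz P.
Definition third_pz := third_z W sum_slope sum_intercept (pz P) (pz Q).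
Definition third_pw := sum_slope * third_pz + sum_intercept.

Lemma sum_slope_integral : sum_slope \in I 0.
Proof.
exact: (slope_integral (pz_integral P) (pw_integral P) (pz_integral Q) (pw_integral Q)).
Qed.

Lemma sum_intercept_integral : sum_intercept \in I 0.
Proof.
apply: (idealB HI); first exact: pw_integral.
by apply: (idealMl HI); [apply: sum_slope_integral | apply: pz_integral].
Qed.

Lemma third_pz_integral : third_pz \in I 0.
Proof.
exact: (third_z_integral sum_slope_integral sum_intercept_integral (pz_integral P) (pz_integral Q)).
Qed.

Lemma third_pw_integral : third_pw \in I 0.
Proof.
apply: (idealD HI); last exact: sum_intercept_integral.
by apply: (idealMl HI); [apply: sum_slope_integral | apply: third_pz_integral].
Qed.

Lemma pden_neq0 : slope_den W (pz Q) (pw P) (pw Q) != 0.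
Proof. exact: (slope_den_neq0 (pz_integral Q) (pw_integral P) (pw_integral Q)). Qed.
Lemma pcub_neq0 : cubic3 W sum_slope != 0.
Proof. exact: (cubic3_neq0 sum_slope_integral). Qed.
Lemma popp_neq0 : opp_den W third_pz third_pw != 0.
Proof. exact: (opp_den_neq0 third_pz_integral third_pw_integral). Qed.

Lemma chart_opp_integral z w : z \in I 0 -> w \in I 0 ->
  (chart_opp W z w).1 \in I 0 /\ (chart_opp W z w).2 \in I 0.
Proof.
move=> Iz Iw; have [_ Id] := idealV1 HI (opp_den_unit Iz Iw).
by split; rewrite /chart_opp /=; integral HI.
Qed.

Definition padd : point :=
  Point (chart_opp_integral third_pz_integral third_pw_integral).1
        (chart_opp_integral third_pz_integral third_pw_integral).2
        (chart_add_on_chart (point_on P) (point_on Q) pden_neq0 pcub_neq0 popp_neq0).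

Lemma chart_padd : chart padd = wadd W (chart P) (chart Q).
Proof. exact: (chart_add_point (point_on P) (point_on Q) pden_neq0 pcub_neq0 popp_neq0). Qed.

Definition popp : point :=
  Point (chart_opp_integral (pz_integral P) (pw_integral P)).1
        (chart_opp_integral (pz_integral P) (pw_integral P)).2
        (chart_opp_on_chart (point_on P)
           (opp_den_neq0 (pz_integral P) (pw_integral P))).

Lemma chart_popp : chart popp = wopp W (chart P).
Proof. exact: (chart_opp_point (opp_den_neq0 (pz_integral P) (pw_integral P))). Qed.

End Sum.

Lemma on_chart0 : on_chart W 0 0.
Proof. by rewrite /on_chart /chart_rhs; ring. Qed.

Definition pzero : point := Point (ideal0 HI 0) (ideal0 HI 0) on_chart0.

Lemma chart_pzero : chart pzero = Inf. Proof. exact: chart_point_inf. Qed.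

Lemma padd0 : left_id pzero padd.
Proof. by move=> P; apply: chart_inj; rewrite chart_padd chart_pzero. Qed.

Lemma padd0r : right_id pzero padd.
Proof. by move=> P; apply: chart_inj; rewrite chart_padd chart_pzero /=; case: chart. Qed.

Lemma paddN : left_inverse pzero popp padd.
Proof.
move=> P; apply: chart_inj; rewrite chart_padd chart_pzero chart_popp.
case: (chart P) => //= x y; rewrite eqxx /= ifT //; apply/eqP; ring.
Qed.

(** [slope_num] is not symmetric in the two points. But when their z differ, [slope_rel] determines
    the slope, and when their z agree, the points are equal. *)
Lemma paddC : commutative padd.
Proof.
move=> P Q; have [/point_eq->//|zPQ] := eqVneq (pz P) (pz Q).
have d0 : pz P - pz Q != 0 by rewrite subr_eq0.
have R : pw P - pw Q = sum_slope P Q * (pz P - pz Q).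
  exact: (slope_rel (point_on P) (point_on Q) (pden_neq0 P Q)).
have R' : pw Q - pw P = sum_slope Q P * (pz Q - pz P).
  exact: (slope_rel (point_on Q) (point_on P) (pden_neq0 Q P)).
have El : sum_slope P Q = sum_slope Q P.
  by apply: (mulIf d0); rewrite -R -[RHS]opprK -mulrN opprB -R' opprB.
have Em : sum_intercept P Q = sum_intercept Q P.
  move: R El; rewrite /sum_intercept; move: (sum_slope P Q) (sum_slope Q P) => s s' R <-.
  by have -> : pw P = pw Q + s * (pz P - pz Q); [rewrite -R | ]; ring.
have Ez : third_pz P Q = third_pz Q P by rewrite /third_pz /third_z El Em; ring.
by apply: point_eq; rewrite /= /third_pw Ez El Em.
Qed.

Lemma same_homX P Q : homX (chart P) = homX (chart Q) ->
  chart P <> Inf -> chart Q <> Inf -> Q = P \/ Q = popp P.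
Proof.
have := on_chart_curve (point_on P); have := on_chart_curve (point_on Q).
rewrite -/(chart P) -/(chart Q); case EP: (chart P) => [|x y] // CQ CP.
case EQ: (chart Q) CQ => [|x' y'] //= CQ Ex _ _; move: CQ; rewrite -Ex => CQ.
have [E|E] := same_abscissa CP CQ; [left | right]; apply: chart_inj.
  by rewrite EP EQ -Ex.
by rewrite chart_popp EP EQ -Ex.
Qed.

Lemma point_avoid N P (s : seq point) : exists2 Q, pcong N Q P & Q \notin s.
Proof.
have [x Ix xs] := ideal_avoid HI N [seq pz R - pz P | R <- s].
have [Q EQ] := point_exists (idealD HI (ideal_le HI (leq0n N) Ix) (pz_integral P)).
exists Q; first by rewrite /pcong EQ /eqmod addrK.
by apply: contra xs => Qs; apply/mapP; exists Q; rewrite // EQ addrK.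
Qed.

(** The excluded points are those for which two of the relevant abscissas coincide. The last two
    arise because x(Q + R) = x(P) means Q + R = P or - P, whence R = P - Q or - P - Q by
    [wadd_cancel]. *)
Lemma padd_generic_assoc P Q R :
    [/\ P != pzero, Q \notin [:: pzero; P; popp P] &
     R \notin [:: pzero; P; popp P; Q; popp Q; padd P Q; popp (padd P Q);
                 padd P (popp Q); padd (popp P) (popp Q)]] ->
  padd (padd P Q) R = padd P (padd Q R).
Proof.
rewrite !inE !negb_or => -[P0 /and3P[Q0 QP QP'] /and5P[R0 RP RP' RQ /and5P[RQ' RS RS' RD RD']]].
have affine A : A != pzero -> exists x y, chart A = Aff x y.
  case E: (chart A) => [|x y]; last by exists x, y.
  by case/eqP; apply: chart_inj; rewrite E chart_pzero.
have [[x1 [y1 E1]] [x2 [y2 E2]] [x3 [y3 E3]]] := And3 (affine P P0) (affine Q Q0) (affine R R0).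
have C1 := on_chart_curve (point_on P); rewrite -/(chart P) E1 in C1.
have C2 := on_chart_curve (point_on Q); rewrite -/(chart Q) E2 in C2.
have C3 := on_chart_curve (point_on R); rewrite -/(chart R) E3 in C3.
have distinct A B x y x' y' : chart A = Aff x y -> chart B = Aff x' y' ->
    B != A -> B != popp A -> x != x'.
  move=> EA EB BA BA'; apply/eqP => xx'.
  have := @same_homX A B; rewrite EA EB /= => /(_ xx')[]//; exact/eqP.
have x12 := distinct _ _ _ _ _ _ E1 E2 QP QP'.
have x13 := distinct _ _ _ _ _ _ E1 E3 RP RP'.
have x23 := distinct _ _ _ _ _ _ E2 E3 RQ RQ'.
apply: chart_inj; rewrite !chart_padd E1 E2 E3; apply: wadd_generic_assoc => //.
  have := chart_padd P Q; rewrite E1 E2 wadd_chord //; cbv zeta => ES.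
  exact: distinct ES E3 RS RS'.
have := chart_padd Q R; rewrite E2 E3; move: (wadd_chord W y2 y3 x23); cbv zeta => ->.
move=> ET; have Ewadd := wadd_chord W y2 y3 x23; move: Ewadd; cbv zeta.
set xT := chordX W _ x2 x3 in ET *; move=> Ewadd; apply/eqP => xT1.
have := @same_homX P (padd Q R); rewrite ET E1 /= xT1 => /(_ erefl)[]//.
  move=> EP; case/eqP: RD; apply: chart_inj; rewrite chart_padd chart_popp -EP ET E2 E3.
  by rewrite (wadd_cancel x23 Ewadd) // xT1.
move=> EP; case/eqP: RD'; apply: chart_inj; rewrite chart_padd -EP chart_popp ET E2 E3.
by rewrite (wadd_cancel x23 Ewadd) // xT1.
Qed.

Lemma third_pz_cong N P Q P' Q' : pcong N P P' -> pcong N Q Q' ->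
  [/\ cong N (sum_slope P Q) (sum_slope P' Q'), cong N (sum_intercept P Q) (sum_intercept P' Q'),
      cong N (third_pz P Q) (third_pz P' Q') & cong N (third_pw P Q) (third_pw P' Q')].
Proof.
move=> PP' QQ'; have [wP wQ] := (pcong_w PP', pcong_w QQ'); rewrite /pcong in PP' QQ'.
have := (pz_integral P, pw_integral P, pz_integral Q, pw_integral Q).
have := (pz_integral P', pw_integral P', pz_integral Q', pw_integral Q').
move=> [[[Iz1' Iw1'] Iz2'] Iw2'] [[[Iz1 Iw1] Iz2] Iw2].
have Il := sum_slope_integral P Q; have Il' := sum_slope_integral P' Q'.
have Im := sum_intercept_integral P Q; have Im' := sum_intercept_integral P' Q'.
have It := third_pz_integral P Q; have It' := third_pz_integral P' Q'.
have ld := cubic3_unit Il; have ld' := cubic3_unit Il'.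
have [_ Id] := idealV1 HI ld; have [_ Id'] := idealV1 HI ld'.
have su := slope_den_unit Iz2 Iw1 Iw2; have su' := slope_den_unit Iz2' Iw1' Iw2'.
have [_ Iu] := idealV1 HI su; have [_ Iu'] := idealV1 HI su'.
have cl : cong N (sum_slope P Q) (sum_slope P' Q').
  rewrite /sum_slope /slope; apply: (congM HI) => //; last apply: (congV HI) => //.
  - exact: slope_num_integral.
  - by rewrite /slope_num; congruence_tac HI.
  - by rewrite /slope_den; congruence_tac HI.
have cm : cong N (sum_intercept P Q) (sum_intercept P' Q') by rewrite /sum_intercept; congruence_tac HI.
have ct : cong N (third_pz P Q) (third_pz P' Q').
  rewrite /third_pz /third_z; apply: (congD HI); first by congruence_tac HI.
  apply: (congN HI); apply: (congM HI) => //; last apply: (congV HI) => //.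
  - exact: (idealS HI (cubic2_ideal Il' Im')).
  - by rewrite /cubic2; congruence_tac HI.
  - by rewrite /cubic3; congruence_tac HI.
by split=> //; rewrite /third_pw; congruence_tac HI.
Qed.

(* Its numerator is divisible by p because the a_i are.                       *)
Definition sum_err P Q :=
  (cubic2 W (sum_slope P Q) (sum_intercept P Q) / cubic3 W (sum_slope P Q)
    + (pz P + pz Q) * (a1 * third_pz P Q + a3 * third_pw P Q))
  / opp_den W (third_pz P Q) (third_pw P Q).

Lemma pz_padd P Q : pz (padd P Q) = pz P + pz Q + sum_err P Q.
Proof.
have n0 := popp_neq0 P Q; apply: (mulIf n0).
rewrite /= divfK // mulrDl /sum_err divfK //.
by rewrite /third_pz /third_z /opp_den; ring.
Qed.

(** Each term of the numerator carries an a_i and the denominators are units, so the error term is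
    known to one digit more than the points. *)
Lemma sum_err_cong N P Q P' Q' : pcong N P P' -> pcong N Q Q' ->
  cong N.+1 (sum_err P Q) (sum_err P' Q').
Proof.
move=> PP' QQ'; have [cl cm ct cw] := third_pz_cong PP' QQ'; rewrite /pcong in PP' QQ'.
have [Iz1 Iz2 Iz1' Iz2'] := And4 (pz_integral P) (pz_integral Q) (pz_integral P') (pz_integral Q').
have [Il Il' Im Im'] := And4 (sum_slope_integral P Q) (sum_slope_integral P' Q')
  (sum_intercept_integral P Q) (sum_intercept_integral P' Q').
have [It It' Iw Iw'] := And4 (third_pz_integral P Q) (third_pz_integral P' Q')
  (third_pw_integral P Q) (third_pw_integral P' Q').
have [ld ld'] := (cubic3_unit Il, cubic3_unit Il').
have [[_ Id] [_ Id']] := (idealV1 HI ld, idealV1 HI ld').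
have [nd nd'] := (opp_den_unit It Iw, opp_den_unit It' Iw').
have [[_ In] [_ In']] := (idealV1 HI nd, idealV1 HI nd').
have [Ib Ib'] := (idealS HI (cubic2_ideal Il Im), idealS HI (cubic2_ideal Il' Im')).
(* The terms are rearranged with the a_i on the left, where [congMS] can use them. *)
have cubic2E l m : cubic2 W l m =
    a1 * l + a3 * l ^+ 2 + a2 * m + a4 * (2%:R * l * m) + a6 * (3%:R * l ^+ 2 * m).
  by rewrite /cubic2; ring.
have numE z1 z2 t w : (z1 + z2) * (a1 * t + a3 * w) =
    a1 * ((z1 + z2) * t) + a3 * ((z1 + z2) * w) by ring.
rewrite /sum_err; apply: (congM HI) => //.
- by rewrite /cubic2 in Ib' *; integral HI.
- apply: (congD HI); last by rewrite !numE; congruence_tac HI.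
  apply: (congM HI) => //; first by rewrite !cubic2E; congruence_tac HI.
  by apply: (congV HI) => //; rewrite /cubic3; congruence_tac HI.
- by apply: (congV HI) => //; rewrite /opp_den; congruence_tac HI.
Qed.

Lemma padd_cong N P Q P' Q' : pcong N P P' -> pcong N Q Q' ->
  pcong N (padd P Q) (padd P' Q').
Proof.
move=> PP' QQ'; rewrite /pcong !pz_padd.
apply: (congD HI); first exact: (congD HI).
by apply: (cong_le HI (leqnSn N)); apply: sum_err_cong.
Qed.

(** Points in general position are dense ([point_avoid]) and addition is continuous ([padd_cong]),
    so both sides agree modulo p^N for every N. *)
Lemma paddA : associative padd.
Proof.
move=> P Q R; apply: point_eq; apply: (cong_eq HI) => N.
have [P' cP gP] := point_avoid N P [:: pzero].
have [Q' cQ gQ] := point_avoid N Q [:: pzero; P'; popp P'].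
have [R' cR gR] := point_avoid N R [:: pzero; P'; popp P'; Q'; popp Q';
  padd P' Q'; popp (padd P' Q'); padd P' (popp Q'); padd (popp P') (popp Q')].
rewrite mem_seq1 in gP; have E := padd_generic_assoc (And3 gP gQ gR).
have [sP sQ sR] := And3 (cong_sym HI cP) (cong_sym HI cQ) (cong_sym HI cR).
apply: (@cong_trans _ _ HI N (pz (padd P' (padd Q' R')))).
  exact: padd_cong sP (padd_cong sQ sR).
by rewrite -E; apply: (padd_cong (padd_cong cP cQ) cR).
Qed.

HB.instance Definition _ := GRing.isZmodule.Build point paddA paddC padd0 paddN.

Lemma sum_err0 P : sum_err P 0 = 0.
Proof.
have := pz_padd P pzero; rewrite padd0r [pz pzero]/= addr0 => /eqP.
by rewrite addrC -subr_eq subrr eq_sym => /eqP.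
Qed.

(** Since [sum_err P 0] vanishes, it is enough to compare [Q] with 0 and use the digit gained in
    [sum_err_cong]. *)
Lemma pz_addS N P Q : pz Q \in I N -> cong N.+1 (pz (P + Q)) (pz P + pz Q).
Proof.
move=> IQ; rewrite [pz _]pz_padd /eqmod addrC addKr -[sum_err _ _]subr0 -(sum_err0 P).
by apply: sum_err_cong; [apply: (cong_refl HI) | rewrite /pcong (cong0 I)].
Qed.

(** All terms of the equation other than z^3 are multiples of w, so w is z^3 divided by a unit
    [u]. *)
Lemma pw_ideal N P : pz P \in I N -> pw P \in I (3 * N).
Proof.
move=> IP; have [Iz Iw] := (pz_integral P, pw_integral P).
pose u := 1 - (a1 * pz P + a2 * pz P ^+ 2 + a3 * pw P + a4 * pz P * pw P + a6 * pw P ^+ 2).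
have u1 : u - 1 \in I 1 by rewrite /u addrAC subrr add0r; integral HI.
have [u0 Iu] := idealV1 HI u1.
have -> : pw P = pz P ^+ 3 / u.
  apply: (mulIf u0); rewrite divfK //; apply/eqP; rewrite -subr_eq0; apply/eqP.
  transitivity (pw P - chart_rhs W (pz P) (pw P)); first by rewrite /u /chart_rhs; ring.
  by rewrite -(point_on P) subrr.
by apply: (idealMl HI) => //; apply: (idealX HI).
Qed.

(** If both z have size p^N, then slope and intercept have size p^(2N) and the third point has z and
    w of size p^N. Every term of the numerator is thus of second order, with an extra factor a_i. *)
Lemma sum_err_ideal N P Q : pz P \in I N -> pz Q \in I N -> sum_err P Q \in I (N + N).+1.
Proof.
move=> IP IQ; have [Iw Iw'] := (pw_ideal IP, pw_ideal IQ).
have [Iz1 Iz2] := (pz_integral P, pz_integral Q).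
have [Iw1 Iw2] := (pw_integral P, pw_integral Q).
have [Il Im It Ir] := And4 (sum_slope_integral P Q) (sum_intercept_integral P Q)
  (third_pz_integral P Q) (third_pw_integral P Q).
have [_ Iu] := idealV1 HI (slope_den_unit Iz2 Iw1 Iw2).
have [_ Id] := idealV1 HI (cubic3_unit Il).
have [_ In] := idealV1 HI (opp_den_unit It Ir).
have le3 : (N + N <= 3 * N)%N by rewrite addnn -mul2n leq_mul2r orbT.
have lN : (N <= N + N)%N by rewrite leq_addr.
have Kw : pw P \in I (N + N) := ideal_le HI le3 Iw.
have KM x y : x \in I N -> y \in I N -> x * y \in I (N + N) by apply: (idealMM HI).
have Kl : sum_slope P Q \in I (N + N).
  apply: (idealMl HI) => //; rewrite /slope_num.
  have [K1 K2 K3] := And3 (KM _ _ IP IP) (KM _ _ IP IQ) (KM _ _ IQ IQ).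
  by rewrite !expr2; integral HI.
have Km : sum_intercept P Q \in I (N + N) by rewrite /sum_intercept; integral HI.
have K2 : cubic2 W (sum_slope P Q) (sum_intercept P Q) \in I (N + N).+1.
  have K1M x y : x \in I 1 -> y \in I (N + N) -> x * y \in I (N + N).+1.
    by rewrite -add1n; apply: (idealMM HI).
  have [M1 M2 M3 M4] := And4 (K1M _ _ I1 Kl) (K1M _ _ I3 Kl) (K1M _ _ I2 Km) (K1M _ _ I4 Kl).
  have M6 := K1M _ _ I6 Kl.
  have -> : cubic2 W (sum_slope P Q) (sum_intercept P Q) = a1 * sum_slope P Q + a3 * sum_slope P Q * sum_slope P Q
      + a2 * sum_intercept P Q + a4 * sum_slope P Q * (2%:R * sum_intercept P Q)
      + a6 * sum_slope P Q * (3%:R * sum_slope P Q * sum_intercept P Q) by rewrite /cubic2; ring.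
  by integral HI.
have Kt : third_pz P Q \in I N.
  rewrite /third_pz /third_z; apply: (idealB HI); first by integral HI.
  by apply: (idealMl HI) => //; apply: (ideal_le HI _ K2); rewrite ltnW.
have Kr : third_pw P Q \in I N.
  have [Kl' Km'] := (ideal_le HI lN Kl, ideal_le HI lN Km).
  by rewrite /third_pw; integral HI.
rewrite /sum_err; apply: (idealMl HI) => //; apply: (idealD HI).
  exact: (idealMl HI).
have -> : (pz P + pz Q) * (a1 * third_pz P Q + a3 * third_pw P Q) =
    a1 * ((pz P + pz Q) * third_pz P Q) + a3 * ((pz P + pz Q) * third_pw P Q) by ring.
have IS : pz P + pz Q \in I N by apply: (idealD HI).
by rewrite -add1n; apply: (idealD HI); apply: (idealMM HI); rewrite // KM.
Qed.

Lemma pz_mulrn N P m : pz P \in I N ->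
  cong (N + N).+1 (pz (P *+ m)) (m%:R * pz P).
Proof.
move=> IP; elim: m => [|m IH].
  by rewrite mulr0n mul0r; apply: (cong_refl HI).
have IQ : pz (P *+ m) \in I N.
  rewrite -[pz _](subrK (m%:R * pz P)) (idealD HI) ?(idealMr HI) ?(ideal_nat HI) //.
  by apply: (ideal_le HI _ IH); rewrite leqW // leq_addr.
rewrite mulrS [pz _]pz_padd mulrS mulrDl mul1r -[X in cong _ _ X]addr0.
apply: (congD HI); first by apply: (congD HI) => //; apply: (cong_refl HI).
by rewrite (cong0 I) sum_err_ideal.
Qed.

(* sum_err modulo p^2, where only the terms linear in the a_i survive; L and  *)
(* N are the slope and the intercept of the line through both points mod p.   *)
Definition law_term (z1 z2 : K) :=
  let L := z1 ^+ 2 + z1 * z2 + z2 ^+ 2 in let N := - (z1 * z2 * (z1 + z2)) in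
  a1 * (- (z1 * z2)) + a2 * N
  + a3 * (L ^+ 2 + (z1 + z2) * (- (L * (z1 + z2)) + N))
  + a4 * (2%:R * L * N) + a6 * (3%:R * L ^+ 2 * N).

Lemma cong_div_unit N x u : x \in I N -> u - 1 \in I 1 -> cong N.+1 (x / u) x.
Proof.
move=> Ix u1; have [u0 Iu] := idealV1 HI u1; rewrite /eqmod.
have -> : x / u - x = x * (- (u - 1) / u) by field.
by rewrite -addn1; apply: (idealMM HI) => //; apply: (idealMl HI) => //; apply: (idealN HI).
Qed.

(** The a_i supply one factor p, so all else is needed only modulo p, where the curve is w = z^3.
    Approximations [z1] and [z2] are allowed because z(m P) will be replaced by m z(P), to which it
    is congruent modulo p. *)
Lemma sum_err_mod2 P Q z1 z2 : z1 \in I 0 -> z2 \in I 0 ->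
  cong 1 (pz P) z1 -> cong 1 (pz Q) z2 -> cong 2 (sum_err P Q) (law_term z1 z2).
Proof.
move=> J1' J2' c1 c2.
have [Iz1 Iz2] := (pz_integral P, pz_integral Q).
have [Iw1 Iw2] := (pw_integral P, pw_integral Q).
have [Il Im It Ir] := And4 (sum_slope_integral P Q) (sum_intercept_integral P Q)
  (third_pz_integral P Q) (third_pw_integral P Q).
pose L := z1 ^+ 2 + z1 * z2 + z2 ^+ 2; pose M := - (z1 * z2 * (z1 + z2)).
have IL : L \in I 0 by rewrite /L; integral HI.
have IM : M \in I 0 by rewrite /M; integral HI.
have cw R z : z \in I 0 -> cong 1 (pz R) z -> cong 1 (pw R) (z ^+ 3).
  have [Iz Iw] := (pz_integral R, pw_integral R).
  move=> Jz cz; apply: (@cong_trans _ _ HI 1 (pz R ^+ 3)); last by congruence_tac HI.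
  rewrite /eqmod [X in X - _](point_on R).
  have -> : chart_rhs W (pz R) (pw R) - pz R ^+ 3 = a1 * pz R * pw R
      + a2 * pz R ^+ 2 * pw R + a3 * pw R ^+ 2 + a4 * pz R * pw R ^+ 2
      + a6 * pw R ^+ 3 by rewrite /chart_rhs; ring.
  by integral HI.
have cl : cong 1 (sum_slope P Q) L.
  apply: (cong_trans HI (y := slope_num W (pz P) (pz Q) (pw P))).
    apply: (cong_div_unit (N := 0)); first exact: slope_num_integral.
    exact: slope_den_unit.
  rewrite /slope_num -!addrA [X in cong _ (_ + X) _]addrA [X in cong _ X _]addrA.
  rewrite -[X in cong _ _ X]addr0 /L; apply: (congD HI).
    by rewrite addrA; congruence_tac HI.
  by rewrite (cong0 I); integral HI.
have cm : cong 1 (sum_intercept P Q) M.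
  have -> : M = z1 ^+ 3 - L * z1 by rewrite /M /L; ring.
  have cw1 := cw P z1 J1' c1; rewrite /sum_intercept; congruence_tac HI.
have ct : cong 1 (third_pz P Q) (- (z1 + z2)).
  rewrite opprD -[X in cong _ _ X]addr0; apply: (congD HI); first by congruence_tac HI.
  have [_ Id] := idealV1 HI (cubic3_unit Il).
  by rewrite (cong0 I) (idealN HI) // (idealMl HI) // cubic2_ideal.
have cr : cong 1 (third_pw P Q) (- (L * (z1 + z2)) + M).
  by rewrite -mulrN /third_pw; congruence_tac HI.
have Ib := cubic2_ideal Il Im.
apply: (cong_trans HI (cong_div_unit _ (opp_den_unit It Ir))).
  have [_ Id] := idealV1 HI (cubic3_unit Il).
  by integral HI.
apply: (cong_trans HI (congD HI (cong_div_unit Ib (cubic3_unit Il)) (cong_refl HI _ _))).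
have -> : cubic2 W (sum_slope P Q) (sum_intercept P Q) + (pz P + pz Q) * (a1 * third_pz P Q + a3 * third_pw P Q) =
  a1 * (sum_slope P Q + (pz P + pz Q) * third_pz P Q)
  + a2 * sum_intercept P Q + a3 * (sum_slope P Q ^+ 2 + (pz P + pz Q) * third_pw P Q)
  + a4 * (2%:R * sum_slope P Q * sum_intercept P Q) + a6 * (3%:R * sum_slope P Q ^+ 2 * sum_intercept P Q).
  by rewrite /cubic2; ring.
rewrite /law_term; cbv zeta; rewrite -/L -/M.
have -> : - (z1 * z2) = L + (z1 + z2) * (- (z1 + z2)) by rewrite /L; ring.
by congruence_tac HI.
Qed.

(** The sums [mul_coef1], ..., [mul_coef6] are made for this recursion: their j-th summands are the
    negated coefficients of [law_term z (j z)], the error in adding P to j P. *)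
Lemma mul_coef_polyS m z : mul_coef_poly W m.+1 z = mul_coef_poly W m z - law_term z (m%:R * z).
Proof.
rewrite /mul_coef_poly /law_term /mul_coef1 /mul_coef2 /mul_coef3 /mul_coef4 /mul_coef6.
rewrite !big_ord_recr /=; ring.
Qed.

Lemma mul_coef_poly_ideal m x : x \in I 0 -> mul_coef_poly W m x \in I 1.
Proof. by move=> Ix; have Inat := ideal_nat HI; rewrite /mul_coef_poly; integral HI. Qed.

Lemma pz_mul_mod2 P m : cong 2 (pz (P *+ m)) (m%:R * pz P - mul_coef_poly W m (pz P)).
Proof.
have Iz := pz_integral P; have Im := ideal_nat HI m.
have Ip n := mul_coef_poly_ideal n Iz.
elim: m Im => [|m IH] Im.
  rewrite mulr0n mul0r /mul_coef_poly /mul_coef1 /mul_coef2 /mul_coef3 /mul_coef4 /mul_coef6.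
  by rewrite !big_ord0 !mul0r !mulr0 !addr0 subr0; apply: (cong_refl HI).
have {}Im := ideal_nat HI m; have {}IH := IH Im.
have IH1 : cong 1 (pz (P *+ m)) (m%:R * pz P).
  apply: (cong_trans HI (cong_le HI (leqnSn 1) IH)).
  by rewrite /eqmod addrAC subrr add0r (idealN HI).
rewrite mulrS [pz _]pz_padd mul_coef_polyS.
have -> : m.+1%:R * pz P - (mul_coef_poly W m (pz P) - law_term (pz P) (m%:R * pz P))
  = pz P + (m%:R * pz P - mul_coef_poly W m (pz P)) + law_term (pz P) (m%:R * pz P) by ring.
apply: (congD HI); first by apply: (congD HI) => //; apply: (cong_refl HI).
by apply: sum_err_mod2 => //; [integral HI | apply: (cong_refl HI)].
Qed.

Lemma chart_mulz P m : chart (P *~ m) = wmulz W m (chart P).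
Proof.
have E n : chart (P *+ n) = iter n (wadd W (chart P)) Inf.
  elim: n => [|n IH]; first by rewrite mulr0n; exact: chart_pzero.
  by rewrite mulrS [chart _]chart_padd IH.
by case: m => n; [exact: (E n) | rewrite /wmulz -(E n.+1) -chart_popp].
Qed.

Lemma point_group : @chart_group K I W point pz pw chart.
Proof.
split=> //; [exact: point_eq | exact: pz_integral | exact: pw_integral | exact: point_on
  | exact: point_exists | exact: chart_inj | exact: chart_padd | exact: chart_mulz
  | exact: pcong_w | exact: pz_addS | exact: pz_mulrn | exact: pz_mul_mod2].
Qed.

End Points.

Theorem chart_group_exists (K : fieldType) (I : nat -> {pred K}) (W : weierstrass K) :
    filtered_field I -> wa1 W \in I 1 -> wa2 W \in I 1 -> wa3 W \in I 1 ->
    wa4 W \in I 1 -> wa6 W \in I 1 ->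
  exists (G : zmodType) (z w : G -> K) (pt : G -> wpoint K), chart_group I W z w pt.
Proof.
move=> HI I1 I2 I3 I4 I6.
by do 4?[eexists]; apply: (point_group HI I1 I2 I3 I4 I6).
Qed.

(** * Divisibility and units in the p-adic integers *)

Section PadicIntegers.
Variables (p : nat) (pr_p : prime p).
Local Notation Zp := (padic_int pr_p).
Implicit Types (x y : Zp) (n : nat).

Lemma padic_res_dvd x m n : (m <= n)%N -> ((p ^ m)%N %| padic_res x n - padic_res x m)%Z.
Proof. by move=> le_mn; rewrite -eqz_mod_dvd (padic_res_le x le_mn) modz_mod. Qed.

Lemma padic_ext x y : (forall n, ((p ^ n)%N %| padic_res x n - padic_res y n)%Z) -> x = y.
Proof.
move=> Hxy; apply: padicP => n; have := Hxy n; rewrite -eqz_mod_dvd => /eqP.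
by rewrite !padic_res_mod.
Qed.

Lemma padic_res_nat m n : padic_res (m%:R : Zp) n = (m%:Z %% (p ^ n)%N)%Z.
Proof. by elim: m => [//|m IH]; rewrite mulrS /= IH modzDm -PoszD add1n. Qed.

(** Division by p costs one digit: the n-th residue of the quotient comes from the residue of index
    n + 1. *)
Lemma padic_red_eq0 x : padic_red x = 0 -> exists y, x = p%:R * y.
Proof.
rewrite /padic_red => /eqP; rewrite -(dvdz_pcharf (pchar_Fp pr_p)) => p1.
have px n : (p %| padic_res x n.+1)%Z.
  have := @padic_res_dvd x 1 n.+1 isT; rewrite expn1 => /(rpredD p1).
  by rewrite addrC subrK.
have p0 : p%:Z != 0 by rewrite -lt0n prime_gt0.
have Hc n : ((padic_res x n.+2 %/ p)%Z = (padic_res x n.+1 %/ p)%Z %[mod (p ^ n)%N])%Z.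
  apply/eqP; rewrite eqz_mod_dvd -(dvdz_mul2r p0) mulrBl !divzK //.
  by rewrite -PoszM -expnSr padic_res_dvd.
exists (padic_mk pr_p Hc); apply: padic_ext => n.
rewrite -eqz_mod_dvd; apply/eqP; rewrite /= padic_res_nat !modzMml modzMmr modz_mod.
rewrite mulrC divzK //; apply/eqP; rewrite eqz_mod_dvd -opprB rpredN.
exact: padic_res_dvd.
Qed.

(** Bezout gives an inverse modulo each p^n, and uniqueness of inverses makes them compatible. *)
Lemma padic_red_unit x : padic_red x != 0 -> exists y, y * x = 1.
Proof.
rewrite /padic_red -(dvdz_pcharf (pchar_Fp pr_p)) => p1.
have cop n : coprimez (padic_res x n) (p ^ n)%N.
  case: n => [|n]; first by rewrite expn0 coprimez_sym coprimezE coprime1n.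
  rewrite coprimezE /= coprimeXr // coprime_sym prime_coprime //.
  apply: contra p1 => pn; have := @padic_res_dvd x 1 n.+1 isT; rewrite expn1.
  by rewrite -opprB rpredN => /rpredD/(_ pn); rewrite subrK.
have ex_inv n : exists b : int, ((p ^ n)%N %| b * padic_res x n - 1)%Z.
  have /coprimezP[[u v] /= E] := cop n; exists u.
  by rewrite -E opprD addNKr rpredN dvdz_mull.
have [b Hb] := choice ex_inv.
have Hc n : (b n.+1 = b n %[mod (p ^ n)%N])%Z.
  apply/eqP; rewrite eqz_mod_dvd -(Gauss_dvdzl _ (p := padic_res x n)); last by rewrite coprimez_sym.
  rewrite (_ : _ * _ = (b n.+1 * padic_res x n.+1 - 1) - (b n * padic_res x n - 1)
      - b n.+1 * (padic_res x n.+1 - padic_res x n)); last by ring.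
  have Hb' : ((p ^ n)%N %| b n.+1 * padic_res x n.+1 - 1)%Z.
    by apply: dvdz_trans (Hb n.+1); rewrite expnS PoszM dvdz_mull.
  apply: rpredB; last by apply: dvdz_mull; apply: padic_res_dvd.
  by apply: rpredB; [apply: Hb' | apply: Hb].
exists (padic_mk pr_p Hc); apply: padic_ext => n.
by rewrite -eqz_mod_dvd /= !modz_mod modzMml eqz_mod_dvd.
Qed.

Lemma padic_valuation x : x != 0 -> exists m y, x = p%:R ^+ m * y /\ padic_red y != 0.
Proof.
move=> /padic_res_neq0[n]; elim: n x => [|n IH] x xn0.
  by move: xn0; rewrite -padic_res_mod expn0 modz1.
have [/padic_red_eq0[y Ey] | rx] := eqVneq (padic_red x) 0; last first.
  by exists 0%N, x; rewrite mul1r.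
have [|m [u [Eu ru]]] := IH y; last by exists m.+1, u; rewrite exprS -mulrA -Eu.
apply: contraNneq xn0 => y0; rewrite -padic_res_mod; apply/eqP/dvdz_mod0P.
have py : ((p ^ n)%N %| padic_res y n.+1)%Z.
  by have := padic_res_dvd y (leqnSn n); rewrite y0 subr0.
rewrite Ey /= padic_res_nat; apply/dvdz_mod0P; rewrite modz_mod modzMml.
by apply/dvdz_mod0P; rewrite expnS PoszM dvdz_mul.
Qed.

End PadicIntegers.

(** * Classification of filtered Z_p-modules *)

Record p_filtration (p : nat) (G : zmodType) (Fil : nat -> {pred G}) : Prop := PFiltration {
  fil0 : forall r, 0 \in Fil r;
  filB : forall r g h, g \in Fil r -> h \in Fil r -> g - h \in Fil r;
  filS : forall r g, g \in Fil r.+1 -> g \in Fil r;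
  fil_sep : forall g, (forall r, g \in Fil r) -> g = 0;
  fil_p : forall r g, g \in Fil r -> g *+ p \in Fil r.+1 }.

(* gr r identifies Fil r / Fil r.+1 with F_p^n; phi is multiplication by p    *)
(* from layer 0 to layer 1, and on the later layers it is the identity.       *)
Record p_graded (p : nat) (G : zmodType) (Fil : nat -> {pred G}) (n : nat)
    (gr : nat -> G -> 'rV['F_p]_n) (phi : 'M['F_p]_n) : Prop := PGraded {
  grD : forall r g h, g \in Fil r -> h \in Fil r -> gr r (g + h) = gr r g + gr r h;
  gr_ker : forall r g, g \in Fil r -> gr r g = 0 -> g \in Fil r.+1;
  gr_S : forall r g, g \in Fil r.+1 -> gr r g = 0;
  gr_surj : forall r v, exists2 g, g \in Fil r & gr r g = v;
  gr_p : forall r g, g \in Fil r.+1 -> gr r.+2 (g *+ p) = gr r.+1 g;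
  gr_p0 : forall g, g \in Fil 0 -> gr 1%N (g *+ p) = gr 0%N g *m phi }.

(** [s c g] is the limit of the integer multiples of [g] by the residues of [c]. The existence of
    such an [s] is the form in which completeness of the group is used. *)
Definition zp_action (p : nat) (pr_p : prime p) (G : zmodType) (Fil : nat -> {pred G})
    (s : padic_int pr_p -> G -> G) : Prop :=
  forall c g, g \in Fil 0 -> forall j, s c g - g *~ padic_res c j \in Fil j.

Section FilteredModule.
Variables (p : nat) (pr_p : prime p) (G : zmodType) (Fil : nat -> {pred G}).
Local Notation Zp := (padic_int pr_p).
Hypothesis HF : p_filtration p Fil.
Variable s : Zp -> G -> G.
Hypothesis Hs : zp_action Fil s.

Lemma filN r g : g \in Fil r -> - g \in Fil r.
Proof. by move=> Fg; rewrite -sub0r (filB HF) ?(fil0 HF). Qed.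

Lemma filD r g h : g \in Fil r -> h \in Fil r -> g + h \in Fil r.
Proof. by move=> Fg Fh; rewrite -[h]opprK (filB HF) ?filN. Qed.

Lemma fil_le q r g : (q <= r)%N -> g \in Fil r -> g \in Fil q.
Proof.
by move/subnK <-; elim: (r - q)%N => // d IH; rewrite addSn => /(filS HF)/IH.
Qed.

Lemma filMz r g m : g \in Fil r -> g *~ m \in Fil r.
Proof.
move=> Fg; have FMn k : g *+ k \in Fil r.
  by elim: k => [|k IH]; rewrite ?(fil0 HF) // mulrS filD.
by case: m => k; rewrite ?NegzE ?mulrNz -pmulrn ?filN.
Qed.

Lemma fil_sum r (J : Type) (t : seq J) (P : pred J) (F : J -> G) :
  (forall i, P i -> F i \in Fil r) -> \sum_(i <- t | P i) F i \in Fil r.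
Proof. by move=> FF; elim/big_ind: _ => //; [exact: (fil0 HF) | exact: filD]. Qed.

Lemma fil_pX r j g : g \in Fil r -> g *+ (p ^ j) \in Fil (r + j)%N.
Proof.
by move=> Fg; elim: j => [|j IH]; rewrite ?addn0 // addnS expnSr mulrnA (fil_p HF).
Qed.

Lemma fil_dvd r j g m : g \in Fil r -> ((p ^ j)%N %| m)%Z -> g *~ m \in Fil (r + j)%N.
Proof. by move=> Fg /dvdzP[u ->]; rewrite mulrC mulrzA filMz // -pmulrn fil_pX. Qed.

Lemma fil0_dvd j g m : g \in Fil 0 -> ((p ^ j)%N %| m)%Z -> g *~ m \in Fil j.
Proof. by move=> Fg /(fil_dvd Fg). Qed.

Lemma fil_act r c g : g \in Fil r -> s c g \in Fil r.
Proof.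
move=> Fg; have F0 : g \in Fil 0 by apply: fil_le Fg.
by rewrite -[s c g](subrK (g *~ padic_res c r)) filD ?filMz ?(Hs c).
Qed.

(** Limits are unique in a separated filtration. The module laws for [s] follow by exhibiting
    suitable integer approximations. *)
Lemma act_uniq c g h (m : nat -> int) : g \in Fil 0 ->
    (forall j, ((p ^ j)%N %| m j - padic_res c j)%Z) ->
    (forall j, h - g *~ m j \in Fil j) -> s c g = h.
Proof.
move=> Fg Hm Hh; apply/eqP; rewrite -subr_eq0; apply/eqP/(fil_sep HF) => j.
have -> : s c g - h = (s c g - g *~ padic_res c j) - g *~ (m j - padic_res c j)
    - (h - g *~ m j).
  by rewrite mulrzBr opprB addrA subrK opprB addrA subrK.
by apply: (filB HF) => //; apply: (filB HF); [apply: Hs | apply: fil0_dvd].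
Qed.

Lemma mulz_cong j g m m' : g \in Fil 0 -> ((p ^ j)%N %| m - m')%Z -> g *~ m - g *~ m' \in Fil j.
Proof. by move=> Fg Hm; rewrite -mulrzBr; apply: fil0_dvd. Qed.

Lemma actDl c d g : g \in Fil 0 -> s (c + d) g = s c g + s d g.
Proof.
move=> Fg; apply: (act_uniq (m := fun j => padic_res c j + padic_res d j)) => // j.
  by rewrite -eqz_mod_dvd /= modz_mod.
by rewrite mulrzDr opprD addrACA filD // Hs.
Qed.

Lemma actDr c g h : g \in Fil 0 -> h \in Fil 0 -> s c (g + h) = s c g + s c h.
Proof.
move=> Fg Fh; apply: (act_uniq (m := padic_res c)) => [|j|j]; first exact: filD.
  by rewrite subrr dvdz0.
by rewrite mulrzDl opprD addrACA filD // Hs.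
Qed.

Lemma actM c d g : g \in Fil 0 -> s (c * d) g = s c (s d g).
Proof.
move=> Fg; apply: (act_uniq (m := fun j => padic_res d j * padic_res c j)) => // j.
  by rewrite mulrC -eqz_mod_dvd /= modz_mod.
rewrite mulrzA -(subrKA (s d g *~ padic_res c j)) filD //; first exact/Hs/fil_act.
by rewrite -mulrzBl filMz // Hs.
Qed.

Lemma act_nat m g : g \in Fil 0 -> s m%:R g = g *+ m.
Proof.
move=> Fg; apply: (act_uniq (m := fun=> m%:Z)) => // j; last by rewrite pmulrn subrr (fil0 HF).
by rewrite padic_res_nat -eqz_mod_dvd modz_mod.
Qed.

Lemma act_torsion c g : g \in Fil 0 -> g *+ p = 0 -> s c g = g *+ (padic_red c : 'F_p).
Proof.
move=> Fg pg0; pose m j := if j is 0%N then 0%:Z else padic_res c j.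
apply: (act_uniq (m := m)) => // -[|j] /=.
- by rewrite expn0 dvd1z.
- by rewrite subrr dvdz0.
- by rewrite mulr0z subr0 pmulrn filMz.
rewrite pmulrn -mulrzBr.
suff /dvdzP[u ->] : (p %| (padic_red c : 'F_p)%:Z - padic_res c j.+1)%Z.
  by rewrite mulrC mulrzA -pmulrn pg0 mul0rz (fil0 HF).
rewrite (dvdz_pcharf (pchar_Fp pr_p)) intrB.
have -> : ((padic_red c : 'F_p)%:Z)%:~R = padic_red c :> 'F_p by rewrite -pmulrn natr_Zp.
rewrite /padic_red -intrB -(dvdz_pcharf (pchar_Fp pr_p)) -opprB rpredN.
by have := @padic_res_dvd p pr_p c 1 j.+1 isT; rewrite expn1.
Qed.

Lemma act_sum c (J : Type) (t : seq J) (P : pred J) (F : J -> G) :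
    (forall i, P i -> F i \in Fil 0) ->
  s c (\sum_(i <- t | P i) F i) = \sum_(i <- t | P i) s c (F i).
Proof.
move=> FF; have act0 : s c 0 = 0.
  by apply: (addrI (s c 0)); rewrite -actDr ?(fil0 HF) // !addr0.
elim: t => [|i t IH]; rewrite ?big_nil // !big_cons.
by case: ifP => // Pi; rewrite actDr ?IH ?FF ?fil_sum.
Qed.

Variables (n : nat) (gr : nat -> G -> 'rV['F_p]_n) (phi : 'M['F_p]_n).
Hypothesis Hgr : p_graded Fil gr phi.

Lemma gr_mulz r g m : g \in Fil r -> gr r (g *~ m) = m%:~R *: gr r g.
Proof.
move=> Fg; have gr0 : gr r 0 = 0.
  by apply: (addrI (gr r 0)); rewrite -(grD Hgr) ?(fil0 HF) // !addr0.
have FMn k : g *+ k \in Fil r by rewrite pmulrn filMz.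
have grMn k : gr r (g *+ k) = k%:R *: gr r g.
  elim: k => [|k IH]; first by rewrite gr0 scale0r.
  by rewrite mulrS (grD Hgr) // IH mulrS scalerDl scale1r.
case: m => k; first exact: grMn.
apply: (addrI (gr r (g *+ k.+1))); rewrite NegzE !mulrNz -!pmulrn.
by rewrite -(grD Hgr) ?filN // addrN gr0 grMn scaleNr addrN.
Qed.

Lemma gr_opp r g : g \in Fil r -> gr r (- g) = - gr r g.
Proof. by move=> Fg; rewrite -mulrN1z gr_mulz // scaleN1r. Qed.

Lemma gr_sum r (J : Type) (t : seq J) (P : pred J) (F : J -> G) :
    (forall i, P i -> F i \in Fil r) ->
  gr r (\sum_(i <- t | P i) F i) = \sum_(i <- t | P i) gr r (F i).
Proof.
move=> FF; elim: t => [|i t IH].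
  by rewrite !big_nil -[0 in LHS](mulr0z (0 : G)) gr_mulz ?(fil0 HF) // scale0r.
by rewrite !big_cons; case: ifP => // Pi; rewrite (grD Hgr) ?IH ?FF ?fil_sum.
Qed.

Lemma gr_pX r j g : g \in Fil r.+1 -> gr (r.+1 + j)%N (g *+ (p ^ j)) = gr r.+1 g.
Proof.
move=> Fg; elim: j => [|j IH]; first by rewrite addn0.
by rewrite addnS expnSr mulrnA addSn (gr_p Hgr) -addSn // fil_pX.
Qed.

Lemma gr_act r c g : g \in Fil r -> gr r (s c g) = padic_red c *: gr r g.
Proof.
move=> Fg; rewrite /padic_red -gr_mulz // -[s c g](subrK (g *~ padic_res c 1)).
suff F : s c g - g *~ padic_res c 1 \in Fil r.+1.
  by rewrite (grD Hgr) ?filMz // ?(gr_S Hgr F) ?add0r // (filS HF).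
rewrite -(subrKA (g *~ padic_res c r.+1)) filD //; first exact/Hs/(fil_le _ Fg).
by rewrite -mulrzBr -addn1; apply: fil_dvd; rewrite // padic_res_dvd // addn1.
Qed.

Section Basis.
Variables (w : 'I_n -> G) (B : 'M['F_p]_n).
Hypotheses (w_fil : forall i, w i \in Fil 1) (B_unit : B \in unitmx)
  (gr_w : forall i, gr 1%N (w i) = row i B).

Definition comb (y : 'I_n -> int) := \sum_i w i *~ y i.

(** Multiplication by p^j preserves layer coordinates from layer 1 on, so the p^j w_i form a basis
    of layer j + 1. This drives the digit-by-digit expansion. *)
Lemma gr_comb j (u : 'I_n -> int) :
  gr j.+1 (comb (fun i => u i * (p ^ j)%N)) = (\row_i (u i)%:~R) *m B.
Proof.
have Fpj i : w i *+ (p ^ j) \in Fil j.+1 by apply: (fil_pX j (w_fil i)).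
rewrite /comb gr_sum => [|i _]; last by rewrite mulrC mulrzA -pmulrn filMz.
rewrite mulmx_sum_row; apply: eq_bigr => i _.
by rewrite mulrC mulrzA -pmulrn gr_mulz // -[j.+1]add1n gr_pX // gr_w mxE.
Qed.

Lemma comb_inj j y : comb y \in Fil j.+1 -> forall i, ((p ^ j)%N %| y i)%Z.
Proof.
elim: j y => [|j IH] y Fy; first by move=> i; rewrite expn0 dvd1z.
have Hy := IH y (filS HF Fy).
have [u Hu] := choice (fun i => elimT dvdzP (Hy i)).
have Ey : comb y = comb (fun i => u i * (p ^ j)%N) by apply: eq_bigr => i _; rewrite Hu.
have := gr_comb j u; rewrite -Ey (gr_S Hgr) // => /esym/(congr1 (mulmx^~ (invmx B))).
rewrite /= mulmxK // mul0mx => /rowP u0 i; rewrite Hu expnS PoszM dvdz_mul //.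
by rewrite (dvdz_pcharf (pchar_Fp pr_p)); have := u0 i; rewrite !mxE => ->.
Qed.

Lemma comb_approx g j : g \in Fil 1 -> exists y, g - comb y \in Fil j.+1.
Proof.
move=> Fg; elim: j => [|j [y Hy]].
  exists (fun=> 0); rewrite /comb big1 ?subr0 // => i _; exact: mulr0z.
pose v := gr j.+1 (g - comb y) *m invmx B.
pose t i : int := (v 0 i : nat)%:Z.
exists (fun i => y i + t i * (p ^ j)%N).
have -> : g - comb (fun i => y i + t i * (p ^ j)%N)
    = (g - comb y) - comb (fun i => t i * (p ^ j)%N).
  rewrite -addrA -opprD; congr (_ - _); rewrite /comb -big_split /=.
  by apply: eq_bigr => i _; rewrite mulrzDr.
have Ft : comb (fun i => t i * (p ^ j)%N) \in Fil j.+1.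
  by apply: fil_sum => i _; rewrite -add1n; apply: fil_dvd; rewrite ?dvdz_mull.
apply: (gr_ker Hgr); first exact: (filB HF).
rewrite (grD Hgr) ?filN // gr_opp // gr_comb.
have -> : \row_i (t i)%:~R = v by apply/rowP => i; rewrite mxE /t -pmulrn natr_Zp.
by rewrite mulmxKV // subrr.
Qed.

(** By [comb_inj] the j-th approximate coefficients are determined modulo p^j, hence they converge
    in Z_p. *)
Lemma basis_span g : g \in Fil 1 -> exists c : 'I_n -> Zp, g = \sum_i s (c i) (w i).
Proof.
move=> Fg; have [y Hy] := choice (fun j => comb_approx j Fg).
have Hc i j : (y j.+1 i = y j i %[mod (p ^ j)%N])%Z.
  apply/eqP; rewrite eqz_mod_dvd; apply: (comb_inj (y := fun i => y j.+1 i - y j i)).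
  rewrite (_ : comb _ = (g - comb (y j)) - (g - comb (y j.+1))).
    by rewrite (filB HF) // (filS HF).
  rewrite opprB addrC addrA subrK /comb -sumrB.
  by apply: eq_bigr => k _; rewrite mulrzBr.
exists (fun i => padic_mk pr_p (Hc i)).
apply/eqP; rewrite -subr_eq0; apply/eqP/(fil_sep HF) => j.
rewrite -(subrKA (comb (y j))) filD //; first exact/(filS HF)/Hy.
rewrite /comb -sumrB; apply: fil_sum => i _.
have F0 : w i \in Fil 0 by apply: (filS HF).
rewrite -(subrKA (w i *~ padic_res (padic_mk pr_p (Hc i)) j)) -opprB filD //.
  by rewrite opprB mulz_cong //= -opprB rpredN -eqz_mod_dvd modz_mod.
by rewrite -opprB filN // Hs.
Qed.

Lemma basis_free (c : 'I_n -> Zp) : \sum_i s (c i) (w i) = 0 -> forall i, c i = 0.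
Proof.
move=> c0 i; have F0 k : w k \in Fil 0 by apply: (filS HF).
apply: padic_ext => j; rewrite [padic_res 0 j]mod0z subr0.
have : ((p ^ j)%N %| padic_res (c i) j.+1)%Z.
  apply: (comb_inj (y := fun i => padic_res (c i) j.+1)).
  rewrite -[comb _]opprK -[X in - X]add0r -[in X in - X]c0 filN // -opprB.
  rewrite /comb -sumrB filN //; apply: fil_sum => k _; rewrite -opprB filN //; exact: Hs.
move=> Hd; have := padic_res_dvd (c i) (leqnSn j); rewrite -opprB rpredN => /rpredD/(_ Hd).
by rewrite subrK.
Qed.

(** An element of [Fil 2] has zero class in layer 1, so all its coefficients in the basis [w] are
    divisible by p. *)
Lemma div_p g : g \in Fil 2 -> exists2 h, h \in Fil 1 & h *+ p = g.
Proof.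
move=> Fg; have [c Ec] := basis_span (filS HF Fg).
have F0 k : w k \in Fil 0 by apply: (filS HF).
have : (\row_i padic_red (c i)) *m B = 0.
  rewrite -(gr_S Hgr Fg) Ec gr_sum => [|i _]; last exact: fil_act.
  by rewrite mulmx_sum_row; apply: eq_bigr => i _; rewrite gr_act // mxE gr_w.
move/(congr1 (mulmx^~ (invmx B))); rewrite /= mulmxK // mul0mx => /rowP c0.
have {}c0 i : padic_red (c i) = 0 by have := c0 i; rewrite !mxE.
have [d Ed] := choice (fun i => padic_red_eq0 (c0 i)).
exists (\sum_i s (d i) (w i)); first by apply: fil_sum => i _; apply: fil_act.
rewrite -sumrMnl Ec; apply: eq_bigr => i _.
by rewrite Ed actM // act_nat // (fil_act _ (r := 0)).
Qed.

End Basis.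
End FilteredModule.

Lemma padic_red_nat (p : nat) (pr_p : prime p) m :
  padic_red (m%:R : padic_int pr_p) = m%:R.
Proof. by rewrite /padic_red padic_res_nat padic_red_mod. Qed.

(* The rows of u and v are bases of layers 0 and 1 in which phi is diagonal   *)
(* with r ones: the first r rows of u and the last b rows of v lift to        *)
(* generators of the free part, the last b rows of u lift to torsion.         *)
Section Structure.
Variables (p : nat) (pr_p : prime p) (G : zmodType) (Fil : nat -> {pred G}).
Local Notation Zp := (padic_int pr_p).
Variables (s : Zp -> G -> G) (r b : nat).
Variables (gr : nat -> G -> 'rV['F_p]_(r + b)) (phi u v : 'M['F_p]_(r + b)).
Hypotheses (HF : p_filtration p Fil) (Hs : zp_action Fil s) (Hgr : p_graded Fil gr phi).
Hypotheses (u_unit : u \in unitmx) (v_unit : v \in unitmx).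
Hypothesis phi_l : forall i : 'I_r, row (lshift b i) u *m phi = row (lshift b i) v.
Hypothesis phi_r : forall j : 'I_b, row (rshift r j) u *m phi = 0.

Lemma filtered_module_structure :
  exists f : 'rV[Zp]_(r + b) * {ffun 'I_b -> Zmodp pr_p} -> G,
  [/\ forall x y, f (x + y) = f x + f y, forall a x, f (a *: x) = s a (f x),
      injective f & forall g, g \in Fil 0 <-> exists x, f x = g].
Proof.
have F10 g : g \in Fil 1 -> g \in Fil 0 by apply: (filS HF).
have exQ (i : 'I_r) : exists g, g \in Fil 0 /\ gr 0 g = row (lshift b i) u.
  by have [g Fg Eg] := gr_surj Hgr 0 (row (lshift b i) u); exists g.
have exR (j : 'I_b) : exists g, g \in Fil 1 /\ gr 1 g = row (rshift r j) v.
  by have [g Fg Eg] := gr_surj Hgr 1 (row (rshift r j) v); exists g.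
have [[Q HQ] [R HR]] := (choice exQ, choice exR).
pose w (i : 'I_(r + b)) := match fintype.split i with inl i => Q i *+ p | inr j => R j end.
have wl i : w (lshift b i) = Q i *+ p by rewrite /w (unsplitK (inl i)).
have wr j : w (rshift r j) = R j by rewrite /w (unsplitK (inr j)).
have Fw k : w k \in Fil 1.
  by rewrite -[k]splitK; case: (fintype.split k) => i /=; rewrite ?wl ?wr ?(fil_p HF) //;
    [case: (HQ i) | case: (HR i)].
have gw k : gr 1 (w k) = row k v.
  rewrite -[k]splitK; case: (fintype.split k) => i /=; rewrite ?wl ?wr; last by case: (HR i).
  by have [FQ EQ] := HQ i; rewrite (gr_p0 Hgr) // EQ phi_l.
have exT (j : 'I_b) : exists g, [/\ g \in Fil 0, g *+ p = 0 & gr 0 g = row (rshift r j) u].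
  have [g Fg Eg] := gr_surj Hgr 0 (row (rshift r j) u).
  have F2 : g *+ p \in Fil 2.
    by apply: (gr_ker Hgr); rewrite ?(fil_p HF) // (gr_p0 Hgr) // Eg phi_r.
  have [h Fh Eh] := div_p HF Hs Hgr Fw v_unit gw F2.
  exists (g - h); split; first by rewrite (filB HF) // F10.
    by rewrite mulrnBl Eh subrr.
  have F0h := F10 _ Fh; have FNh := filN HF F0h.
  by rewrite (grD Hgr) // (gr_opp HF Hgr) // (gr_S Hgr Fh) subr0.
have [T HT] := choice exT.
have {HQ} [FQ EQ] := all_and2 HQ; have {HR} [FR ER] := all_and2 HR.
have {HT} [FT pT ET] := all_and3 HT.
have tors j c d : padic_red c = padic_red d -> s c (T j) = s d (T j).
  by move=> cd; rewrite !(act_torsion HF Hs) // cd.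
(* This section of reduction is not additive, but [tors] shows that only the reduction matters on
   [T j]. *)
pose lift (x : Zmodp pr_p) : Zp := (x : 'F_p)%:R.
have liftK x : padic_red (lift x) = x by rewrite padic_red_nat natr_Zp.
pose f (x : 'rV[Zp]_(r + b) * {ffun 'I_b -> Zmodp pr_p}) :=
  \sum_i s (x.1 0 (lshift b i)) (Q i) + \sum_j s (x.1 0 (rshift r j)) (R j)
  + \sum_j s (lift (x.2 j)) (T j).
have FR0 j := F10 _ (FR j).
have fD x y : f (x + y) = f x + f y.
  rewrite /f addrACA [X in _ = X + _]addrACA -!big_split /=; congr (_ + _ + _).
  - by apply: eq_bigr => i _; rewrite mxE (actDl HF Hs).
  - by apply: eq_bigr => i _; rewrite mxE (actDl HF Hs).
  - by apply: eq_bigr => j _; rewrite -(actDl HF Hs) // ffunE; apply: tors;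
      rewrite padic_redD !liftK.
have Fl (x : 'rV[Zp]_(r + b) * {ffun 'I_b -> Zmodp pr_p}) :
  [/\ \sum_i s (x.1 0 (lshift b i)) (Q i) \in Fil 0,
   \sum_j s (x.1 0 (rshift r j)) (R j) \in Fil 1 & \sum_j s (lift (x.2 j)) (T j) \in Fil 0].
  by split; apply: (fil_sum HF) => i _; apply: (fil_act HF Hs).
have fZ (a : Zp) (x : 'rV[Zp]_(r + b) * {ffun 'I_b -> Zmodp pr_p}) : f (a *: x) = s a (f x).
  have [F1 F2 F3] := Fl x.
  have F02 := F10 _ F2; have F12 := filD HF F1 F02.
  rewrite /f (actDr HF Hs _ F12 F3) (actDr HF Hs _ F1 F02); congr (_ + _ + _).
  - by rewrite (act_sum HF Hs) => [|i _]; rewrite ?(fil_act HF Hs) //;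
      apply: eq_bigr => i _; rewrite mxE (actM HF Hs).
  - by rewrite (act_sum HF Hs) => [|i _]; rewrite ?(fil_act HF Hs) //;
      apply: eq_bigr => i _; rewrite mxE (actM HF Hs).
  - rewrite (act_sum HF Hs) => [|i _]; rewrite ?(fil_act HF Hs) //.
    by apply: eq_bigr => j _; rewrite -(actM HF Hs) // ffunE; apply: tors; rewrite padic_redM !liftK.
have gf x : gr 0 (f x) = row_mx (\row_i padic_red (x.1 0 (lshift b i))) (\row_j x.2 j) *m u.
  have [F1 F2 F3] := Fl x.
  have F02 := F10 _ F2; have F12 := filD HF F1 F02.
  rewrite (grD Hgr F12 F3) (grD Hgr F1 F02) (gr_S Hgr F2) addr0.
  rewrite mulmx_sum_row big_split_ord /= !(gr_sum HF Hgr);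
    try by move=> i _; apply: (fil_act HF Hs).
  congr (_ + _); apply: eq_bigr => i _; rewrite (gr_act HF Hs Hgr) // ?row_mxEl ?row_mxEr mxE ?EQ //.
  by rewrite ET liftK.
(* Layer 0 kills the torsion coordinates and makes the coefficients of the [Q i] divisible by p. The
   relation then lives in [Fil 1], where the [w] are free. *)
have f0 x : f x = 0 -> x = 0.
  move=> fx0; have [gr0 xT0] :
      (\row_i padic_red (x.1 0 (lshift b i)) = 0) /\ (\row_j (x.2 j : 'F_p) = 0).
    apply/eq_row_mx; rewrite row_mx0; apply: (can_inj (mulmxK u_unit)); rewrite -gf fx0 mul0mx.
    by rewrite (gr_S Hgr) // (fil0 HF).
  have c0 i : padic_red (x.1 0 (lshift b i)) = 0 by have /rowP/(_ i) := gr0; rewrite !mxE.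
  have [d Ed] := choice (fun i => padic_red_eq0 (c0 i)).
  have x20 : x.2 = 0 by apply/ffunP => j; have /rowP/(_ j) := xT0; rewrite !mxE ffunE.
  pose c k := match fintype.split k with inl i => d i | inr j => x.1 0 (rshift r j) end.
  have E : \sum_k s (c k) (w k) = 0.
    rewrite big_split_ord /= -[RHS]fx0 /f [X in _ + _ + X]big1 ?addr0.
      congr (_ + _); apply: eq_bigr => i _; rewrite /c ?(unsplitK (inl i)) ?(unsplitK (inr i)) ?wl ?wr //.
      by rewrite Ed [_ * d i]mulrC (actM HF Hs) // (act_nat HF Hs).
    by move=> j _; rewrite x20 ffunE (tors _ _ 0) ?liftK // (act_nat HF Hs 0) ?mulr0n.
  have c0' := basis_free HF Hs Hgr Fw v_unit gw E.
  rewrite [x]surjective_pairing x20; congr pair; apply/rowP => k.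
  rewrite mxE -[k in LHS]splitK; have := c0' k; rewrite /c.
  by case: (fintype.split k) => i /= ci //; rewrite Ed ci mulr0.
exists f; split=> //.
  move=> x y Exy; apply/eqP; rewrite -subr_eq0; apply/eqP/f0.
  by apply: (addIr (f y)); rewrite -fD subrK add0r.
move=> g; split=> [Fg | [x <-]]; last first.
  by have [F1 F2 F3] := Fl x; rewrite !(filD HF) // F10.
(* [x0] matches the class of [g] in layer 0. The remainder in [Fil 1] is expanded in [w], and the p
   in w = p Q is absorbed into the coefficient. *)
pose y := gr 0 g *m invmx u; pose lft (t : 'F_p) : Zp := (t : nat)%:R.
have lftK t : padic_red (lft t) = t by rewrite padic_red_nat natr_Zp.
pose x0 := (row_mx (\row_i lft (y 0 (lshift b i))) 0,
  [ffun j => y 0 (rshift r j) : Zmodp pr_p]) : 'rV[Zp]_(r + b) * {ffun 'I_b -> Zmodp pr_p}.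
have F0x : f x0 \in Fil 0 by have [F1 F2 F3] := Fl x0; rewrite !(filD HF) // F10.
have Fgx : g - f x0 \in Fil 1.
  have FN := filN HF F0x; apply: (gr_ker Hgr); first exact: (filB HF).
  rewrite (grD Hgr) // (gr_opp HF Hgr) // gf; apply/eqP; rewrite subr_eq0; apply/eqP.
  rewrite -[LHS](mulmxKV u_unit) -/y; congr (_ *m u); apply/rowP => k; rewrite -[k]splitK.
  case: (fintype.split k) => i /=; last by rewrite row_mxEr [RHS]mxE ffunE.
  by rewrite row_mxEl [RHS]mxE row_mxEl [X in padic_red X]mxE lftK.
have [c Ec] := basis_span HF Hs Hgr Fw v_unit gw Fgx.
pose x1 := (row_mx (\row_i (c (lshift b i) * p%:R)) (\row_j c (rshift r j)),
  0) : 'rV[Zp]_(r + b) * {ffun 'I_b -> Zmodp pr_p}.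
exists (x1 + x0); rewrite fD -[RHS](subrK (f x0)) Ec; congr (_ + _).
rewrite big_split_ord /= /f [X in _ + _ + X = _]big1 ?addr0 => [|j _].
  congr (_ + _); apply: eq_bigr => i _; rewrite ?wl ?wr ?row_mxEl ?row_mxEr mxE //.
  by rewrite (actM HF Hs) // (act_nat HF Hs).
by rewrite ffunE (tors _ _ 0) ?liftK // (act_nat HF Hs 0) ?mulr0n.
Qed.

End Structure.

(** Gaussian elimination writes [phi] as an invertible matrix, a partial identity and another
    invertible matrix. The inverse of the first and the last provide the two adapted bases. *)
Lemma rank_normal_form (F : fieldType) (n : nat) (phi : 'M[F]_n) :
  exists r b (e : n = (r + b)%N) (u v : 'M[F]_n),
  [/\ b = (n - \rank phi)%N, u \in unitmx, v \in unitmx &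
      forall i : 'I_n, row i u *m phi = if (i < r)%N then row i v else 0].
Proof.
exists (\rank phi), (n - \rank phi)%N, (esym (subnKC (rank_leq_row phi))).
exists (invmx (col_ebase phi)), (row_ebase phi).
split; rewrite ?unitmx_inv ?row_ebase_unit ?col_ebase_unit // => i.
rewrite -row_mul -[X in _ *m X]mulmx_ebase !mulmxA mulVmx ?col_ebase_unit // mul1mx.
rewrite row_mul; case: ifP => ir.
  rewrite (_ : row i _ = delta_mx 0 i) -?rowE //; apply/rowP => j.
  by rewrite !mxE ir andbT [j == i]eq_sym -val_eqE.
by rewrite (_ : row i _ = 0) ?mul0mx //; apply/rowP => j; rewrite !mxE ir andbF.
Qed.

Theorem filtered_module_classification (p : nat) (pr_p : prime p) (G : zmodType)
    (Fil : nat -> {pred G}) (s : padic_int pr_p -> G -> G) (n : nat)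
    (gr : nat -> G -> 'rV['F_p]_n) (phi : 'M['F_p]_n) :
    p_filtration p Fil -> zp_action Fil s -> p_graded Fil gr phi ->
  exists b, #|[set x : 'rV['F_p]_n | x *m phi == 0]| = (p ^ b)%N /\
  exists f : 'rV[padic_int pr_p]_n * {ffun 'I_b -> Zmodp pr_p} -> G,
  [/\ forall x y, f (x + y) = f x + f y, forall a x, f (a *: x) = s a (f x),
      injective f & forall g, g \in Fil 0 <-> exists x, f x = g].
Proof.
move=> HF Hs Hgr; have [r [b [e [u [v [Eb u_unit v_unit uv]]]]]] := rank_normal_form phi.
exists b; split.
  rewrite Eb -mxrank_ker -[X in (X ^ _)%N](card_Fp pr_p) -card_rowg.
  by apply: eq_card => x; rewrite !inE sub_kermx.
subst n; apply: (filtered_module_structure HF Hs Hgr u_unit v_unit) => i; rewrite uv.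
  by rewrite /= ltn_ord.
by rewrite /= ltnNge leq_addr.
Qed.

(** * The integers of an unramified extension: freeness, rank and completeness *)

Lemma finField_coords (k : finFieldType) (p : nat) (pk : p \in [pchar k]) :
  exists d (iota : k -> 'rV['F_p]_d), {morph iota : x y / x + y} /\ bijective iota.
Proof.
have [f lin_f bij_f] := pprimeChar_vectAxiom pk.
exists (logn p #|k|), f; split=> // x y.
by have := lin_f 1 x y; rewrite !scale1r.
Qed.

Lemma fraction_mul_denom (R : idomainType) (c : {fraction R}) :
  exists n d : R, d != 0 /\ c * tofrac d = tofrac n.
Proof.
elim/quotW: c => r; exists r.1, r.2; split; first exact: denom_ratioP.
unlock FracField.tofrac; rewrite -[LHS]FracField.pi_mul; apply/eqmodP.
rewrite /= FracField.equivfE /FracField.mulf.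
by rewrite !numden_Ratio ?mulf_neq0 ?oner_eq0 ?denom_ratioP // !mulr1 mulrC.
Qed.

Section PadicInt.
Variables (p : nat) (pr_p : prime p).
Local Notation Zp := (padic_int pr_p).

Lemma padic_natr_neq0 m : (0 < m)%N -> m%:R != 0 :> Zp.
Proof.
move=> m0; apply/eqP => /(congr1 (fun x : Zp => padic_res x m)).
have ltm : (m < p ^ m)%N by rewrite ltn_expl // prime_gt1.
rewrite padic_res_nat [padic_res 0 m]mod0z modz_nat modn_small // => -[m00].
by rewrite m00 in m0.
Qed.

Lemma padic_res_ge0 (x : Zp) j : (`|padic_res x j|%N)%:Z = padic_res x j.
Proof.
by rewrite gez0_abs // -padic_res_mod modz_ge0 // -lt0n expn_gt0 prime_gt0.
Qed.

Lemma padic_dvd_res (x : Zp) j : padic_res x j = 0 -> exists y, x = p%:R ^+ j * y.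
Proof.
elim: j x => [|j IH] x x0; first by exists x; rewrite mul1r.
have [y Ey] : exists y, x = p%:R * y.
  by apply: padic_red_eq0; rewrite /padic_red (padic_res_le x (ltn0Sn j)) x0 mod0z.
have p0 : p%:Z != 0 by rewrite -lt0n prime_gt0.
suff /IH[z Ez] : padic_res y j = 0 by exists z; rewrite Ey Ez exprS mulrA.
rewrite -padic_res_mod; apply/dvdz_mod0P.
have : ((p ^ j)%N %| padic_res y j.+1)%Z.
  rewrite -(dvdz_mul2l p0) -PoszM -expnS; apply/dvdz_mod0P; rewrite -modzMml -padic_res_nat.
  by have := x0; rewrite Ey.
have := padic_res_dvd y (leqnSn j); rewrite -opprB rpredN => /rpredD H /H.
by rewrite subrK.
Qed.

Lemma padic_approx (x : Zp) j : exists y, x = (`|padic_res x j|%N)%:R + p%:R ^+ j * y.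
Proof.
have [|y Ey] := @padic_dvd_res (x - (`|padic_res x j|%N)%:R) j.
  by rewrite /= padic_res_nat padic_res_ge0 modzDmr padic_res_mod subrr mod0z.
by exists y; rewrite -Ey addrC subrK.
Qed.

Lemma padic_resD (x y : Zp) j :
  padic_res (x + y) j = ((padic_res x j + padic_res y j) %% (p ^ j)%N)%Z.
Proof. by []. Qed.

Lemma padic_res_pX j (z : Zp) : padic_res (p%:R ^+ j * z) j = 0.
Proof. by rewrite -natrX /= padic_res_nat modzz mul0r mod0z. Qed.

(** A nonzero denominator is a power of p times a unit. *)
Lemma padic_frac (c : padic pr_p) : exists N (a : Zp), p%:R ^+ N * c = tofrac a.
Proof.
have [n [d [d0 Ec]]] := fraction_mul_denom c.
have [m [u [Ed /padic_red_unit[v vu]]]] := padic_valuation d0.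
exists m, (n * v); have u0 : u != 0 by apply: contraNneq d0 => u0; rewrite Ed u0 mulr0.
apply: (@mulIf _ (tofrac u)); first by rewrite tofrac_eq0.
rewrite -tofracM -[n * v * u]mulrA vu mulr1 -Ec Ed tofracM tofracXn rmorph_nat.
by rewrite [_ * c]mulrC mulrA.
Qed.

End PadicInt.

Section Unramified.
Variables (p : nat) (pr_p : prime p) (K : fieldExtType (padic pr_p)).
Local Notation Zp := (padic_int pr_p).
Local Notation emb := (@padic_int_emb p pr_p K).
Local Notation O := (integer K).
Hypothesis unrK : unramified K.

Definition pideal (N : nat) : {pred K} := fun x => x / p%:R ^+ N \in O.

Lemma embE a : emb a = in_alg K (tofrac a). Proof. by []. Qed.

Lemma emb_inj : injective emb.
Proof. by move=> a b /fmorph_inj/eqP; rewrite tofrac_eq => /eqP. Qed.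

Lemma emb_integral a : emb a \in O.
Proof. by apply/asboolP; apply: integral_id. Qed.

Lemma natr_neq0 m : (0 < m)%N -> m%:R != 0 :> K.
Proof.
move=> m0; rewrite -(rmorph_nat emb) -(rmorph0 emb) (inj_eq emb_inj).
exact: padic_natr_neq0.
Qed.

Lemma p_neq0 : p%:R != 0 :> K. Proof. by rewrite natr_neq0 ?prime_gt0. Qed.

Lemma pX_neq0 N : p%:R ^+ N != 0 :> K. Proof. by rewrite expf_neq0 ?p_neq0. Qed.

Lemma pidealP N x : reflect (exists2 y, y \in O & x = p%:R ^+ N * y) (x \in pideal N).
Proof.
apply: (iffP idP) => [Ox | [y Oy ->]].
  by exists (x / p%:R ^+ N); rewrite // mulrC divfK ?pX_neq0.
by rewrite unfold_in mulrC mulKf ?pX_neq0.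
Qed.

Lemma pideal0E x : (x \in pideal 0) = (x \in O).
Proof. by rewrite unfold_in expr0 divr1. Qed.

Lemma max_ideal_pideal x : (x \in max_ideal K) = (x \in pideal 1).
Proof.
apply/idP/idP => [/unrK[y Oy ->] | /pidealP[y Oy ->]].
  by apply/pidealP; exists y.
by apply/unrK; exists y.
Qed.

Lemma pideal1_invN x : x \in pideal 1 -> x != 0 -> x^-1 \notin O.
Proof. by rewrite -max_ideal_pideal => /andP[_ /orP[/eqP-> /eqP|]]. Qed.

Lemma one_notin_pideal1 : 1 \notin pideal 1.
Proof.
apply/negP => /pideal1_invN/(_ (oner_neq0 _)); rewrite invr1.
by rewrite rpred1.
Qed.

Lemma unit_inv x : x \in O -> x \notin pideal 1 -> x != 0 /\ x^-1 \in O.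
Proof.
by rewrite -max_ideal_pideal => Ox; rewrite unfold_in Ox /= negb_or negbK => /andP[].
Qed.

Lemma clear_denominators (q : {poly padic pr_p}) :
  exists N, forall i, exists a : Zp, p%:R ^+ N * q`_i = tofrac a.
Proof.
elim/poly_ind: q => [|q c [N IH]]; first by exists 0%N => i; exists 0; rewrite coef0 mulr0 tofrac0.
have [M [a Ea]] := padic_frac c; exists (N + M)%N => i.
have pX L : p%:R ^+ L = tofrac (p%:R ^+ L : Zp) by rewrite rmorphXn /= rmorph_nat.
rewrite coefD coefMX coefC; case: i => [|i].
  by exists (p%:R ^+ N * a); rewrite add0r exprD -mulrA Ea pX -tofracM.
have [b Eb] := IH i; exists (p%:R ^+ M * b).
by rewrite addr0 addnC exprD -mulrA Eb pX -tofracM.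
Qed.

(** If p^N clears the denominators of the minimal polynomial of x, then p^N x is a root of a monic
    polynomial with coefficients in Z_p. *)
Lemma pX_integral (x : K) : exists N, p%:R ^+ N * x \in O.
Proof.
have [q Eq] : exists q : {poly padic pr_p}, minPoly 1%VS x = map_poly (in_alg K) q.
  by have /polyOver1P := minPolyOver 1%AS x.
have [N HN] := clear_denominators q; exists N.
have q_monic : q \is monic by rewrite -(map_monic (in_alg K)) -Eq monic_minPoly.
pose d := (size q).-1; have sq : size q = d.+1.
  by rewrite prednK // size_poly_gt0 monic_neq0.
(* This is the monic polynomial p^(N d) q(X / p^N). Below degree d every coefficient has at least
   one factor p^N, which suffices to make it integral. *)
pose P := \poly_(i < d.+1) (p%:R ^+ (N * (d - i)) * in_alg K q`_i).
have Pd : P`_d = 1.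
  rewrite coef_poly ltnSn subnn muln0 mul1r -[d]/((size q).-1) -lead_coefE.
  by rewrite (monicP q_monic) rmorph1.
have sP : size P = d.+1.
  by apply/eqP; rewrite eqn_leq size_poly ltnNge; apply: contra (oner_neq0 K) =>
    /leq_sizeP/(_ d (leqnn d)); rewrite Pd => ->.
apply/asboolP; apply: (@integral_root_monic _ _ _ _ P).
- by rewrite monicE lead_coefE sP Pd.
- rewrite /root horner_poly; have := root_minPoly 1%VS x.
  rewrite Eq /root horner_coef size_map_poly sq => /eqP E.
  apply/eqP/(etrans _ (etrans (congr1 (GRing.mul (p%:R ^+ (N * d))) E) (mulr0 _))).
  rewrite mulr_sumr; apply: eq_bigr => i _; rewrite coef_map exprMn -exprM mulrACA -exprD.
  by rewrite -mulnDr subnK -1?ltnS // mulrA.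
- apply/integral_poly => i; rewrite coef_poly; case: ltnP => [|_]; last exact: integral0.
  rewrite ltnS leq_eqVlt => /orP[/eqP-> | ltid].
    rewrite subnn muln0 mul1r -[d]/((size q).-1) -lead_coefE (monicP q_monic) rmorph1.
    exact: integral1.
  have [a Ea] := HN i.
  have Ea' : p%:R ^+ N * in_alg K q`_i = emb a.
    by rewrite embE -Ea rmorphM rmorphXn rmorph_nat.
  suff /asboolP : p%:R ^+ (N * (d - i)) * in_alg K q`_i \in O by [].
  rewrite -[(d - i)%N]prednK ?subn_gt0 // mulnS addnC exprD -mulrA Ea'.
  by rewrite rpredM ?rpredX ?rpred_nat ?emb_integral.
Qed.

Lemma pideal_sep x : (forall N, x \in pideal N) -> x = 0.
Proof.
move=> Hx; apply/eqP; apply: contraT => x0; have [N HN] := pX_integral x^-1.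
have /pidealP[y Oy Ey] := Hx N.+1.
case/negP: one_notin_pideal1; apply/pidealP; exists (y * (p%:R ^+ N * x^-1)); first by rewrite rpredM.
rewrite mulrA expr1; apply: (mulfI (pX_neq0 N)).
by rewrite mulr1 !mulrA -exprSr -Ey mulrAC mulfV ?mul1r.
Qed.

Lemma pideal_avoid N (s : seq K) : exists2 x, x \in pideal N & x \notin s.
Proof.
pose t := [seq p%:R ^+ N * m%:R : K | m <- iota 0 (size s).+1].
have t_uniq : uniq t.
  rewrite map_inj_uniq ?iota_uniq // => m m' /(mulfI (pX_neq0 N)).
  wlog le_mm' : m m' / (m <= m')%N => [IH E|].
    by have /orP[/IH->|/IH->] := leq_total m m'.
  move=> /eqP; rewrite eq_sym -subr_eq0 -natrB // => E; apply/eqP; rewrite eqn_leq le_mm' /=.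
  by rewrite -subn_eq0 -[_ == _]negbK -lt0n; apply/negP => /natr_neq0; rewrite E.
have [sub | /allPn[x /mapP[m _ ->] xs]] := boolP (all (mem s) t).
  by have := uniq_leq_size t_uniq (allP sub); rewrite size_map size_iota ltnn.
by exists (p%:R ^+ N * m%:R); rewrite //; apply/pidealP; exists m%:R; rewrite ?rpred_nat.
Qed.


Lemma pideal_0 N : 0 \in pideal N.
Proof. by rewrite unfold_in mul0r rpred0. Qed.

Lemma pideal_B N x y : x \in pideal N -> y \in pideal N -> x - y \in pideal N.
Proof. by move=> Ix Iy; rewrite unfold_in mulrBl rpredB. Qed.

Lemma pideal_MM M N x y : x \in pideal M -> y \in pideal N -> x * y \in pideal (M + N)%N.
Proof. by move=> Ix Iy; rewrite unfold_in exprD invfM mulrACA rpredM. Qed.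

Lemma pideal_p N x : (p%:R * x \in pideal N.+1) = (x \in pideal N).
Proof. by rewrite !unfold_in exprS invfM mulrACA mulfV ?p_neq0 // mul1r. Qed.

Lemma pideal_S N x : x \in pideal N.+1 -> x \in pideal N.
Proof.
move=> Ix; rewrite unfold_in (_ : x / _ = x / p%:R ^+ N.+1 * p%:R).
  by rewrite rpredM ?rpred_nat.
by rewrite exprSr invfM -!mulrA mulVf ?p_neq0 ?mulr1.
Qed.

Lemma pideal_V1 x : x - 1 \in pideal 1 -> x != 0 /\ x^-1 \in pideal 0.
Proof.
move=> Ix; rewrite pideal0E; apply: unit_inv.
  have := pideal_S Ix; rewrite pideal0E => Ox1.
  by rewrite -[x](subrK 1) rpredD ?rpred1.
apply: contra one_notin_pideal1 => Ix1.
by rewrite -[1](subKr x) pideal_B.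
Qed.

Lemma pideal_filtration : p_filtration p pideal.
Proof.
split; [exact: pideal_0 | exact: pideal_B | exact: pideal_S | exact: pideal_sep |].
by move=> r g Ig; rewrite -mulr_natl pideal_p.
Qed.

Lemma emb_action : zp_action pideal (fun c x => emb c * x).
Proof.
move=> c x; rewrite pideal0E => Ox j; have [y Ey] := padic_approx c j.
have -> : emb c = (`|padic_res c j|%N)%:R + p%:R ^+ j * emb y.
  by rewrite [in LHS]Ey rmorphD rmorphM rmorphXn !rmorph_nat.
rewrite -[X in x *~ X]padic_res_ge0 -pmulrn -[x *+ _]mulr_natl mulrDl addrAC subrr add0r.
by apply/pidealP; exists (emb y * x); rewrite ?mulrA // rpredM ?emb_integral.
Qed.

Lemma pX_frac_neq0 N : p%:R ^+ N != 0 :> padic pr_p.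
Proof.
by rewrite expf_neq0 // -(rmorph_nat (@tofrac Zp)) tofrac_eq0 padic_natr_neq0 ?prime_gt0.
Qed.

Lemma scale_pX N (x : K) : (p%:R ^+ N : padic pr_p) *: x = p%:R ^+ N * x.
Proof. by rewrite -!natrX scaler_nat mulr_natl. Qed.

Section Residue.
Variables (k : finFieldType) (red : {rmorphism int_ring K -> k}).
Hypothesis red_residue : is_residue_map red.
Local Notation bar := (reduce red).

Lemma reduceE x (Ox : x \in O) : bar x = red (IntRing Ox).
Proof. by rewrite /reduce; congr (red _); apply: val_inj; rewrite insubdK. Qed.

Lemma reduceD x y : x \in O -> y \in O -> bar (x + y) = bar x + bar y.
Proof.
move=> Ox Oy; rewrite (reduceE Ox) (reduceE Oy) -rmorphD (reduceE (rpredD Ox Oy)).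
by congr (red _); apply: val_inj.
Qed.

Lemma reduceN x : x \in O -> bar (- x) = - bar x.
Proof.
move=> Ox; have ONx : - x \in O by rewrite rpredN.
by rewrite (reduceE Ox) (reduceE ONx) -rmorphN; congr (red _); apply: val_inj.
Qed.

Lemma reduceM x y : x \in O -> y \in O -> bar (x * y) = bar x * bar y.
Proof.
move=> Ox Oy; rewrite (reduceE Ox) (reduceE Oy) -rmorphM (reduceE (rpredM Ox Oy)).
by congr (red _); apply: val_inj.
Qed.

Lemma reduce1 : bar 1 = 1.
Proof. by rewrite (reduceE (rpred1 _)) -(rmorph1 red); congr (red _); apply: val_inj. Qed.

Lemma reduceX x m : x \in O -> bar (x ^+ m) = bar x ^+ m.
Proof.
move=> Ox; elim: m => [|m IH]; first by rewrite reduce1.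
by rewrite !exprS reduceM ?rpredX // IH.
Qed.

Lemma reduce_nat m : bar m%:R = m%:R.
Proof.
elim: m => [|m IH]; first by rewrite -[0%:R](subrr 1) reduceD ?reduceN ?rpredN ?rpred1 // reduce1 subrr.
by rewrite !mulrS reduceD ?rpred_nat ?rpred1 // reduce1 IH.
Qed.

Lemma reduce_eq0 x : x \in O -> (bar x == 0) = (x \in pideal 1).
Proof.
move=> Ox; rewrite (reduceE Ox) -max_ideal_pideal.
by apply/eqP/idP => /(red_residue.2 (IntRing Ox)).
Qed.

Lemma reduce_surj c : exists2 x, x \in O & bar x = c.
Proof.
have [[x Ox] <-] := red_residue.1 c.
by exists x; rewrite // (reduceE Ox).
Qed.

Lemma residue_pchar : p \in [pchar k].
Proof.
rewrite inE pr_p /= -reduce_nat reduce_eq0 ?rpred_nat //.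
by apply/pidealP; exists 1; rewrite ?rpred1 // mulr1.
Qed.

Variables (d : nat) (iota : k -> 'rV['F_p]_d).
Hypotheses (iotaD : {morph iota : x y / x + y}) (iota_bij : bijective iota).

Lemma iota0 : iota 0 = 0.
Proof. by apply: (addrI (iota 0)); rewrite -iotaD !addr0. Qed.

Definition pideal_gr (N : nat) (x : K) := iota (bar (x / p%:R ^+ N)).

Lemma pideal_grD N x y : x \in pideal N -> y \in pideal N ->
  pideal_gr N (x + y) = pideal_gr N x + pideal_gr N y.
Proof. by move=> Ix Iy; rewrite /pideal_gr mulrDl reduceD ?iotaD. Qed.

Lemma pideal_gr_ker N x : x \in pideal N -> pideal_gr N x = 0 -> x \in pideal N.+1.
Proof.
rewrite /pideal_gr -iota0 => Ix /(bij_inj iota_bij)/eqP; rewrite reduce_eq0 //.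
by rewrite !unfold_in -mulrA -invfM -exprSr.
Qed.

Lemma pideal_gr_S N x : x \in pideal N.+1 -> pideal_gr N x = 0.
Proof.
move=> Ix; rewrite /pideal_gr -iota0; congr iota; apply/eqP.
by rewrite reduce_eq0; [rewrite unfold_in -mulrA -invfM -exprSr | apply: pideal_S].
Qed.

Lemma pideal_gr_surj N v : exists2 x, x \in pideal N & pideal_gr N x = v.
Proof.
have [iota' _ iotaK] := iota_bij; have [x Ox Ex] := reduce_surj (iota' v).
exists (x * p%:R ^+ N); first by rewrite unfold_in mulfK ?pX_neq0.
by rewrite /pideal_gr mulfK ?pX_neq0 // Ex iotaK.
Qed.

Lemma pideal_gr_p N x : pideal_gr N.+1 (p%:R * x) = pideal_gr N x.
Proof. by rewrite /pideal_gr exprS invfM mulrACA mulfV ?p_neq0 // mul1r. Qed.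

Lemma pideal_graded : p_graded pideal pideal_gr 1%:M.
Proof.
split; [exact: pideal_grD | exact: pideal_gr_ker | exact: pideal_gr_S | exact: pideal_gr_surj | |].
  by move=> r g _; rewrite -mulr_natl pideal_gr_p.
by move=> g _; rewrite -mulr_natl pideal_gr_p mulmx1.
Qed.

(** The classification applied to O_K itself. Here p acts as the identity on all layers, so the
    kernel is trivial and O_K is free of rank d. *)
Lemma integer_coords : exists f : 'rV[Zp]_d -> K,
  [/\ forall x y, f (x + y) = f x + f y, forall a x, f (a *: x) = emb a * f x,
      injective f & forall x, x \in O <-> exists y, f y = x].
Proof.
have [b [card_b [f [fD fZ f_inj f_im]]]] :=
  filtered_module_classification pideal_filtration emb_action pideal_graded.
have b0 : b = 0%N.
  move: card_b; rewrite (_ : [set _ | _] = [set 0]) ?cards1.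
    by move/eqP; rewrite eq_sym -(expn0 p) eqn_exp2l ?prime_gt1 // => /eqP.
  by apply/setP => x; rewrite !inE mulmx1.
have f2 (t : {ffun 'I_b -> Zmodp pr_p}) : t = 0.
  by apply/ffunP => i; have := ltn_ord i; rewrite {2}b0.
exists (fun u => f (u, 0)); split=> [x y | a x | x y /f_inj[] // | x].
- by rewrite -fD; congr (f (_, _)); rewrite addr0.
- by rewrite -fZ; congr (f (_, _)); rewrite scaler0.
- rewrite -pideal0E; split=> [/f_im[[u t] <-] | [y <-]]; first by exists u; rewrite (f2 t).
  by apply/f_im; exists (y, 0).
Qed.

(** A basis of O_K over Z_p is one of K over Q_p: clearing denominators by powers of p gives both
    spanning and freeness. *)
Lemma dim_residue : \dim {:K} = d.
Proof.
have [f [fD fZ f_inj f_im]] := integer_coords.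
have f0 : f 0 = 0 by apply: (addrI (f 0)); rewrite -fD !addr0.
have f_sum (u : 'rV[Zp]_d) : f u = \sum_i emb (u 0 i) * f (delta_mx 0 i).
  rewrite [in LHS](row_sum_delta u).
  elim/big_rec2: _ => [//|i y x _ E]; by rewrite fD fZ E.
pose X := [tuple f (delta_mx 0 i) | i < d].
have XE (i : 'I_d) : X`_i = f (delta_mx 0 i) by rewrite -tnth_nth tnth_mktuple.
suff X_basis : basis_of {:K} X by rewrite (size_basis X_basis).
rewrite /basis_of; apply/andP; split.
  rewrite eqEsubv subvf /=; apply/subvP => x _.
  have [N] := pX_integral x; move/f_im => [u Eu].
  have -> : x = \sum_i (p%:R ^- N * tofrac (u 0 i)) *: X`_i.
    apply: (scalerI (pX_frac_neq0 N)); rewrite (scale_pX N x) -Eu f_sum scaler_sumr.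
    apply: eq_bigr => i _; rewrite scalerA mulrA mulfV ?pX_frac_neq0 // mul1r XE.
    by rewrite -mulr_algl.
  by apply: rpred_sum => i _; apply: rpredZ; apply: memv_span; rewrite mem_nth ?size_tuple.
apply/freeP => c.
have [M HM] := choice (fun i => padic_frac (c i)); pose N := \max_i M i.
have /choice[a Ha] i : exists a, p%:R ^+ N * c i = tofrac a.
  have [a Ea] := HM i; exists (p%:R ^+ (N - M i) * a).
  by rewrite tofracM tofracXn rmorph_nat -Ea mulrA -exprD subnK ?leq_bigmax.
move=> /(congr1 ( *:%R (p%:R ^+ N))); rewrite scaler0 scaler_sumr => E i.
have /f_inj/rowP/(_ i) : f (\row_j a j) = f 0.
  rewrite f0 -E f_sum; apply: eq_bigr => j _.
  by rewrite scalerA Ha mxE XE -mulr_algl.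
rewrite !mxE => ai0; have := Ha i; rewrite ai0 tofrac0 => /eqP.
by rewrite mulf_eq0 (negPf (pX_frac_neq0 N)) => /eqP.
Qed.

(** In the coordinates of [integer_coords] a Cauchy sequence converges componentwise in Z_p. *)
Lemma pideal_complete (u : nat -> K) : (forall j, u j \in pideal 0) ->
  (forall j, u j.+1 - u j \in pideal j) ->
  exists2 l, l \in pideal 0 & forall j, l - u j \in pideal j.
Proof.
have [f [fD fZ f_inj f_im]] := integer_coords => Ou Hu.
have f0 : f 0 = 0 by apply: (addrI (f 0)); rewrite -fD !addr0.
have fN x : f (- x) = - f x by apply: (addrI (f x)); rewrite -fD !addrN.
have /choice[y Ey] j : exists z, f z = u j by apply/f_im; rewrite -pideal0E.
have fX j z : f (p%:R ^+ j *: z) = p%:R ^+ j * f z.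
  by rewrite fZ rmorphXn rmorph_nat.
have dy j i : padic_res (y j.+1 0 i) j = padic_res (y j 0 i) j.
  have /pidealP[x /f_im[z <-]] := Hu j.
  rewrite -!Ey -fN -fD -fX => /f_inj/rowP/(_ i); rewrite !mxE => /eqP; rewrite subr_eq => /eqP->.
  by rewrite padic_resD padic_res_pX add0r padic_res_mod.
have Hc i j : (padic_res (y j.+1 0%R i) j.+1 = padic_res (y j 0%R i) j %[mod (p ^ j)%N])%Z.
  by rewrite padic_step dy.
pose c : 'rV[Zp]_d := \row_i padic_mk pr_p (Hc i).
exists (f c); first by rewrite pideal0E; apply/f_im; exists c.
move=> j; have /choice[z Hz] i : exists z : Zp, c 0 i - y j 0 i = p%:R ^+ j * z.
  by apply: padic_dvd_res; rewrite mxE /= padic_res_mod modzDmr addrN mod0z.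
apply/pidealP; exists (f (\row_i z i)); first by apply/f_im; exists (\row_i z i).
by rewrite -fX -Ey -fN -fD; congr f; apply/rowP => i; rewrite [RHS]mxE [X in _ = _ * X]mxE -Hz !mxE.
Qed.

End Residue.

Lemma pideal_filtered_field (k : finFieldType) (red : {rmorphism int_ring K -> k}) :
  is_residue_map red -> filtered_field pideal.
Proof.
move=> Hred; have [d [iota [iotaD iota_bij]]] := finField_coords (residue_pchar Hred).
split; [exact: pideal_0 | exact: pideal_B | by rewrite pideal0E rpred1 | exact: pideal_MM
  | exact: pideal_S | exact: pideal_V1 | exact: pideal_sep | exact: (pideal_complete Hred iotaD iota_bij)
  | exact: pideal_avoid].
Qed.

End Unramified.

Lemma mul_coef1E m : (2 * mul_coef1 m + m = m ^ 2)%N.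
Proof.
rewrite /mul_coef1; elim: m => [|m IH]; first by rewrite big_ord0.
rewrite big_ord_recr /=; set e := bigop _ _ _ in IH *.
transitivity (2 * e + m + 2 * m + 1)%N; first by ring.
by rewrite IH; ring.
Qed.

Lemma mul_coef2E m : (3 * mul_coef2 m + m = m ^ 3)%N.
Proof.
rewrite /mul_coef2; elim: m => [|m IH]; first by rewrite big_ord0.
rewrite big_ord_recr /=; set e := bigop _ _ _ in IH *.
transitivity (3 * e + m + 3 * (m * m.+1) + 1)%N; first by ring.
by rewrite IH; ring.
Qed.

Lemma mul_coef3E m : (2 * mul_coef3 m + m = m ^ 4)%N.
Proof.
rewrite /mul_coef3; elim: m => [|m IH]; first by rewrite big_ord0.
rewrite big_ord_recr /=; set e := bigop _ _ _ in IH *.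
transitivity (2 * e + m + 2 * (m * (2 * m ^ 2 + 3 * m + 2)) + 1)%N; first by ring.
by rewrite IH; ring.
Qed.

Lemma mul_coef4E m : (5 * mul_coef4 m + 2 * m = 2 * m ^ 5)%N.
Proof.
rewrite /mul_coef4; elim: m => [|m IH]; first by rewrite big_ord0.
rewrite big_ord_recr /=; set e := bigop _ _ _ in IH *.
transitivity (5 * e + 2 * m + 5 * (2 * (m ^ 2 + m + 1) * (m * m.+1)) + 2)%N; first by ring.
by rewrite IH; ring.
Qed.

Lemma mul_coef6E m : (7 * mul_coef6 m + 3 * m = 3 * m ^ 7)%N.
Proof.
rewrite /mul_coef6; elim: m => [|m IH]; first by rewrite big_ord0.
rewrite big_ord_recr /=; set e := bigop _ _ _ in IH *.
transitivity (7 * e + 3 * m + 7 * (3 * (m ^ 2 + m + 1) ^ 2 * (m * m.+1)) + 3)%N; first by ring.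
by rewrite IH; ring.
Qed.

(** Applied to the closed forms above, this makes each coefficient vanish modulo p unless p divides
    its leading factor 2, 3, 5 or 7. *)
Lemma dvdn_mul_coef p c e k l : prime p -> ~~ (p %| c)%N ->
  (c * e + k * p = k * p ^ l.+1)%N -> (p %| e)%N.
Proof.
move=> pr_p pc E; have : (p %| c * e)%N.
  rewrite -(dvdn_addl _ (n := k * p)%N) ?dvdn_mull // E expnS.
  by rewrite mulnCA dvdn_mulr.
by rewrite Euclid_dvdM // (negPf pc).
Qed.

Lemma prime_normP (k : finFieldType) (p : nat) (c : k) : p \in [pchar k] ->
  prime_norm c = 1 <-> exists2 b, b != 0 & c = b / b ^+ p.
Proof.
(* [prime_norm] takes its characteristic from [finPcharP], and that one must be identified with
   [p]. *)
rewrite /prime_norm; case: (finPcharP k) => q pr_q qk pk.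
have Epq : q = p by have := pcharf_eq pk q; rewrite qk => /esym; rewrite inE => /eqP.
move: qk; rewrite Epq => qk {q pr_q Epq}.
have [alpha gen_alpha alphaE] := finField_galois_generator (sub1v {: pPrimeCharType qk}%AS).
have alphaX x : alpha x = x ^+ p.
  by rewrite alphaE ?memvf //= dimv1 expn1 card_Fp // (pcharf_prime pk).
have H90 := Hilbert's_theorem_90 gen_alpha (memvf (c : pPrimeCharType qk)).
split=> [/eqP/H90[b [_ b0] ->] | [b b0 Ec]]; first by exists b; rewrite // alphaX.
by apply/eqP/H90; exists b; rewrite ?memvf // alphaX.
Qed.

Lemma additive_matrix (p n : nat) (pr_p : prime p) (f : 'rV['F_p]_n -> 'rV['F_p]_n) :
  {morph f : x y / x + y} -> exists phi, forall x, f x = x *m phi.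
Proof.
move=> fD; have f0 : f 0 = 0 by apply: (addrI (f 0)); rewrite -fD !addr0.
have fZ c x : f (c *: x) = c *: f x.
  rewrite -[c]natr_Zp !scaler_nat; elim: (c : nat) => [//|m IH].
  by rewrite !mulrS fD IH.
exists (\matrix_i f (delta_mx 0 i)) => x; rewrite mulmx_sum_row [in LHS](row_sum_delta x).
elim/big_rec2: _ => [//|i y z _ <-]; by rewrite fD fZ rowK.
Qed.

(** * The points as a filtered Z_p-module *)

Section ReductionFiltration.
Variables (p : nat) (pr_p : prime p) (K : fieldExtType (padic pr_p)).
Local Notation Zp := (padic_int pr_p).
Local Notation I := (@pideal p pr_p K).
Hypothesis unrK : unramified K.
Variables (k : finFieldType) (red : {rmorphism int_ring K -> k}).
Hypothesis red_residue : is_residue_map red.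
Local Notation bar := (reduce red).
Variables (d : nat) (iota : k -> 'rV['F_p]_d).
Hypotheses (iotaD : {morph iota : x y / x + y}) (iota_bij : bijective iota).
Variables (W : weierstrass K) (G : zmodType) (z w : G -> K) (pt : G -> wpoint K).
Hypothesis HG : chart_group I W z w pt.
Hypotheses (W1 : wa1 W \in I 1) (W2 : wa2 W \in I 1) (W3 : wa3 W \in I 1)
  (W4 : wa4 W \in I 1) (W6 : wa6 W \in I 1).

Let HI : filtered_field I. Proof. exact: (pideal_filtered_field unrK red_residue). Qed.
Local Notation cong := (eqmod I).

Definition point_fil (r : nat) : {pred G} := fun g => z g \in I r.

Lemma point_filE r g : (g \in point_fil r) = (z g \in I r). Proof. by []. Qed.

Lemma cong_mem r x y : cong r x y -> (x \in I r) = (y \in I r).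
Proof.
move=> xy; apply/idP/idP => [Ix | Iy]; last by rewrite -[x](subrK y) (idealD HI).
by rewrite -[y](subKr x) (idealB HI).
Qed.

Lemma point_filN r g : g \in point_fil r -> - g \in point_fil r.
Proof.
move=> Fg; have := cg_addS HG (- g) Fg; rewrite addNr (cg_0 HG) /eqmod sub0r.
move/(idealN HI); rewrite opprK => /(idealS HI) H.
by rewrite point_filE -[z _](addrK (z g)) (idealB HI).
Qed.

Lemma point_filD r g h : g \in point_fil r -> h \in point_fil r -> g + h \in point_fil r.
Proof.
move=> Fg Fh; rewrite point_filE (cong_mem (cong_le HI (leqnSn r) (cg_addS HG g Fh))).
exact: (idealD HI).
Qed.

Lemma natr_p_ideal r x : x \in I r -> p%:R * x \in I r.+1.
Proof. by rewrite pideal_p. Qed.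

Lemma point_filtration : p_filtration p point_fil.
Proof.
split=> [r | r g h Fg Fh | r g | g Fg | r g Fg].
- by rewrite point_filE (cg_0 HG) (ideal0 HI).
- by rewrite point_filD ?point_filN.
- exact: (idealS HI).
- by apply: (cg_inj HG); rewrite (cg_0 HG); apply: (pideal_sep unrK).
- rewrite point_filE (cong_mem (y := p%:R * z g)) ?natr_p_ideal //.
  by apply: (cong_le HI _ (cg_mulrn HG p Fg)); rewrite ltnS leq_addr.
Qed.

Lemma cong_of_fil r g h : g - h \in point_fil r -> cong r (z g) (z h).
Proof.
move=> Fgh; have := cg_addS HG h Fgh; rewrite addrC subrK => /(cong_le HI (leqnSn r)) E.
apply: (cong_trans HI E); rewrite /eqmod addrC addKr. exact: Fgh.
Qed.

(** [cg_addS] compares z(g) with z(h) + z(g - h) only one digit beyond the known size of z(g - h),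
    so that size is improved one level at a time. *)
Lemma fil_of_cong r g h : cong r (z g) (z h) -> g - h \in point_fil r.
Proof.
move=> Egh; suff H s : (s <= r)%N -> g - h \in point_fil s by apply: H.
elim: s => [|s IH] sr; first by rewrite point_filE (cg_z HG).
have := cg_addS HG h (IH (ltnW sr)); rewrite addrC subrK => E.
have := cong_trans HI (cong_sym HI E) (cong_le HI sr Egh).
by rewrite /eqmod addrC addKr.
Qed.

(** The z-coordinates of the multiples by successive residues form a Cauchy sequence, and their
    limit is the z of a point. *)
Lemma point_action_exists : exists s : Zp -> G -> G, zp_action point_fil s.
Proof.
have ex (cg : Zp * G) : exists h, forall j, h - cg.2 *~ padic_res cg.1 j \in point_fil j.
  case: cg => c g /=; have F0 : g \in point_fil 0 by rewrite point_filE (cg_z HG).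
  have [|x Ix Hx] := ideal_cvg HI (fun j => cg_z HG (g *~ padic_res c j)).
    move=> j; apply: cong_of_fil; rewrite -mulrzBr.
    by apply: (fil0_dvd point_filtration F0); apply: padic_res_dvd.
  have [h Eh] := cg_ex HG Ix; exists h => j; apply: fil_of_cong.
  by rewrite Eh; apply: Hx.
have [s Hs] := choice ex; exists (fun c g => s (c, g)) => c g _ j; exact: Hs (c, g) j.
Qed.

Local Notation igr := (pideal_gr red iota).
Definition point_gr (r : nat) (g : G) := igr r (z g).

Lemma pideal_gr_cong r x y : y \in I r -> cong r.+1 x y -> igr r x = igr r y.
Proof.
move=> Iy xy; rewrite -[x](subrK y) (pideal_grD red iotaD) //; last exact: (idealS HI).
by rewrite (pideal_gr_S unrK red_residue iotaD) ?add0r.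
Qed.

(* Multiplication by p from E_0/E_1 to E_1/E_2, both identified with k.       *)
Definition mul_p_gr (t : k) : k :=
  t - (bar (wa1 W / p%:R) * (mul_coef1 p)%:R * t ^+ 2
     + bar (wa2 W / p%:R) * (mul_coef2 p)%:R * t ^+ 3
     + bar (wa3 W / p%:R) * (mul_coef3 p)%:R * t ^+ 4
     + bar (wa4 W / p%:R) * (mul_coef4 p)%:R * t ^+ 5
     + bar (wa6 W / p%:R) * (mul_coef6 p)%:R * t ^+ 7).

Lemma point_gr_mul_p g : point_gr 1 (g *+ p) = iota (mul_p_gr (bar (z g))).
Proof.
have Oz : z g \in integer K by rewrite -pideal0E (cg_z HG).
have Iz := cg_z HG g.
have Op a : a \in I 1 -> a / p%:R \in integer K by [].
have [V1 V2 V3 V4] := And4 (Op _ W1) (Op _ W2) (Op _ W3) (Op _ W4); have V6 := Op _ W6.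
have Imp := mul_coef_poly_ideal HI W1 W2 W3 W4 W6 p Iz.
have Ip : p%:R * z g \in I 1 by rewrite natr_p_ideal.
rewrite /point_gr (pideal_gr_cong _ (cg_mul_mod2 HG g p)); last exact: (idealB HI).
rewrite /pideal_gr expr1; congr iota.
have -> : (p%:R * z g - mul_coef_poly W p (z g)) / p%:R = z g -
   (wa1 W / p%:R * (mul_coef1 p)%:R * z g ^+ 2
     + wa2 W / p%:R * (mul_coef2 p)%:R * z g ^+ 3
     + wa3 W / p%:R * (mul_coef3 p)%:R * z g ^+ 4
     + wa4 W / p%:R * (mul_coef4 p)%:R * z g ^+ 5
     + wa6 W / p%:R * (mul_coef6 p)%:R * z g ^+ 7).
  have p0 : p%:R != 0 :> K by apply: p_neq0.
  by rewrite /mul_coef_poly; move: p0; move: (p%:R : K) => q q0; field.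
have Rn m := rpred_nat (integer K) m.
have Ot a m i : a \in integer K -> a * m%:R * z g ^+ i \in integer K.
  by move=> Oa; rewrite rpredM ?rpredX // rpredM.
have Et a m i : a \in integer K -> bar (a * m%:R * z g ^+ i) = bar a * m%:R * bar (z g) ^+ i.
  by move=> Oa; rewrite !reduceM ?rpredM ?rpredX // reduceX // reduce_nat.
rewrite /mul_p_gr -!Et // reduceD ?rpredN ?rpredD ?Ot // reduceN ?rpredD ?Ot //.
by rewrite !reduceD ?rpredD ?Ot.
Qed.

Lemma point_gr_surj r v : exists2 g, g \in point_fil r & point_gr r g = v.
Proof.
have [x Ix Ex] := pideal_gr_surj red_residue iota_bij r v.
have [g Eg] := cg_ex HG (ideal_le HI (leq0n r) Ix).
by exists g; rewrite ?point_filE /point_gr Eg.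
Qed.

Lemma point_grD r g h : g \in point_fil r -> h \in point_fil r ->
  point_gr r (g + h) = point_gr r g + point_gr r h.
Proof.
move=> Fg Fh; rewrite /point_gr (pideal_gr_cong _ (cg_addS HG g Fh)); last exact: (idealD HI).
exact: (pideal_grD red iotaD).
Qed.

Lemma mul_p_grD : {morph mul_p_gr : x y / x + y}.
Proof.
have lift_k t : exists g, bar (z g) = t.
  have [x Ox Ex] := reduce_surj red_residue t.
  by rewrite -pideal0E in Ox; have [g Eg] := cg_ex HG Ox; exists g; rewrite Eg.
move=> t t'; have [[g <-] [h <-]] := (lift_k t, lift_k t').
have [F0g F0h] : g \in point_fil 0 /\ h \in point_fil 0 by rewrite !point_filE !(cg_z HG).
(* inherited from the additivity of g |-> g *+ p *)
apply: (bij_inj iota_bij); rewrite iotaD -!point_gr_mul_p -point_grD ?(fil_p point_filtration) //.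
rewrite -mulrnDl point_gr_mul_p; congr (iota (mul_p_gr _)).
have := point_grD F0g F0h; rewrite /point_gr /pideal_gr !expr0 !divr1 -iotaD.
by move=> /(bij_inj iota_bij).
Qed.

Lemma point_graded : exists phi, p_graded point_fil point_gr phi /\
  #|[set x : 'rV['F_p]_d | x *m phi == 0]| = #|[set t : k | mul_p_gr t == 0]|.
Proof.
have [iota' iotaK iota'K] := iota_bij.
have iota'D : {morph iota' : x y / x + y}.
  by move=> x y; apply: (can_inj iotaK); rewrite iotaD !iota'K.
have [|phi Hphi] := @additive_matrix p d pr_p (fun x => iota (mul_p_gr (iota' x))).
  by move=> x y; rewrite iota'D mul_p_grD iotaD.
have i0 : iota 0 = 0 by apply: (addrI (iota 0)); rewrite -iotaD !addr0.
exists phi; split; last first.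
  rewrite -(card_imset _ (can_inj iotaK)); apply: eq_card => x; rewrite inE.
  apply/idP/imsetP => [/eqP | [t]]; rewrite -?Hphi.
    rewrite -i0 => /(can_inj iotaK) E; exists (iota' x); last by rewrite iota'K.
    by rewrite inE E.
  by rewrite inE => /eqP E ->; rewrite iotaK E i0.
split=> [r g h Fg Fh | r g Fg | r g Fg | r v | r g Fg | g _].
- exact: point_grD.
- exact: (pideal_gr_ker unrK red_residue iotaD iota_bij).
- exact: (pideal_gr_S unrK red_residue iotaD).
- exact: point_gr_surj.
- rewrite /point_gr -(pideal_gr_p red iota r.+1).
  (* At level r + 1 the error of [cg_mulrn] has level 2r + 3, and r + 3 is enough to fix the class
     in layer r + 2. *)
  apply: pideal_gr_cong; first by rewrite natr_p_ideal.
  by apply: (cong_le HI _ (cg_mulrn HG p Fg)); rewrite addSnnS ltnS addnS !ltnS leq_addl.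
- by rewrite point_gr_mul_p -Hphi /point_gr /pideal_gr expr0 divr1 iotaK.
Qed.

Theorem point_module_structure : exists b,
  #|[set t : k | mul_p_gr t == 0]| = (p ^ b)%N /\
  exists (s : Zp -> G -> G) (f : 'rV[Zp]_d * {ffun 'I_b -> Zmodp pr_p} -> G),
  [/\ zp_action point_fil s, forall x y, f (x + y) = f x + f y,
      forall a x, f (a *: x) = s a (f x) & bijective f].
Proof.
have [s Hs] := point_action_exists; have [phi [Hphi card_phi]] := point_graded.
have [b [card_b [f [fD fZ f_inj f_im]]]] :=
  filtered_module_classification point_filtration Hs Hphi.
exists b; split; first by rewrite -card_phi.
exists s, f; split=> //.
have ex_inv g : exists x, f x = g by apply/f_im; rewrite point_filE (cg_z HG).
have [f' f'K] := choice ex_inv; exists f' => // x; apply: f_inj; exact: f'K.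
Qed.

End ReductionFiltration.

(** * Nonsingular reduction and convergence of points *)

Section NonsingularPoints.
Variables (p : nat) (pr_p : prime p) (K : fieldExtType (padic pr_p)).
Local Notation Zp := (padic_int pr_p).
Local Notation I := (@pideal p pr_p K).
Local Notation O := (integer K).
Hypothesis unrK : unramified K.
Variables (k : finFieldType) (red : {rmorphism int_ring K -> k}).
Hypothesis red_residue : is_residue_map red.
Local Notation bar := (reduce red).
Variables (W : weierstrass K) (G : zmodType) (z w : G -> K) (pt : G -> wpoint K).
Hypothesis HG : chart_group I W z w pt.
Hypotheses (W1 : wa1 W \in I 1) (W2 : wa2 W \in I 1) (W3 : wa3 W \in I 1)
  (W4 : wa4 W \in I 1) (W6 : wa6 W \in I 1).

Let HI : filtered_field I. Proof. exact: (pideal_filtered_field unrK red_residue). Qed.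

(* The homogeneous coordinates (x : y : 1) or (0 : 1 : 0) of a point are      *)
(* hom_scale times (z : -1 : w).                                              *)
Definition hom_scale g : K := if w g == 0 then -1 else (w g)^-1.

Lemma hom_scale_neq0 g : hom_scale g != 0.
Proof.
rewrite /hom_scale; case: (eqVneq (w g) 0) => [_|w0]; first by rewrite oppr_eq0 oner_eq0.
by rewrite invr_eq0.
Qed.

Lemma hom_pt g : [/\ homX (pt g) = hom_scale g * z g, homY (pt g) = - hom_scale g &
  homZ (pt g) = hom_scale g * w g].
Proof.
rewrite (cg_pt HG) /chart_point /hom_scale; have Cg := cg_on HG g.
case: (eqVneq (w g) 0) Cg => [-> /on_chart_w0->|w0 _] /=; first by rewrite !mulr0 opprK.
by rewrite mulVf // mulrC.
Qed.

Lemma bar_ideal1 a : a \in I 1 -> bar a = 0.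
Proof.
by move=> Ia; apply/eqP; rewrite (reduce_eq0 unrK red_residue) // -pideal0E (idealS HI).
Qed.

(** The coordinates (z : -1 : w) are integral with a unit in the middle. The a_i reduce to 0, so the
    last partial derivative reduces to Y^2 = 1. *)
Lemma pt_in_E0 g : E0 red W (pt g).
Proof.
split; first by rewrite (cg_pt HG); apply: on_chart_curve; apply: (cg_on HG).
have [EX EY EZ] := hom_pt g; have s0 := hom_scale_neq0 g.
have [Oz Ow] : z g \in O /\ w g \in O by rewrite -!pideal0E (cg_z HG) (cg_w HG).
have ON1 : -1 \in O by rewrite rpredN rpred1.
exists (hom_scale g)^-1; rewrite EX EY EZ !mulKf // mulrN mulVf //; split=> //.
  rewrite (negPf (_ : -1 \notin _)) ?andbF // (max_ideal_pideal unrK).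
  apply: contra (one_notin_pideal1 unrK) => /(idealN HI); by rewrite opprK.
apply: Or33; rewrite /= (bar_ideal1 W1) (bar_ideal1 W2) (bar_ideal1 W3) (bar_ideal1 W4)
  (bar_ideal1 W6) reduceN ?rpred1 // reduce1.
by rewrite sqrrN expr1n !(mulr0, mul0r, subr0, addr0) oner_eq0.
Qed.

Lemma chart_unique x y y' : x \in I 0 -> y \in I 0 -> y' \in I 0 ->
  on_chart W x y -> on_chart W x y' -> y = y'.
Proof.
move=> Ix Iy Iy' C C'; apply/eqP; rewrite -subr_eq0 (slope_rel C C') ?subrr ?mulr0 //.
exact: (slope_den_neq0 HI W1 W2 W3 W4 W6).
Qed.

(** The reduced curve Y^2 Z = X^3 is singular at (0 : 0 : 1), its only point with Y = 0. Hence c y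
    is a unit, and z = - x / y and w = - 1 / y are integral. *)
Lemma E0_pt P : E0 red W P -> exists g, pt g = P.
Proof.
case: P => [_|x y [C [c [[OX OY OZ] _ ns]]]].
  by exists 0; have := cg_ptM HG 0 0; rewrite mulr0z.
rewrite /= in C OX OY OZ ns; rewrite mulr1 in OZ ns.
have Y0 : bar (c * y) != 0.
  apply/negP => /eqP Y0.
  have X0 : bar (c * x) = 0.
    (* [T] collects the terms of the homogeneous equation that carry an a_i, and therefore reduces
       to 0. *)
    pose T := wa1 W * ((c * x) * (c * y) * c) + wa3 W * ((c * y) * c ^+ 2)
      - wa2 W * ((c * x) ^+ 2 * c) - wa4 W * ((c * x) * c ^+ 2) - wa6 W * c ^+ 3.
    have E : (c * x) ^+ 3 = (c * y) * (c * y * c) + T.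
      transitivity (c ^+ 3 * (y ^+ 2 + wa1 W * x * y + wa3 W * y
        - wa2 W * x ^+ 2 - wa4 W * x - wa6 W)); last by rewrite /T; ring.
      by rewrite C; ring.
    have IT a t : a \in I 1 -> t \in O -> a * t \in I 1.
      by move=> Ia Ot; apply: (idealMl HI); rewrite ?pideal0E.
    have I1T : T \in I 1.
      have M1 := IT _ _ W1 (rpredM (rpredM OX OY) OZ).
      have M3 := IT _ _ W3 (rpredM OY (rpredX 2 OZ)).
      have M2 := IT _ _ W2 (rpredM (rpredX 2 OX) OZ).
      have M4 := IT _ _ W4 (rpredM OX (rpredX 2 OZ)).
      have M6 := IT _ _ W6 (rpredX 3 OZ).
      exact: (idealB HI (idealB HI (idealB HI (idealD HI M1 M3) M2) M4) M6).
    have OT : T \in O by rewrite -pideal0E (idealS HI).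
    apply/eqP; have : bar (c * x) ^+ 3 == 0.
      rewrite -reduceX // E (reduceD red (rpredM OY (rpredM OY OZ)) OT) (bar_ideal1 I1T).
      by rewrite addr0 (reduceM red OY (rpredM OY OZ)) Y0 mul0r.
    by rewrite expf_eq0.
  move: ns; rewrite /nonsingular /= (bar_ideal1 W1) (bar_ideal1 W2) (bar_ideal1 W3)
    (bar_ideal1 W4) (bar_ideal1 W6) X0 Y0.
  by rewrite !(expr0n, mul0r, mulr0, subr0, addr0, subrr, oppr0) /= !eqxx; case.
have [cy0 Oinv] : c * y != 0 /\ (c * y)^-1 \in O.
  by apply: (unit_inv unrK OY); rewrite -(reduce_eq0 unrK red_residue).
have y0 : y != 0 by apply: contraNneq cy0 => ->; rewrite mulr0.
have c0 : c != 0 by apply: contraNneq cy0 => ->; rewrite mul0r.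
have Iz : - x / y \in I 0.
  rewrite pideal0E (_ : - x / y = - (c * x) * (c * y)^-1); last by field; rewrite y0 c0.
  by rewrite rpredM ?rpredN.
have Iw : - y^-1 \in I 0.
  rewrite pideal0E (_ : - y^-1 = - c * (c * y)^-1); last by field; rewrite y0 c0.
  by rewrite rpredM ?rpredN.
have [g Eg] := cg_ex HG Iz; exists g; rewrite (cg_pt HG).
have Cg := cg_on HG g; rewrite Eg in Cg *.
rewrite (chart_unique Iz (cg_w HG g) Iw Cg (curve_on_chart y0 C)).
exact: chart_point_curve.
Qed.

(** The points are rescaled to the common factor [hom_scale g], which leaves the convergent
    coordinates (z : -1 : w). If p^M clears the denominator of this factor, at most M digits are
    lost. *)
Lemma point_cvg_pt (u : nat -> G) g :
    (forall N, \forall j \near \oo%classic, eqmod I N (z (u j)) (z g)) ->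
  point_cvg (fun j => pt (u j)) (pt g).
Proof.
move=> Hu; have [EX EY EZ] := hom_pt g.
have [M HM] := pX_integral (hom_scale g).
have cvg_scale x y : (forall N, \forall j \near \oo%classic, eqmod I N (x j) y) ->
    padic_cvg (fun j => hom_scale g * x j) (hom_scale g * y).
  move=> Hx N; apply: filterS (Hx (N + M)%N) => j /pidealP[t Ot Et].
  exists (p%:R ^+ M * hom_scale g * t); first by rewrite rpredM.
  by rewrite -mulrBr Et exprD; ring.
have cE j x : hom_scale g / hom_scale (u j) * (hom_scale (u j) * x) = hom_scale g * x.
  by rewrite mulrA divfK ?hom_scale_neq0.
exists (fun j => hom_scale g / hom_scale (u j)); split.
- by move=> j; rewrite mulf_neq0 ?invr_eq0 ?hom_scale_neq0.
- rewrite EX (_ : (fun j => _) = (fun j => hom_scale g * z (u j))); first exact: cvg_scale.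
  by apply/funext => j; have [-> _ _] := hom_pt (u j); rewrite cE.
- rewrite EY -mulrN1 (_ : (fun j => _) = (fun j => hom_scale g * -1)).
    by apply: cvg_scale => N; apply: filterE => j; apply: (cong_refl HI).
  by apply/funext => j; have [_ -> _] := hom_pt (u j); rewrite -(mulrN1 (hom_scale (u j))) cE.
- rewrite EZ (_ : (fun j => _) = (fun j => hom_scale g * w (u j))).
    by apply: cvg_scale => N; apply: filterS (Hu N) => j; apply: (cg_eqmod_w HG).
  by apply/funext => j; have [_ _ ->] := hom_pt (u j); rewrite cE.
Qed.

Lemma E0_isomorphic_of_action (s : Zp -> G -> G) (M : lmodType Zp) (f : M -> G) :
    zp_action (point_fil z) s -> (forall x y, f (x + y) = f x + f y) ->
    (forall a x, f (a *: x) = s a (f x)) -> bijective f ->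
  E0_isomorphic red W M.
Proof.
move=> Hs fD fZ f_bij; exists (pt \o f); split.
- split.
  + by move=> x _; apply: pt_in_E0.
  + by move=> x y _ _ /(cg_pt_inj HG)/(bij_inj f_bij).
  + move=> P /E0_pt[g <-]; have [f' _ f'K] := f_bij.
    by exists (f' g); rewrite //= f'K.
- by move=> x y; rewrite /= fD (cg_ptD HG).
- move=> a x m Hm; rewrite /= (_ : (fun j => _) = (fun j => pt (f x *~ m j))); last first.
    by apply/funext => j; rewrite (cg_ptM HG).
  apply: point_cvg_pt => N; apply: filterS (Hm N) => j Ej.
  have F0 : f x \in point_fil z 0 by rewrite unfold_in (cg_z HG).
  have HF := point_filtration unrK red_residue HG.
  apply: (cong_of_fil unrK red_residue HG); rewrite fZ.
  rewrite -(subrKA (f x *~ padic_res a N)) (filD HF) //.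
    by rewrite -mulrzBr (fil0_dvd HF F0) // -eqz_mod_dvd Ej.
  by rewrite -opprB (filN HF) // Hs.
Qed.

End NonsingularPoints.

Lemma E0_isomorphic_transfer (p : nat) (pr_p : prime p) (K : fieldExtType (padic pr_p))
    (k : finFieldType) (red : {rmorphism int_ring K -> k}) (W : weierstrass K)
    (M N : lmodType (padic_int pr_p)) (h : N -> M) :
    (forall x y, h (x + y) = h x + h y) -> (forall a x, h (a *: x) = a *: h x) ->
  bijective h -> E0_isomorphic red W M -> E0_isomorphic red W N.
Proof.
move=> hD hZ [h' hK h'K] [f [[f_fun f_inj f_surj] fD fZ]].
exists (f \o h); split=> [|x y|a x]; [|by rewrite /= hD fD|by rewrite /= hZ; apply: fZ].
split=> [x _|x y _ _ E|P /f_surj[u _ <-]]; first exact: f_fun.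
  by apply: (can_inj hK); apply: f_inj; rewrite ?in_setT.
by exists (h' u); rewrite //= h'K.
Qed.

(** * The kernel of psi prime by prime, and the conclusion *)

(** The kernel consists of roots of a nonzero polynomial of degree at most p, so an order p^b forces
    b <= 1. By [prime_normP] a nonzero root exists exactly when c has norm 1. *)
Lemma frobenius_kernel_card (k : finFieldType) (p b : nat) (c : k) (f : k -> k) :
    p \in [pchar k] -> (forall t, f t = t - c * t ^+ p) ->
    #|[set t | f t == 0]| = (p ^ b)%N ->
  (prime_norm c = 1 -> b = 1%N) /\ (prime_norm c <> 1 -> b = 0%N).
Proof.
move=> pk fE card_f; have pr_p := pcharf_prime pk; have p1 := prime_gt1 pr_p.
have f0 : f 0 = 0 by rewrite fE expr0n gtn_eqF ?prime_gt0 // mulr0 subrr.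
split=> [/(prime_normP _ pk)[t t0 Ec] | Nc].
  have tK : t \in [set t | f t == 0].
    by rewrite inE fE Ec divfK ?subrr // expf_neq0.
  have lt1 : (1 < p ^ b)%N.
    rewrite -card_f (cardD1 0) (cardD1 t) !inE f0 eqxx t0 /=.
    by move: tK; rewrite inE => ->.
  have lep : (p ^ b <= p ^ 1)%N.
    rewrite -card_f expn1 -ltnS cardE.
    pose P : {poly k} := 'X - c *: 'X^p.
    have sP : (size P <= p.+1)%N.
      rewrite (leq_trans (size_polyD _ _)) // geq_max size_polyX ltnS ltnW //=.
      by rewrite size_polyN (leq_trans (size_scale_leq _ _)) // size_polyXn.
    apply: leq_trans sP; apply: max_poly_roots; last exact: enum_uniq.
      apply/eqP => /(congr1 (fun q : {poly k} => q`_1)).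
      rewrite coefB coefX coefZ coefXn coef0 eqxx ltn_eqF // mulr0 subr0 => /eqP.
      by rewrite oner_eq0.
    apply/allP => x; rewrite mem_enum inE fE => /eqP E.
    by rewrite /root !hornerE E.
  move: lt1 lep; rewrite leq_exp2l // -{1}(expn0 p) ltn_exp2l //.
  by case: b {card_f} => [|[|b]].
apply/eqP; rewrite -(eqn_exp2l _ _ p1) expn0 -card_f.
apply/cards1P; exists 0; apply/setP => t; rewrite !inE; apply/eqP/eqP => [|->//].
rewrite fE => /eqP; rewrite subr_eq0 => /eqP Et; apply/eqP; apply/negPn/negP => t0.
by apply: Nc; apply/(prime_normP _ pk); exists t; rewrite // {1}Et mulfK // expf_neq0.
Qed.

Section MultiplicationByP.
Variables (p : nat) (pr_p : prime p) (K : fieldExtType (padic pr_p)).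
Variables (k : finFieldType) (red : {rmorphism int_ring K -> k}) (W : weierstrass K).
Hypothesis pk : p \in [pchar k].
Local Notation bar := (reduce red).
Local Notation psi := (mul_p_gr red W).

Lemma mul_coef1_eq0 : ~~ (p %| 2)%N -> (mul_coef1 p)%:R = 0 :> k.
Proof.
move=> pc; apply/eqP; rewrite -(dvdn_pcharf pk).
by apply: (@dvdn_mul_coef _ 2 _ 1 1); rewrite // !mul1n mul_coef1E.
Qed.

Lemma mul_coef2_eq0 : ~~ (p %| 3)%N -> (mul_coef2 p)%:R = 0 :> k.
Proof.
move=> pc; apply/eqP; rewrite -(dvdn_pcharf pk).
by apply: (@dvdn_mul_coef _ 3 _ 1 2); rewrite // !mul1n mul_coef2E.
Qed.

Lemma mul_coef3_eq0 : ~~ (p %| 2)%N -> (mul_coef3 p)%:R = 0 :> k.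
Proof.
move=> pc; apply/eqP; rewrite -(dvdn_pcharf pk).
by apply: (@dvdn_mul_coef _ 2 _ 1 3); rewrite // !mul1n mul_coef3E.
Qed.

Lemma mul_coef4_eq0 : ~~ (p %| 5)%N -> (mul_coef4 p)%:R = 0 :> k.
Proof.
move=> pc; apply/eqP; rewrite -(dvdn_pcharf pk).
by apply: (@dvdn_mul_coef _ 5 _ 2 4); rewrite // mul_coef4E.
Qed.

Lemma mul_coef6_eq0 : ~~ (p %| 7)%N -> (mul_coef6 p)%:R = 0 :> k.
Proof.
move=> pc; apply/eqP; rewrite -(dvdn_pcharf pk).
by apply: (@dvdn_mul_coef _ 7 _ 3 6); rewrite // mul_coef6E.
Qed.

Lemma mul_p_gr2 t : p = 2%N ->
  psi t = - (bar (wa3 W / 2%:R) * t ^+ 4 + bar (wa1 W / 2%:R) * t ^+ 2 - t).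
Proof.
move=> Ep; have two0 : 2%:R = 0 :> k by apply/eqP; rewrite -(dvdn_pcharf pk) Ep.
have pR := congr1 (fun m : nat => m%:R : K) Ep.
have e1 : (mul_coef1 p)%:R = 1 :> k by rewrite Ep /mul_coef1 !big_ord_recr big_ord0.
have e3 : (mul_coef3 p)%:R = 1 :> k.
  rewrite Ep /mul_coef3 !big_ord_recr big_ord0 /= (_ : (_ + _)%N = 1 + 2 * 3)%N //.
  by rewrite natrD natrM two0 mul0r addr0.
rewrite /mul_p_gr e1 e3 mul_coef2_eq0 ?mul_coef4_eq0 ?mul_coef6_eq0 ?Ep // pR.
by ring.
Qed.

Lemma reduce_natM m (a : K) q : a \in @pideal p pr_p K 1 -> p = q ->
  bar (m%:R * a / q%:R) = m%:R * bar (a / p%:R).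
Proof.
move=> Ia Ep; rewrite -mulrA -(congr1 (fun m : nat => m%:R : K) Ep).
by rewrite reduceM ?rpred_nat // reduce_nat.
Qed.

(** The constant 8 is (3^3 - 3) / 3; the other four coefficients are divisible by 3. *)
Lemma mul_p_gr3 t : wa2 W \in @pideal p pr_p K 1 -> p = 3%N ->
  psi t = t - bar (8%:R * wa2 W / 3%:R) * t ^+ p.
Proof.
move=> I2 Ep; rewrite (reduce_natM _ I2 Ep).
have e2 : mul_coef2 p = 8 by rewrite Ep /mul_coef2 !big_ord_recr big_ord0.
rewrite /mul_p_gr mul_coef1_eq0 ?mul_coef3_eq0 ?mul_coef4_eq0 ?mul_coef6_eq0 ?[in ~~ _]Ep //.
rewrite e2 (_ : t ^+ p = t ^+ 3); last by rewrite Ep.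
by ring.
Qed.

Lemma mul_p_gr5 t : wa4 W \in @pideal p pr_p K 1 -> p = 5%N ->
  psi t = t - bar (3%:R * wa4 W / 5%:R) * t ^+ p.
Proof.
move=> I4 Ep; rewrite (reduce_natM _ I4 Ep).
have p0 : 5%:R = 0 :> k by apply/eqP; rewrite -(dvdn_pcharf pk) Ep.
have e4 : (mul_coef4 p)%:R = 3%:R :> k.
  (* The coefficient is 2 (5^5 - 5) / 5 = 1248, which is 3 modulo 5. *)
  have -> : mul_coef4 p = (3 + 5 * 249)%N by rewrite Ep /mul_coef4 !big_ord_recr big_ord0.
  by rewrite natrD natrM p0 mul0r addr0.
rewrite /mul_p_gr mul_coef1_eq0 ?mul_coef2_eq0 ?mul_coef3_eq0 ?mul_coef6_eq0 ?[in ~~ _]Ep //.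
rewrite e4 (_ : t ^+ p = t ^+ 5); last by rewrite Ep.
by ring.
Qed.

Lemma mul_p_gr7 t : wa6 W \in @pideal p pr_p K 1 -> p = 7%N ->
  psi t = t - bar (4%:R * wa6 W / 7%:R) * t ^+ p.
Proof.
move=> I6 Ep; rewrite (reduce_natM _ I6 Ep).
have p0 : 7%:R = 0 :> k by apply/eqP; rewrite -(dvdn_pcharf pk) Ep.
have e6 : (mul_coef6 p)%:R = 4%:R :> k.
  (* Dividing the closed form by 7 shows that the coefficient is - 3 = 4 modulo 7. *)
  have E : (mul_coef6 p + 3 = 3 * p ^ 6)%N.
    apply/eqP; rewrite -(eqn_pmul2r (prime_gt0 pr_p)) -mulnA -expnSr mulnDl.
    by rewrite [(mul_coef6 p * p)%N]mulnC {1}Ep mul_coef6E.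
  have /eqP := congr1 (fun m => m%:R : k) E.
  rewrite natrD natrM natrX (pcharf0 pk) expr0n mulr0 addr_eq0 => /eqP->.
  by apply/eqP; rewrite eq_sym -subr_eq0 opprK -natrD p0.
rewrite /mul_p_gr mul_coef1_eq0 ?mul_coef2_eq0 ?mul_coef3_eq0 ?mul_coef4_eq0 ?[in ~~ _]Ep //.
rewrite e6 (_ : t ^+ p = t ^+ 7); last by rewrite Ep.
by ring.
Qed.

Lemma mul_p_gr_id t : p <> 2%N -> p <> 3%N -> p <> 5%N -> p <> 7%N -> psi t = t.
Proof.
move=> p2 p3 p5 p7.
have ndvd q : prime q -> p <> q -> ~~ (p %| q)%N by move=> pr_q /eqP; rewrite dvdn_prime2.
rewrite /mul_p_gr mul_coef1_eq0 ?mul_coef2_eq0 ?mul_coef3_eq0 ?mul_coef4_eq0 ?mul_coef6_eq0 ?ndvd //.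
by ring.
Qed.

End MultiplicationByP.

Theorem theorem1 (p : nat) (pr_p : prime p) (n : nat)
    (K : fieldExtType (padic pr_p)) (dimK : \dim {:K} = n)
    (unrK : unramified K)
    (k : finFieldType) (red : {rmorphism int_ring K -> k})
    (red_residue : is_residue_map red)
    (a1 a2 a3 a4 a6 : K)
    (a1m : a1 \in max_ideal K) (a2m : a2 \in max_ideal K) (a3m : a3 \in max_ideal K)
    (a4m : a4 \in max_ideal K) (a6m : a6 \in max_ideal K)
    (elliptic : wdisc (Weierstrass a1 a2 a3 a4 a6) != 0) :
  let bar := reduce red in
  let E := Weierstrass a1 a2 a3 a4 a6 in
  let case_i := p = 2%N /\
    exists x : k, bar (a3 / 2%:R) * x ^+ 3 + bar (a1 / 2%:R) * x - 1 = 0 in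
  let case_ii := p = 3%N /\ prime_norm (bar (8%:R * a2 / 3%:R)) = 1 in
  let case_iii := p = 5%N /\ prime_norm (bar (3%:R * a4 / 5%:R)) = 1 in
  let case_iv := p = 7%N /\ prime_norm (bar (4%:R * a6 / 7%:R)) = 1 in
  [/\ ~ [\/ case_i, case_ii, case_iii | case_iv] ->
        E0_isomorphic red E 'rV[padic_int pr_p]_n,
      case_i -> exists b : nat,
        #|[set X : k | bar (a3 / 2%:R) * X ^+ 4 + bar (a1 / 2%:R) * X ^+ 2 - X
                       == 0]| = (2 ^ b)%N /\
        E0_isomorphic red E
          ('rV[padic_int pr_p]_n * {ffun 'I_b -> Zmodp pr_p})%type &
      [\/ case_ii, case_iii | case_iv] ->
        E0_isomorphic red E ('rV[padic_int pr_p]_n * Zmodp pr_p)%type].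
Proof.
move=> bar E case_i case_ii case_iii case_iv.
have HI := pideal_filtered_field unrK red_residue.
have pk := residue_pchar unrK red_residue; have p1 := prime_gt1 pr_p.
rewrite !(max_ideal_pideal unrK) in a1m a2m a3m a4m a6m.
have [G [z [w [pt HG]]]] := @chart_group_exists _ _ E HI a1m a2m a3m a4m a6m.
have [d [iota [iotaD iota_bij]]] := finField_coords pk.
have Ed : d = n by rewrite -dimK (dim_residue unrK red_residue iotaD iota_bij).
subst d.
have [b [card_b [s [f [Hs fD fZ f_bij]]]]] :=
  point_module_structure unrK red_residue iotaD iota_bij HG a1m a2m a3m a4m a6m.
have iso : E0_isomorphic red E ('rV[padic_int pr_p]_n * {ffun 'I_b -> Zmodp pr_p})%type.
  exact: (E0_isomorphic_of_action unrK red_residue HG a1m a2m a3m a4m a6m Hs fD fZ f_bij).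
have iso0 : b = 0%N -> E0_isomorphic red E 'rV[padic_int pr_p]_n.
  move=> b0; apply: (E0_isomorphic_transfer (h := fun u => (u, 0)) _ _ _ iso).
  - by move=> x y; congr pair; rewrite addr0.
  - by move=> a x; congr pair; rewrite scaler0.
  exists fst => // -[u t] /=; congr pair; apply/ffunP => i.
  by have := ltn_ord i; rewrite {2}b0.
have iso1 : b = 1%N -> E0_isomorphic red E ('rV[padic_int pr_p]_n * Zmodp pr_p)%type.
  move=> b1; have i0 : 'I_b by rewrite b1; exact: ord0.
  pose h (u : 'rV[padic_int pr_p]_n * Zmodp pr_p) :
    'rV[padic_int pr_p]_n * {ffun 'I_b -> Zmodp pr_p} := (u.1, [ffun=> u.2]).
  apply: (E0_isomorphic_transfer (h := h) _ _ _ iso).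
  - by move=> x y; congr pair; apply/ffunP => i; rewrite !ffunE.
  - by move=> a x; congr pair; apply/ffunP => i; rewrite !ffunE.
  exists (fun u : 'rV[padic_int pr_p]_n * {ffun 'I_b -> Zmodp pr_p} => (u.1, u.2 i0))
    => -[u t]; first by rewrite /= ffunE.
  congr pair; apply/ffunP => i; rewrite ffunE; congr (t _); apply: val_inj.
  by case: (i) (i0) => [i' Hi] [j' Hj] /=; move: Hi Hj; rewrite b1 !ltnS !leqn0 => /eqP-> /eqP->.
have kernel3 (Ep : p = 3%N) :=
  frobenius_kernel_card pk (fun t => @mul_p_gr3 p pr_p K k red E pk t a2m Ep) card_b.
have kernel5 (Ep : p = 5%N) :=
  frobenius_kernel_card pk (fun t => @mul_p_gr5 p pr_p K k red E pk t a4m Ep) card_b.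
have kernel7 (Ep : p = 7%N) :=
  frobenius_kernel_card pk (fun t => @mul_p_gr7 p pr_p K k red E pk t a6m Ep) card_b.
split=> [ncases|[Ep _]|cases]; last 1 first.
- by apply: iso1; case: cases => -[Ep N1];
    [apply: (kernel3 Ep).1 | apply: (kernel5 Ep).1 | apply: (kernel7 Ep).1].
- apply: iso0.
  have [p2|p2] := eqVneq p 2%N.
    apply/eqP; rewrite -(eqn_exp2l _ _ p1) expn0 -card_b; apply/cards1P; exists 0.
    apply/setP => t; rewrite !inE (mul_p_gr2 red E pk t p2); apply/eqP/eqP => [Et | ->].
      apply/eqP; apply/negPn/negP => t0; apply: ncases; apply: Or41; split=> //.
      (* psi(t) is - t times the cubic of case (i), so a nonzero element of the kernel solves that
         cubic. *)
      exists t; apply: (mulfI t0); rewrite mulr0 -[RHS]oppr0 -[in RHS]Et opprK; ring.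
    by rewrite !expr0n !mulr0 addr0 subrr oppr0.
  have [p3|/eqP p3] := eqVneq p 3%N.
    by apply: (kernel3 p3).2 => N1; apply: ncases; apply: Or42.
  have [p5|/eqP p5] := eqVneq p 5%N.
    by apply: (kernel5 p5).2 => N1; apply: ncases; apply: Or43.
  have [p7|/eqP p7] := eqVneq p 7%N.
    by apply: (kernel7 p7).2 => N1; apply: ncases; apply: Or44.
  apply/eqP; rewrite -(eqn_exp2l _ _ p1) expn0 -card_b; apply/cards1P; exists 0.
  by apply/setP => t; rewrite !inE mul_p_gr_id // => /eqP E2; rewrite E2 in p2.
- exists b; split=> //; rewrite -[X in (X ^ _)%N]Ep -card_b.
  apply: eq_card => t; rewrite !inE (mul_p_gr2 red E pk t Ep).
  by rewrite oppr_eq0.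
Qed.
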